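(* Let $\mu$ be a finite positive Borel measure on $\overline{\mathbb D}$ and $\Psi_1,\Psi_2$ Orlicz functions. 1) If the identity maps $H^{\Psi_1}$ compactly into $L^{\Psi_2}(\mu)$, then for every $A>0$, $\rho_\mu(h)=o\Big(\dfrac{1}{\Psi_2(A\Psi_1^{-1}(1/h))}\Big)$ as $h\to0$. 2) If $\mu(\mathbb T)=0$ and for every $A>0$, $K_\mu(h)=o\Big(\dfrac{1/h}{\Psi_2(A\Psi_1^{-1}(1/h))}\Big)$ as $h\to0$, then the identity maps $H^{\Psi_1}$ compactly into $L^{\Psi_2}(\mu)$. 3) If $\Psi_1=\Psi_2=\Psi$ satisfies $\nabla_0$, then the following are equivalent: the identity $H^\Psi\to L^\Psi(\mu)$ is compact; the condition in 1) holds for every $A>0$; the condition on $K_\mu$ in 2) holds for every $A>0$.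
   Context: An Orlicz function is a continuous, strictly convex, increasing $\Psi\colon[0,\infty)\to[0,\infty)$ with $\Psi(0)=0$ and $\Psi(x)/x\to\infty$. $L^\Psi(\nu)$ with Luxemburg norm $\inf\{C>0:\int\Psi(|f|/C)\,d\nu\le1\}$. $H^\Psi$ = analytic $f$ on $\mathbb D$ with $\sup_{r<1}\|f(re^{i\cdot})\|_{L^\Psi(m)}<\infty$ ($m$ normalized measure on $\mathbb T$), with boundary function $f^*$; an $f\in H^\Psi$ is regarded as a function on $\overline{\mathbb D}$ equal to $f$ on $\mathbb D$ and $f^*$ on $\mathbb T$. $W(\xi,h)=\{z\in\overline{\mathbb D}:1-h<|z|\le1,\ |\arg(z\bar\xi)|<h\}$; $\rho_\mu(h)=\sup_{\xi\in\mathbb T}\mu(W(\xi,h))$; $K_\mu(h)=\sup_{0<t\le h}\rho_\mu(t)/t$. $\Psi$ satisfies $\nabla_0$ if there are $x_0>0$ and $C\ge1$ with $\frac{\Psi(2x)}{\Psi(x)}\le\frac{\Psi(2Cy)}{\Psi(y)}$ for all $x_0\le x\le y$. *)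

(* Defs.v *)
(* R : realType, complex numbers R[i] from
   mathcomp-real-closed; the closed disc is viewed inside R * R (product
   Borel sigma-algebra) so that measures on it are MathComp measures. *)
From mathcomp Require Import all_boot all_order all_algebra.
From mathcomp Require Import all_classical all_reals all_analysis.
From mathcomp Require Import complex.
Import Order.TTheory GRing.Theory Num.Theory numFieldNormedType.Exports.

Set Implicit Arguments.
Unset Strict Implicit.
Unset Printing Implicit Defensive.

Local Open Scope classical_set_scope.
Local Open Scope ring_scope.

Section OrliczDefs.
Variable R : realType.

Definition cabs (z : R[i]) : R :=
  Num.sqrt (complex.Re z ^+ 2 + complex.Im z ^+ 2).

Definition expi (t : R) : R[i] := (cos t +i* sin t)%C.

Definition toC (p : (R * R)%type) : R[i] := (p.1 +i* p.2)%C.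

Definition cdisc : set (R * R)%type := [set p | cabs (toC p) <= 1].
Definition ucircle : set (R * R)%type := [set p | cabs (toC p) = 1].

Definition orlicz (Psi : R -> R) : Prop :=
  [/\ {within [set x : R | 0 <= x], continuous Psi},
      Psi 0 = 0,
      (forall x y : R, 0 <= x -> x <= y -> Psi x <= Psi y),
      (forall x y t : R, 0 <= x -> 0 <= y -> x != y -> 0 < t < 1 ->
          Psi (t * x + (1 - t) * y) < t * Psi x + (1 - t) * Psi y) &
      (forall M : R, exists x0 : R, forall x, x0 < x -> M < Psi x / x)].

Definition orlicz_inv (Psi : R -> R) (y : R) : R :=
  sup [set x : R | 0 <= x /\ Psi x <= y].

(* Luxemburg norm of a nonnegative function g on D w.r.t. a measure mu:
   inf {C > 0 : int_D Psi(g/C) dmu <= 1}  (+oo if no such C) *)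
Definition luxemburg d (T : measurableType d) (Psi : R -> R)
    (mu : {measure set T -> \bar R}) (D : set T) (g : T -> R) : \bar R :=
  ereal_inf [set C%:E | C in
    [set C : R | 0 < C /\ (\int[mu]_(x in D) (Psi (g x / C))%:E <= 1)%E]].

(* Luxemburg norm in L^Psi(m), m the normalized arc-length measure on T,
   parametrized by t in [0, 2 pi) : dm = dt / (2 pi) *)
Definition luxT (Psi : R -> R) (g : R -> R) : \bar R :=
  ereal_inf [set C%:E | C in
    [set C : R | 0 < C /\
      (((2 * pi)^-1)%:E *
         \int[@lebesgue_measure R]_(t in `[0%R, (2 * pi)%R[) (Psi (g t / C))%:E
         <= 1)%E]].

Definition analytic_disc (f : R[i] -> R[i]) : Prop :=
  exists a : nat -> R[i], forall z : R[i], cabs z < 1 ->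
    forall eps : R, 0 < eps -> exists N : nat, forall n : nat, (N <= n)%N ->
      cabs (f z - \sum_(k < n) a k * z ^+ k) < eps.

Definition hnorm (Psi : R -> R) (f : R[i] -> R[i]) : \bar R :=
  ereal_sup [set luxT Psi (fun t => cabs (f ((r%:C)%C * expi t))) |
               r in [set r : R | 0 <= r < 1]].

Definition in_H (Psi : R -> R) (f : R[i] -> R[i]) : Prop :=
  analytic_disc f /\ (hnorm Psi f < +oo)%E.

Definition radlim (f : R[i] -> R[i]) (xi l : R[i]) : Prop :=
  forall eps : R, 0 < eps -> exists delta : R, 0 < delta /\
    forall r : R, 1 - delta < r < 1 -> cabs (f ((r%:C)%C * xi) - l) < eps.

(* boundary function f^* : radial limit where it exists (0 elsewhere) *)
Definition bnd (f : R[i] -> R[i]) (xi : R[i]) : R[i] :=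
  xget 0 [set l | radlim f xi l].

Definition fext (f : R[i] -> R[i]) (p : (R * R)%type) : R[i] :=
  if cabs (toC p) < 1 then f (toC p) else bnd f (toC p).

Definition LPnorm (Psi : R -> R) (mu : {measure set (R * R)%type -> \bar R})
    (g : (R * R)%type -> R[i]) : \bar R :=
  luxemburg Psi mu cdisc (fun p => cabs (g p)).

Definition compact_embedding (Psi1 Psi2 : R -> R)
    (mu : {measure set (R * R)%type -> \bar R}) : Prop :=
  (forall f, in_H Psi1 f -> (LPnorm Psi2 mu (fext f) < +oo)%E) /\
  (forall u : nat -> R[i] -> R[i],
     (forall n, in_H Psi1 (u n)) ->
     (exists M : R, forall n, (hnorm Psi1 (u n) <= M%:E)%E) ->
     exists (phi : nat -> nat) (g : (R * R)%type -> R[i]),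
       [/\ (forall m n, (m < n)%N -> (phi m < phi n)%N),
           measurable_fun cdisc (fun p => complex.Re (g p)),
           measurable_fun cdisc (fun p => complex.Im (g p)),
           (LPnorm Psi2 mu g < +oo)%E &
           (forall eps : R, 0 < eps -> exists N : nat, forall n, (N <= n)%N ->
              (LPnorm Psi2 mu (fun p => (fext (u (phi n)) p - g p)%R) <= eps%:E)%E)]).

Definition window (theta h : R) : set (R * R)%type :=
  [set p | 1 - h < cabs (toC p) <= 1 /\
     exists phi : R, toC p = ((cabs (toC p))%:C)%C * expi phi /\ `|phi - theta| < h].

Definition rho (mu : {measure set (R * R)%type -> \bar R}) (h : R) : \bar R :=
  ereal_sup [set mu (window theta h) | theta in [set: R]].

Definition Kmu (mu : {measure set (R * R)%type -> \bar R}) (h : R) : \bar R :=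
  ereal_sup [set (rho mu t * (t^-1)%:E)%E | t in [set t : R | 0 < t <= h]].

Definition rho_cond (Psi1 Psi2 : R -> R)
    (mu : {measure set (R * R)%type -> \bar R}) : Prop :=
  forall A : R, 0 < A -> forall eps : R, 0 < eps ->
    exists delta : R, 0 < delta /\ forall h : R, 0 < h < delta ->
      (rho mu h <= (eps * (1 / Psi2 (A * orlicz_inv Psi1 h^-1)))%:E)%E.

Definition K_cond (Psi1 Psi2 : R -> R)
    (mu : {measure set (R * R)%type -> \bar R}) : Prop :=
  forall A : R, 0 < A -> forall eps : R, 0 < eps ->
    exists delta : R, 0 < delta /\ forall h : R, 0 < h < delta ->
      (Kmu mu h <= (eps * (h^-1 / Psi2 (A * orlicz_inv Psi1 h^-1)))%:E)%E.

Definition nabla0 (Psi : R -> R) : Prop :=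
  exists x0 C : R, [/\ 0 < x0, 1 <= C &
    forall x y : R, x0 <= x -> x <= y ->
      Psi (2 * x) / Psi x <= Psi (2 * C * y) / Psi y].

End OrliczDefs.

(* Main.v *)
(** Part 1.  If the condition on [rho] fails along windows of size [h], the peaks
    [a (h / (1 - (1 - h) e^{-i th} z))^2] with [a = Psi1^{-1}(1/h)] lie in the unit ball of
    [H^Psi1], because convexity bounds [Psi1] of their modulus by a Poisson kernel; they are at most
    [a] everywhere and at least [a / 6] on the window.  If their images accumulate at [g], then on a
    window whose [a] is large compared with an earlier peak, one of the two peaks is at distance
    at least [a / 24] from [g] at each point, and Chebyshev's inequality bounds the mass of the
    window by [2 / Psi2 (K A a)] for a prescribed [K].

    Part 2.  For a polynomial [p] the function [|p|^{1/2}] is dominated by the Poisson integral of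
    its boundary values.  A dyadic stopping-time argument on arcs, applied to the excess of
    [|p|^{1/2}] over a level [k], covers [|p| > (c k)^2] by windows whose total mass is
    controlled by [Kmu] at scale [1 / Psi1 (k^2)] and the integral of the excess.  Summing over dyadic
    levels shows that [Psi2 (|p| / eps)] has uniformly small tails in [L^1 mu] over the unit ball of
    [H^Psi1]; the estimate passes to analytic functions by Fatou.  Locally uniformly
    convergent subsequences then converge in norm, since thin annuli have small mass.

    Part 3.  Iterating [nabla0] compares [Psi (A x) / Psi x] with [Psi (A' y) / Psi y] for [x <= y],
    which transfers the bound on [rho] at scale [t] to [Kmu] at scale [h >= t].  At [A = 1] the bound reads
    [rho h = o(h)], so that covering the circle by [O(1 / h)] windows shows that it is null. *)
Require Import Defs.
From mathcomp Require Import all_boot all_order all_algebra.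
From mathcomp Require Import all_classical all_reals all_analysis.
From mathcomp Require Import complex.
From mathcomp Require Import measurable_realfun.
From mathcomp Require Import ring lra.
Import Order.TTheory GRing.Theory Num.Theory.
Import numFieldNormedType.Exports.
Local Open Scope classical_set_scope.
Local Open Scope ring_scope.
Set Implicit Arguments.
Unset Strict Implicit.
Unset Printing Implicit Defensive.

(** * Modulus and polar form *)

Section ComplexAbs.
Variable R : realType.
Implicit Types z w : R[i].

(** The obstacle is that no growth condition is imposed on [Psi1], so maximal functions need not act
    on the Orlicz space: for |f| itself convexity bounds the contribution of every level by Psi1
    |f|, and the sum over levels may diverge. The square root repairs this. With v = |f|^{1/2} the
    relevant function is x -> Psi1 (x^2), and Psi1 (k^2) <= (k / v)^2 Psi1 (v^2) for k <= v. Level k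
    then contributes at most (k / v) Psi1 (v^2), and dyadic levels add up geometrically. The price
    is the mean value inequality for |p|^{1/2}. For polynomials it comes from the Poisson formula
    applied to approximate polynomial square roots of a majorant whose modulus agrees with |p| on
    the circle, so no theory of subharmonic functions enters. The boundary function is obtained by a
    pointwise choice, hence is not known to be measurable. It is met only where it is harmless: on a
    null circle, or for test functions continuous up to the circle. Integrals involving it are
    compared by inequalities valid without measurability. *)

Lemma cabsE z : (cabs z)%:C%C = `|z|.
Proof. by rewrite normc_def. Qed.

Lemma cabsM z w : cabs (z * w) = cabs z * cabs w.
Proof. by apply: complexI; rewrite rmorphM /= !cabsE normrM. Qed.

Lemma cabsD z w : cabs (z + w) <= cabs z + cabs w.
Proof. by rewrite -lecR rmorphD /= !cabsE ler_normD. Qed.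

Lemma cabsN z : cabs (- z) = cabs z.
Proof. by apply: complexI; rewrite !cabsE normrN. Qed.

Lemma cabsB z w : cabs (z - w) <= cabs z + cabs w.
Proof. by rewrite -(cabsN w) cabsD. Qed.

Lemma cabsC z w : cabs (z - w) = cabs (w - z).
Proof. by rewrite -cabsN opprB. Qed.

Lemma cabs_ge0 z : 0 <= cabs z.
Proof. exact: sqrtr_ge0. Qed.

Lemma cabs0 : cabs (0 : R[i]) = 0.
Proof. by rewrite /cabs /= expr0n /= addr0 sqrtr0. Qed.

Lemma cabs1 : cabs (1 : R[i]) = 1.
Proof. by apply: complexI; rewrite cabsE normr1. Qed.

Lemma cabsX z n : cabs (z ^+ n) = cabs z ^+ n.
Proof. by apply: complexI; rewrite rmorphXn /= !cabsE normrX. Qed.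

Lemma cabsV z : cabs (z^-1) = (cabs z)^-1.
Proof. by apply: complexI; rewrite fmorphV /= !cabsE normfV. Qed.

Lemma cabs_eq0 z : (cabs z == 0) = (z == 0).
Proof. by rewrite -(inj_eq (@complexI R)) cabsE normr_eq0. Qed.

Lemma cabsR (x : R) : cabs (x%:C%C) = `|x|.
Proof. by rewrite /cabs /= expr0n /= addr0 sqrtr_sqr. Qed.

Lemma cabs_sum (I : Type) (r : seq I) (P : pred I) (F : I -> R[i]) :
  cabs (\sum_(i <- r | P i) F i) <= \sum_(i <- r | P i) cabs (F i).
Proof.
elim/big_ind2: _ => [|z x w y zx wy|//]; first by rewrite cabs0.
by apply: le_trans (cabsD _ _) _; rewrite lerD.
Qed.

Lemma sqr_cabs z : cabs z ^+ 2 = complex.Re z ^+ 2 + complex.Im z ^+ 2.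
Proof. by rewrite sqr_sqrtr // addr_ge0 // sqr_ge0. Qed.

Lemma Re_le_cabs z : `|complex.Re z| <= cabs z.
Proof. by rewrite -sqrtr_sqr ler_wsqrtr // lerDl sqr_ge0. Qed.

Lemma Im_le_cabs z : `|complex.Im z| <= cabs z.
Proof. by rewrite -sqrtr_sqr ler_wsqrtr // lerDr sqr_ge0. Qed.

Lemma cabs_le_ReIm z : cabs z <= `|complex.Re z| + `|complex.Im z|.
Proof.
rewrite -(ler_pXn2r (ltn0Sn 1)) ?nnegrE ?cabs_ge0 ?addr_ge0 // sqr_cabs.
rewrite -[complex.Re z ^+ 2]real_normK ?num_real// -[complex.Im z ^+ 2]real_normK ?num_real//.
by have := normr_ge0 (complex.Re z); have := normr_ge0 (complex.Im z); nra.
Qed.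

Lemma cabsB_ge z w : cabs z - cabs w <= cabs (z - w).
Proof. by rewrite lerBlDr -{1}(subrK w z) cabsD. Qed.

Lemma cabs_expi (t : R) : cabs (expi t) = 1.
Proof. by rewrite /cabs /= cos2Dsin2 sqrtr1. Qed.

Lemma expi0 : expi (0 : R) = 1.
Proof. by rewrite /expi cos0 sin0. Qed.

Lemma expiD (s t : R) : expi (s + t) = expi s * expi t.
Proof. by rewrite /expi cosD sinD; simpc; congr (_ +i* _)%C; ring. Qed.

Lemma expiX (t : R) n : expi t ^+ n = expi (n%:R * t).
Proof.
elim: n => [|n IH]; first by rewrite expr0 mul0r expi0.
by rewrite exprS IH -expiD -{1}(mul1r t) -mulrDl -natr1 addrC.
Qed.

Lemma ReB z w : complex.Re (z - w) = complex.Re z - complex.Re w.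
Proof. by case: z => a b; case: w. Qed.

Lemma ImB z w : complex.Im (z - w) = complex.Im z - complex.Im w.
Proof. by case: z => a b; case: w. Qed.

Lemma ReM z w : complex.Re (z * w) =
  complex.Re z * complex.Re w - complex.Im z * complex.Im w.
Proof. by case: z => a b; case: w. Qed.

Lemma ImM z w : complex.Im (z * w) =
  complex.Re z * complex.Im w + complex.Im z * complex.Re w.
Proof. by case: z => a b; case: w. Qed.

Lemma ReD z w : complex.Re (z + w) = complex.Re z + complex.Re w.
Proof. by case: z => a b; case: w. Qed.

Lemma ImD z w : complex.Im (z + w) = complex.Im z + complex.Im w.
Proof. by case: z => a b; case: w. Qed.

(** The angle is [acos] of the normalized real part, negated below the real axis. Its range is
    recorded because [windowE] inverts the cosine on |g|. *)
Lemma polar_pi z : exists2 g : R, `|g| <= pi & z = (cabs z)%:C%C * expi g.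
Proof.
have [->|z0] := eqVneq z 0.
  by exists 0; rewrite ?normr0 ?pi_ge0 // cabs0 mul0r.
have c0 : 0 < cabs z by rewrite lt_neqAle cabs_ge0 eq_sym cabs_eq0 z0.
pose a := complex.Re z / cabs z; pose b := complex.Im z / cabs z.
have ab : a ^+ 2 + b ^+ 2 = 1.
  by rewrite !expr_div_n -mulrDl -sqr_cabs divff // expf_neq0 // gt_eqF.
have a1 : -1 <= a <= 1.
  by rewrite -ler_norml /a normrM normfV (ger0_norm (ltW c0)) ler_pdivrMr // mul1r Re_le_cabs.
have sb : Num.sqrt (1 - a ^+ 2) = `|b| by rewrite -ab addrC addKr sqrtr_sqr.
exists (if 0 <= b then acos a else - acos a).
  by case: ifP => _; rewrite ?normrN ger0_norm ?acos_ge0 ?acos_lepi.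
have -> : expi (if 0 <= b then acos a else - acos a) = (a +i* b)%C.
  case: ifPn => b0; rewrite /expi ?cosN ?sinN acosK ?in_itv //= sin_acos // sb.
    by rewrite ger0_norm.
  by rewrite ltr0_norm ?opprK // ltNge.
rewrite [z in LHS]complexE /a /b; case: z z0 c0 @a @b ab a1 sb => x y ? c0 *.
by simpc; rewrite [_ * (x / _)]mulrC [_ * (y / _)]mulrC !divfK ?gt_eqF.
Qed.

Lemma polar z : exists g : R, z = (cabs z)%:C%C * expi g.
Proof. by have [g _ zg] := polar_pi z; exists g. Qed.

Lemma expi_2pi (t : R) : expi (t + 2 * pi) = expi t.
Proof. by rewrite /expi mulr_natl cosD2pi sinD2pi. Qed.

Lemma polar_2pi z : exists2 g : R, 0 <= g <= 2 * pi & z = (cabs z)%:C%C * expi g.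
Proof.
have [g] := polar_pi z; rewrite ler_norml => /andP[g1 g2] zg; have := pi_ge0 R.
have [g0|g0] := lerP 0 g => p0; first by exists g => //; lra.
by exists (g + 2 * pi); [lra|rewrite expi_2pi].
Qed.

End ComplexAbs.

(** * Integral inequalities without measurability *)

Section MonotoneIntegral.
Context d (T : measurableType d) (R : realType) (mu : {measure set T -> \bar R}).
Local Open Scope ereal_scope.

(** The integral of a nonnegative function is a supremum over simple functions below it, so
    monotonicity survives without measurability. This is what allows [fext], whose boundary values
    come from a choice. *)
Lemma ge0_le_integral_nomeas (D : set T) (f g : T -> \bar R) :
  (forall x, D x -> 0 <= f x) -> (forall x, D x -> f x <= g x) ->
  \int[mu]_(x in D) f x <= \int[mu]_(x in D) g x.
Proof.
move=> f0 fg.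
rewrite !ge0_integralE //; last by move=> x Dx; exact: le_trans (f0 _ Dx) (fg _ Dx).
apply: ereal_sup_le => _ /= [h hf <-]; exists h => //= x.
apply: le_trans (hf x) _; exact: lee_restrict.
Qed.

Lemma markov_nomeas (D B : set T) (f : T -> \bar R) (c : R) :
  measurable D -> measurable B -> B `<=` D -> (0 <= c)%R ->
  (forall x, D x -> 0 <= f x) -> (forall x, B x -> c%:E <= f x) ->
  c%:E * mu B <= \int[mu]_(x in D) f x.
Proof.
move=> mD mB BD c0 f0 fc.
have -> : c%:E * mu B = \int[mu]_(x in D) (cst c%:E \_ B) x.
  by rewrite -integral_mkcondr setIidr // integral_cst.
apply: ge0_le_integral_nomeas => x Dx; rewrite patchE; case: ifPn => //; rewrite ?inE.
- exact: fc.
- by move=> _; exact: f0.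
Qed.

End MonotoneIntegral.

(** * Real-valued integrals of continuous functions *)

Definition RI (R : realType) (a b : R) (f : R -> R) : R :=
  \int[@lebesgue_measure R]_(x in `[a, b]) f x.

Lemma eq_continuous (R : realType) (f g : R -> R) :
  f =1 g -> continuous f -> continuous g.
Proof. by move=> /funext ->. Qed.

Lemma continuous_fcomp (R : realType) (f g : R -> R) :
  continuous f -> continuous g -> continuous (fun x => g (f x)).
Proof. by move=> cf cg x; apply: continuous_comp; [exact: cf|exact: cg]. Qed.

Section ContinuousIntegral.
Variable R : realType.
Implicit Types (a b c : R) (f g : R -> R).
Notation mu := (@lebesgue_measure R).

Lemma RI_integrable a b f : continuous f -> mu.-integrable `[a, b] (EFin \o f).
Proof.
move=> cf; apply: continuous_compact_integrable; first exact: segment_compact.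
exact: continuous_subspaceT.
Qed.

Lemma RI_EFin a b f : continuous f ->
  (\int[mu]_(x in `[a, b]) (f x)%:E = (RI a b f)%:E)%E.
Proof.
move=> cf; rewrite /RI /Rintegral fineK //; apply: integrable_fin_num => //.
exact: RI_integrable.
Qed.

Lemma RI_EFin_co a b f : continuous f ->
  (\int[mu]_(x in `[a, b[) (f x)%:E = (RI a b f)%:E)%E.
Proof.
move=> cf; rewrite -RI_EFin // integral_itv_bndo_bndc //.
apply/measurable_EFinP; apply: measurable_funTS; exact: continuous_measurable_fun.
Qed.

Lemma RID a b f g : continuous f -> continuous g ->
  RI a b (fun x => f x + g x) = RI a b f + RI a b g.
Proof. by move=> cf cg; rewrite /RI RintegralD //; exact: RI_integrable. Qed.

Lemma RIB a b f g : continuous f -> continuous g ->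
  RI a b (fun x => f x - g x) = RI a b f - RI a b g.
Proof. by move=> cf cg; rewrite /RI RintegralB //; exact: RI_integrable. Qed.

Lemma RIZ a b k f : continuous f -> RI a b (fun x => k * f x) = k * RI a b f.
Proof. by move=> cf; rewrite /RI RintegralZl //; exact: RI_integrable. Qed.

Lemma eq_RI a b f g : (forall x, a <= x <= b -> f x = g x) -> RI a b f = RI a b g.
Proof. by move=> fg; apply: eq_Rintegral => x; rewrite inE /= in_itv /= => /fg. Qed.

Lemma RI_cst a b k : a <= b -> RI a b (fun=> k) = k * (b - a).
Proof.
move=> ab; have := @Rintegral_cst _ _ R mu `[a, b]%classic (measurable_itv _) k.
rewrite /RI => ->; congr (_ * _).
have := @lebesgue_measure_itv R `[a, b]; rewrite /= lte_fin => ->.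
case: ltP => //= ba; have -> : a = b by apply: le_anti; rewrite ab ba.
by rewrite subrr.
Qed.

Lemma RI_le a b f g : continuous f -> continuous g ->
  (forall x, a <= x <= b -> f x <= g x) -> RI a b f <= RI a b g.
Proof.
move=> cf cg fg; apply: le_Rintegral => //; try exact: RI_integrable.
all: by move=> x /=; rewrite in_itv /= => /fg.
Qed.

Lemma RI_ge0 a b f : (forall x, a <= x <= b -> 0 <= f x) -> 0 <= RI a b f.
Proof. by move=> f0; apply: Rintegral_ge0 => x /=; rewrite in_itv /= => /f0. Qed.

Lemma RI_split a b c f : continuous f -> a <= b -> b <= c ->
  RI a c f = RI a b f + RI b c f.
Proof.
move=> cf ab bc.
have := @Rintegral_itvB R f (BLeft a) (BRight c) b (@RI_integrable a c f cf).
rewrite !bnd_simp => /(_ ab bc) h.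
rewrite /RI -[X in _ + X]Rintegral_itv_obnd_cbnd; last first.
  by apply: integrableS (@RI_integrable b c f cf) => //; apply: subset_itvr; rewrite bnd_simp.
by rewrite -h addrC subrK.
Qed.

Lemma RI_subset a b a' b' f : continuous f -> (forall x, 0 <= f x) ->
  a <= a' -> a' <= b' -> b' <= b -> RI a' b' f <= RI a b f.
Proof.
move=> cf f0 aa' ab' bb'.
rewrite (@RI_split a a' b) ?(le_trans ab') // (@RI_split a' b' b) //.
by rewrite addrCA lerDl addr_ge0 // RI_ge0.
Qed.

Lemma RI_abs a b f : continuous f -> `|RI a b f| <= RI a b (fun x => `|f x|).
Proof. by move=> cf; apply: le_normr_Rintegral => //; exact: RI_integrable. Qed.

Lemma RI_FTC a b f (F : R -> R) : a < b -> continuous f ->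
  (forall x : R, is_derive x 1 F (f x)) -> RI a b f = F b - F a.
Proof.
move=> ab cf dF; apply: EFin_inj; rewrite -RI_EFin // EFinB.
have cF (x : R) : {for x, continuous F}.
  by apply: differentiable_continuous; apply/derivable1_diffP; have [] := dF x.
apply: continuous_FTC2 => //.
- exact: continuous_subspaceT.
- split=> [x _|//|//].
  + by have [] := dF x.
  + exact/cvg_at_right_filter/cF.
  + exact/cvg_at_left_filter/cF.
- by move=> x _; rewrite derive1E; have [] := dF x.
Qed.

Lemma RI_shift a b c f : a <= b -> continuous f ->
  RI (a + c) (b + c) f = RI a b (fun x => f (x + c)).
Proof.
move=> ab cf.
have cs : continuous (fun x : R => x + c).
  by move=> x; apply: continuousD; [exact: cvg_id|exact: cvg_cst].
have cfs : continuous (fun x => f (x + c)).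
  move=> x; apply: (@continuous_comp _ _ _ (fun x : R => x + c) f); [exact: cs|exact: cf].
have dS (x : R) : is_derive x 1 (fun x : R => x + c) 1.
  by rewrite -[X in is_derive _ _ _ X]addr0; apply: is_deriveD.
have d1 (x : R) : (fun x : R => x + c)^`()%classic x = 1 by rewrite derive1E; have [] := dS x.
have d1' : (fun x : R => x + c)^`()%classic = cst 1 by apply/funext => x; exact: d1.
apply: EFin_inj; rewrite -!RI_EFin //.
rewrite (@integration_by_substitution_increasing R (fun x => x + c) f a b) //.
- by apply: eq_integral => x _ /=; rewrite d1' /= mulr1.
- by move=> x y _ _; rewrite ltrD2r.
- by move=> x _; rewrite d1'; exact: cvg_cst.
- by rewrite d1'; exact: is_cvg_cst.
- by rewrite d1'; exact: is_cvg_cst.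
- split=> [x _|//|//].
  + by have [] := dS x.
  + exact/cvg_at_right_filter/cs.
  + exact/cvg_at_left_filter/cs.
- exact: continuous_subspaceT.
Qed.

End ContinuousIntegral.

(** * Orlicz functions *)

Section Orlicz.
Variables (R : realType) (Psi : R -> R).
Hypothesis oPsi : orlicz Psi.
Implicit Types (x y c : R).

Lemma orlicz0 : Psi 0 = 0. Proof. by case: oPsi. Qed.

Lemma orlicz_mono x y : 0 <= x -> x <= y -> Psi x <= Psi y.
Proof. by case: oPsi => _ _ h _ _; exact: h. Qed.

Lemma orlicz_ge0 x : 0 <= x -> 0 <= Psi x.
Proof. by move=> x0; rewrite -orlicz0; exact: orlicz_mono. Qed.

Lemma orlicz_convex x y t : 0 <= x -> 0 <= y -> 0 <= t <= 1 ->
  Psi (t * x + (1 - t) * y) <= t * Psi x + (1 - t) * Psi y.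
Proof.
move=> x0 y0 /andP[t0 t1].
have [->|xy] := eqVneq x y.
  by rewrite -!mulrDl addrC subrK !mul1r.
move: t0; rewrite le_eqVlt => /predU1P[<-|t0].
  by rewrite subr0 !mul0r !mul1r !add0r.
move: t1; rewrite le_eqVlt => /predU1P[->|t1].
  by rewrite subrr !mul0r !mul1r !addr0.
by case: oPsi => _ _ _ h _; apply/ltW/h => //; rewrite t0 t1.
Qed.

(** Convexity between 0 and [x]. In the absence of a doubling condition, this is the homogeneity on
    which the estimates rest. *)
Lemma orlicz_scale c x : 0 <= c <= 1 -> 0 <= x -> Psi (c * x) <= c * Psi x.
Proof.
move=> c01 x0; have := @orlicz_convex x 0 c x0 (lexx _) c01.
by rewrite orlicz0 !mulr0 !addr0.
Qed.

Lemma orlicz_scale_ge c x : 1 <= c -> 0 <= x -> c * Psi x <= Psi (c * x).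
Proof.
move=> c1 x0; have c0 : 0 < c by exact: lt_le_trans c1.
have := @orlicz_scale c^-1 (c * x); rewrite mulrA mulVf ?gt_eqF // mul1r => h.
rewrite -ler_pdivlMl //; apply: h; last by rewrite mulr_ge0 // ltW.
by rewrite invr_ge0 ltW //= invf_le1.
Qed.

Lemma orlicz_mid x y : 0 <= x -> 0 <= y ->
  Psi ((x + y) / 2) <= (Psi x + Psi y) / 2.
Proof.
move=> x0 y0; have := @orlicz_convex x y 2^-1 x0 y0.
have -> : 1 - 2^-1 = 2^-1 :> R by field.
rewrite -!mulrDr ![2^-1 * _]mulrC; apply; lra.
Qed.

(** [orlicz] asks only for weak monotonicity. Strict convexity between 0 and [x] gives Psi (x / 2) <
    Psi x / 2, and the left side is nonnegative. *)
Lemma orlicz_gt0 x : 0 < x -> 0 < Psi x.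
Proof.
move=> x0; case: oPsi => _ P0 _ h _.
have := @h x 0 2^-1 (ltW x0) (lexx _).
rewrite (gt_eqF x0) P0 !mulr0 !addr0 => /(_ isT) h'.
have {h'} h' : Psi (2^-1 * x) < 2^-1 * Psi x by apply: h'; lra.
have : 0 <= Psi (2^-1 * x) by apply: orlicz_ge0; lra.
lra.
Qed.

Lemma orlicz_lt x y : 0 <= x -> x < y -> Psi x < Psi y.
Proof.
move=> x0 xy; have y0 : 0 < y by exact: le_lt_trans xy.
have := @orlicz_scale (x / y) y; rewrite divfK ?gt_eqF // => h.
have {h} h : Psi x <= x / y * Psi y.
  by apply: h (ltW y0); rewrite divr_ge0 ?(ltW y0) //= ler_pdivrMr // mul1r ltW.
by apply: le_lt_trans h _; rewrite gtr_pMl ?orlicz_gt0 // ltr_pdivrMr // mul1r.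
Qed.

(** [orlicz] constrains [Psi] only on the half-line, so the argument is cut at 0 to obtain a
    function continuous on the whole line. *)
Lemma orlicz_continuous : continuous (fun x => Psi (Num.max 0 x)).
Proof.
case: oPsi => /subspace_continuousP cP _ _ _ _ x.
have m0 : 0 <= Num.max 0 x by rewrite le_max lexx.
have cm : {for x, continuous (fun x : R => Num.max 0 x)}.
  by apply: continuous_max; [exact: cvg_cst|exact: cvg_id].
move=> B /(cP _ m0) /cm; apply: (@filterS _ (nbhs x)) => y /=; apply.
by rewrite le_max lexx.
Qed.

Lemma orlicz_superlinear M : exists2 x0, 1 <= x0 & forall x, x0 <= x -> M * x <= Psi x.
Proof.
case: oPsi => _ _ _ _ /(_ M)[x0 h]; exists (Num.max 1 (x0 + 1)); first by rewrite le_max lexx.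
move=> x; rewrite ge_max => /andP[x1 xx]; have x0' : 0 < x by lra.
by rewrite -ler_pdivlMr // ltW // h; lra.
Qed.

(** Superlinearity brackets the level [y], the intermediate value theorem yields a preimage [c], and
    strict growth identifies the set under [sup] with [0, c]. *)
Lemma orlicz_invP y : 0 <= y ->
  0 <= orlicz_inv Psi y /\ Psi (orlicz_inv Psi y) = y.
Proof.
move=> y0; have [x1 x11 hx] := orlicz_superlinear y.
have x10 : 0 <= x1 by lra.
have Px1 : y <= Psi x1 by apply: le_trans (hx _ (lexx _)); nra.
have [|c] := @IVT R (fun x => Psi (Num.max 0 x)) 0 x1 y x10
  (continuous_subspaceT orlicz_continuous).
  rewrite (max_l (lexx 0)) (max_r x10) orlicz0 min_l ?orlicz_ge0 // max_r ?orlicz_ge0 //.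
  by rewrite y0 Px1.
rewrite in_itv /= => /andP[c0 _]; rewrite max_r // => Pc.
suff -> : orlicz_inv Psi y = c by [].
have S : [set x : R | 0 <= x /\ Psi x <= y] = `[0, c]%classic.
  apply/seteqP; split=> x /=; rewrite in_itv /=.
    case=> x0 Px; rewrite x0 /= leNgt; apply/negP => cx.
    by have := orlicz_lt c0 cx; rewrite Pc ltNge Px.
  by move=> /andP[x0 xc]; split=> //; rewrite -Pc orlicz_mono.
rewrite /orlicz_inv S; apply: sup_itv.
by rewrite bnd_simp.
Qed.

Lemma orlicz_inv_ge x y : 0 <= x -> Psi x <= y -> x <= orlicz_inv Psi y.
Proof.
move=> x0 xy; have y0 : 0 <= y by exact: le_trans (orlicz_ge0 x0) xy.
have [i0 iE] := orlicz_invP y0; rewrite leNgt; apply/negP => h.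
by have := orlicz_lt i0 h; rewrite iE ltNge xy.
Qed.

Lemma orlicz_inv_gt0 y : 0 < y -> 0 < orlicz_inv Psi y.
Proof.
move=> y0; have [i0 iE] := orlicz_invP (ltW y0); rewrite lt_neqAle i0 andbT.
by apply/eqP => h; move: iE y0; rewrite -h orlicz0 => ->; rewrite ltxx.
Qed.

End Orlicz.

(** * The Poisson kernel *)

Section Poisson.
Variable R : realType.
Implicit Types (s x t a : R).

Lemma geometric_squeeze s x B : 0 <= s < 1 -> (forall m, x <= s ^+ m * B) -> x <= 0.
Proof.
move=> /andP[s0 s1] h.
have c : (fun m => s ^+ m * B) @ \oo --> (0 : R).
  rewrite -[X in _ --> X](mul0r B); apply: cvgMl; apply: cvg_expr.
  by rewrite ger0_norm.
rewrite -(cvg_lim _ c) //; apply: limr_ge; first by apply/cvg_ex; exists 0.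
by apply: nearW => m; exact: h.
Qed.

Definition pden s x := 1 - 2 * s * cos x + s ^+ 2.

Definition poisson s x := (1 - s ^+ 2) / pden s x.

Lemma pden_ge s x : 0 <= s -> (1 - s) ^+ 2 <= pden s x.
Proof. by move=> s0; rewrite /pden; have := cos_le1 x; nra. Qed.

Lemma pden_gt0 s x : 0 <= s < 1 -> 0 < pden s x.
Proof.
move=> /andP[s0 s1]; apply: lt_le_trans (pden_ge x s0).
by rewrite exprn_gt0 // subr_gt0.
Qed.

Lemma pdenE s x : pden s x = cabs (1 - s%:C%C * expi x) ^+ 2.
Proof.
rewrite sqr_cabs ReB ImB ReM ImM /= !mul0r subr0 addr0 /pden.
have := cos2Dsin2 x; rewrite /= sub0r => h.
have -> : s ^+ 2 = s ^+ 2 * (cos x ^+ 2 + sin x ^+ 2) by rewrite h mulr1.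
by ring.
Qed.

Lemma poisson_gt0 s x : 0 <= s < 1 -> 0 < poisson s x.
Proof.
move=> s01; rewrite divr_gt0 ?pden_gt0 // subr_gt0; move/andP: s01 => [? ?].
by rewrite expr_lt1 // ltW.
Qed.

Lemma continuous_affine (k b c : R) : continuous (fun t : R => k * (t - c) + b).
Proof.
move=> t; apply: cvgD; last exact: cvg_cst.
by apply: cvgM; [exact: cvg_cst|apply: cvgB; [exact: cvg_id|exact: cvg_cst]].
Qed.

Lemma continuous_cosk (k b c : R) : continuous (fun t : R => cos (k * (t - c) + b)).
Proof.
move=> t; apply: (@continuous_comp _ _ _ (fun t : R => k * (t - c) + b) cos).
  exact: continuous_affine.
exact: continuous_cos.
Qed.

Lemma continuous_poisson s c : 0 <= s < 1 -> continuous (fun t => poisson s (t - c)).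
Proof.
move=> s01 t; apply: cvgM; first exact: cvg_cst.
apply: cvgV; first by rewrite gt_eqF // pden_gt0.
apply: cvgD; last exact: cvg_cst.
apply: cvgB; first exact: cvg_cst.
apply: cvgM; first exact: cvg_cst.
apply: (@continuous_comp _ _ _ (fun t : R => t - c) cos); last exact: continuous_cos.
by apply: cvgB; [exact: cvg_id|exact: cvg_cst].
Qed.

Lemma sinDn2pi n x : sin (x + n%:R * (2 * pi)) = sin x.
Proof.
elim: n => [|n IH]; first by rewrite mul0r addr0.
have -> : x + n.+1%:R * (2 * pi) = x + n%:R * (2 * pi) + pi *+ 2.
  by rewrite -natr1 mulrDl mul1r addrA [in RHS]mulr2n mulrDl mul1r.
by rewrite sinD2pi IH.
Qed.

Lemma RI_cos a c b (k : nat) : (0 < k)%N ->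
  RI a (a + 2 * pi) (fun t => cos (k%:R * (t - c) + b)) = 0.
Proof.
move=> k0; have kn0 : k%:R != 0 :> R by rewrite pnatr_eq0 -lt0n.
transitivity (k%:R^-1 * sin (k%:R * (a + 2 * pi - c) + b) -
              k%:R^-1 * sin (k%:R * (a - c) + b)); last first.
  have -> : k%:R * (a + 2 * pi - c) + b = k%:R * (a - c) + b + k%:R * (2 * pi) by ring.
  by rewrite sinDn2pi subrr.
apply: (@RI_FTC R _ _ _ (fun t => k%:R^-1 * sin (k%:R * (t - c) + b))).
- by have := pi_gt0 R; lra.
- exact: continuous_cosk.
- move=> t.
  have dl : is_derive (t : R) 1 (fun t : R => k%:R * (t - c) + b) k%:R.
    by apply: is_derive_eq; rewrite /GRing.scale /=; ring.
  have ds := @is_derive1_comp R sin (fun t : R => k%:R * (t - c) + b) t _ _ (is_derive_sin _) dl.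
  apply: (is_derive_eq (is_deriveZ k%:R^-1 ds)).
  by rewrite /GRing.scale /= mulrCA mulVf // mulr1.
Qed.

Lemma pden_cos_identity s (P : R) x y :
  (1 + s ^+ 2) * (P * cos y) - s * (P * cos (y + x) + P * cos (y - x)) =
  P * (1 - 2 * s * cos x + s ^+ 2) * cos y.
Proof. by rewrite cosD cosB; ring. Qed.

(** Fourier coefficients of the Poisson kernel, found without expanding it. Since the kernel times
    [pden] is constant, the vanishing mean of a cosine gives the recurrence (1 + s^2) C_{j+1} = s
    (C_{j+2} + C_j), with characteristic roots s and 1 / s. The differences C_{j+1} - s C_j are s^m
    times later bounded ones, hence zero, which excludes the growing root. *)
Lemma poisson_cos s a c b k : 0 <= s < 1 ->
  RI a (a + 2 * pi) (fun t => poisson s (t - c) * cos (k%:R * (t - c) + b)) =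
  2 * pi * s ^+ k * cos b.
Proof.
move=> s01; have /andP[s0 s1] := s01.
have pi2 : 0 < 2 * pi :> R by have := pi_gt0 R; lra.
have a2 : a <= a + 2 * pi by lra.
have cP := @continuous_poisson s c s01.
have cC (j b' : R) : continuous (fun t => poisson s (t - c) * cos (j * (t - c) + b')).
  by move=> t; apply: cvgM; [exact: cP|exact: continuous_cosk].
pose C b' j := RI a (a + 2 * pi)
  (fun t => poisson s (t - c) * cos (j%:R * (t - c) + b')).
have pc t : poisson s t * pden s t = 1 - s ^+ 2 by rewrite divfK // gt_eqF // pden_gt0.
have rec b' j : (1 + s ^+ 2) * C b' j.+1 = s * (C b' j.+2 + C b' j).
  apply/eqP; rewrite -subr_eq0 -(@mulr0 R (1 - s ^+ 2)) -(@RI_cos a c b' j.+1) //.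
  rewrite -RIZ; last exact: continuous_cosk.
  rewrite /C -RID // -!RIZ -?RIB //; last 3 first.
  - by move=> t; apply: cvgM; [exact: cvg_cst|exact: cC].
  - by move=> t; apply: cvgM; [exact: cvg_cst|apply: cvgD; exact: cC].
  - by move=> t; apply: cvgD; exact: cC.
  apply/eqP/eq_RI => t _; rewrite -(pc (t - c)).
  set x := t - c; set P := poisson s x; rewrite /pden.
  have -> : j.+2%:R * x + b' = (j.+1%:R * x + b') + x by rewrite -natr1; ring.
  have -> : j%:R * x + b' = (j.+1%:R * x + b') - x by rewrite -[j.+1%:R]natr1; ring.
  exact: pden_cos_identity.
have D b' j : C b' j.+1 = s * C b' j.
  have Dj i : C b' i.+1 - s * C b' i = s * (C b' i.+2 - s * C b' i.+1).
    by have := rec b' i; lra.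
  have Dm i m : C b' i.+1 - s * C b' i = s ^+ m * (C b' (i + m)%N.+1 - s * C b' (i + m)%N).
    elim: m i => [|m IH] i; first by rewrite addn0 expr0 mul1r.
    by rewrite Dj IH exprS mulrA addSnnS.
  pose B := RI a (a + 2 * pi) (fun t => poisson s (t - c)).
  have CB i : `|C b' i| <= B.
    apply: le_trans (RI_abs _ _ (cC _ _)) _; apply: RI_le => //.
      by move=> t; apply: cvg_norm; exact: cC.
    move=> t _; rewrite normrM gtr0_norm ?poisson_gt0 //; apply: ler_piMr; first exact/ltW/poisson_gt0.
    by rewrite ler_norml cos_geN1 cos_le1.
  apply/eqP; rewrite -subr_eq0 -normr_le0; apply: (@geometric_squeeze s _ (2 * B)) => // m.
  rewrite (Dm j m) normrM ger0_norm ?exprn_ge0 // ler_wpM2l ?exprn_ge0 //.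
  apply: le_trans (ler_normB _ _) _; rewrite normrM (ger0_norm s0).
  by have := CB (j + m)%N; have := CB (j + m)%N.+1; have := normr_ge0 (C b' (j + m)%N); nra.
have Ck b' j : C b' j = s ^+ j * C b' 0%N.
  by elim: j => [|j IH]; rewrite ?expr0 ?mul1r // D IH exprS mulrA.
(* The constant is fixed by integrating the kernel times [pden], that is 1 - s^2, and using C_1 = s
   C_0. *)
have C0 : C 0 0%N = 2 * pi.
  have : (1 - s ^+ 2) * (2 * pi) = (1 + s ^+ 2) * C 0 0%N - 2 * s * C 0 1%N.
    have -> : (1 - s ^+ 2) * (2 * pi) = RI a (a + 2 * pi) (fun=> 1 - s ^+ 2).
      by rewrite RI_cst // addrAC subrr add0r.
    rewrite /C -!RIZ -?RIB //; last 2 first.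
    - by move=> t; apply: cvgM; [exact: cvg_cst|exact: cC].
    - by move=> t; apply: cvgM; [exact: cvg_cst|exact: cC].
    apply: eq_RI => t _; rewrite -(pc (t - c)) !addr0 mul0r cos0 mul1r /pden; ring.
  rewrite D => h; have n0 : 1 - s ^+ 2 != 0 by rewrite gt_eqF // subr_gt0 expr_lt1.
  by apply: (mulfI n0); rewrite h; ring.
have Cb : C b 0%N = cos b * C 0 0%N.
  rewrite /C -RIZ //; apply: eq_RI => t _.
  by rewrite !mul0r !add0r cos0; ring.
by rewrite -/(C b k) Ck Cb C0; ring.
Qed.

Lemma poisson_mass s a c : 0 <= s < 1 ->
  RI a (a + 2 * pi) (fun t => poisson s (t - c)) = 2 * pi.
Proof.
move=> s01; have := @poisson_cos s a c 0 0 s01; rewrite cos0 !mulr1 => h; rewrite -[RHS]h.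
by apply: eq_RI => t _; rewrite mul0r addr0 cos0 mulr1.
Qed.

End Poisson.

(** * Subharmonicity of the square root of the modulus *)

Section TrigPolynomial.
Variable R : realType.
Implicit Types (p q : {poly R[i]}) (c : nat -> R[i]).

Lemma expi_Re_term (z : R[i]) (s t : R) k :
  exists g, z = (cabs z)%:C%C * expi g /\
    complex.Re (z * (s%:C%C * expi t) ^+ k) = cabs z * (s ^+ k * cos (k%:R * t + g)).
Proof.
have [g zg] := polar z; exists g; split=> //.
rewrite {1}zg exprMn expiX.
have -> : (cabs z)%:C%C * expi g * (s%:C%C ^+ k * expi (k%:R * t)) =
          ((cabs z * s ^+ k)%:C%C) * expi (k%:R * t + g).
  by rewrite addrC expiD rmorphM rmorphXn /=; ring.
by rewrite ReM /= mul0r subr0 mulrA.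
Qed.

Lemma continuous_Re_trig n c :
  continuous (fun t : R => complex.Re (\sum_(k < n) c k * expi t ^+ k)).
Proof.
elim: n => [|n IH].
  by apply: (@eq_continuous _ (fun=> 0)) => [u|u]; [rewrite big_ord0|exact: cvg_cst].
apply: (@eq_continuous _ (fun u : R =>
   complex.Re (\sum_(k < n) c k * expi u ^+ k) + complex.Re (c n * expi u ^+ n))).
  by move=> u; rewrite big_ord_recr ReD.
suff h : continuous (fun u : R => complex.Re (c n * expi u ^+ n)).
  by move=> t; apply: cvgD; [exact: IH|exact: h].
have [g cg] := polar (c n).
apply: (@eq_continuous _ (fun u : R => cabs (c n) * cos (n%:R * (u - 0) + g))).
  by move=> u; rewrite {2}cg expiX subr0 -mulrA -expiD ReM /= mul0r subr0 addrC.
by move=> t; apply: cvgM; [exact: cvg_cst|exact: continuous_cosk].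
Qed.

Lemma horner_expi p t : p.[expi t] = \sum_(k < size p) p`_k * expi t ^+ k.
Proof. exact: horner_coef. Qed.

Lemma continuous_Re_poly p : continuous (fun t : R => complex.Re p.[expi t]).
Proof.
apply: (@eq_continuous _ (fun t => complex.Re (\sum_(k < size p) p`_k * expi t ^+ k))).
  by move=> t; rewrite horner_expi.
exact: (@continuous_Re_trig _ (fun k => p`_k)).
Qed.

Lemma continuous_Im_poly p : continuous (fun t : R => complex.Im p.[expi t]).
Proof.
apply: (@eq_continuous _ (fun t => complex.Re ((0 -i* 1)%C *: p).[expi t])).
  by move=> t; rewrite hornerZ ReM /= mul0r mulN1r opprK add0r.
exact: continuous_Re_poly.
Qed.

Lemma continuous_cabs_poly p : continuous (fun t : R => cabs p.[expi t]).
Proof.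
apply: (@continuous_fcomp _
  (fun t : R => complex.Re p.[expi t] * complex.Re p.[expi t] +
    complex.Im p.[expi t] * complex.Im p.[expi t]) Num.sqrt).
  have cR := @continuous_Re_poly p; have cI := @continuous_Im_poly p.
  by move=> t; apply: cvgD; apply: cvgM; (exact: cR || exact: cI).
exact: sqrt_continuous.
Qed.

Lemma poisson_Re_poly p (s a th : R) : 0 <= s < 1 ->
  RI a (a + 2 * pi) (fun t => poisson s (t - th) * complex.Re p.[expi t]) =
  2 * pi * complex.Re p.[s%:C%C * expi th].
Proof.
move=> s01; have pi2 : 0 < 2 * pi :> R by have := pi_gt0 R; lra.
have cP := @continuous_poisson _ s th s01.
suff H n c : RI a (a + 2 * pi) (fun t => poisson s (t - th) *
    complex.Re (\sum_(k < n) c k * expi t ^+ k)) =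
    2 * pi * complex.Re (\sum_(k < n) c k * (s%:C%C * expi th) ^+ k).
  rewrite [in RHS]horner_coef -(H _ (fun k => p`_k)).
  by apply: eq_RI => t _; rewrite horner_expi.
elim: n => [|n IH].
  transitivity (RI a (a + 2 * pi) (fun=> 0)); last first.
    by rewrite RI_cst ?mul0r ?big_ord0 ?mulr0 //; lra.
  by apply: eq_RI => t _; rewrite big_ord0 mulr0.
transitivity (RI a (a + 2 * pi) (fun t => poisson s (t - th) *
    complex.Re (\sum_(k < n) c k * expi t ^+ k)) +
  2 * pi * complex.Re (c n * (s%:C%C * expi th) ^+ n)); last first.
  by rewrite IH -mulrDr -ReD big_ord_recr.
have [g [cg ->]] := @expi_Re_term (c n) s th n.
have -> : 2 * pi * (cabs (c n) * (s ^+ n * cos (n%:R * th + g))) =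
  cabs (c n) * (2 * pi * s ^+ n * cos (n%:R * th + g)) by ring.
rewrite -(@poisson_cos _ s a th _ n s01) -RIZ; last first.
  by move=> t; apply: cvgM; [exact: cP|exact: continuous_cosk].
rewrite -RID; last 2 first.
- by move=> t; apply: cvgM; [exact: cP|exact: continuous_Re_trig].
- move=> t; apply: cvgM; first exact: cvg_cst.
  by apply: cvgM; [exact: cP|exact: continuous_cosk].
apply: eq_RI => t _; rewrite big_ord_recr /= ReD mulrDr; congr (_ + _).
rewrite {1}cg expiX -mulrA -expiD ReM /= mul0r subr0.
have -> : n%:R * (t - th) + (n%:R * th + g) = g + n%:R * t by ring.
by ring.
Qed.

(* rotating [p] so that its value is nonnegative turns the Poisson formula for real parts into this inequality *)
Lemma poisson_cabs_poly p (s a th : R) : 0 <= s < 1 ->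
  2 * pi * cabs p.[s%:C%C * expi th] <=
  RI a (a + 2 * pi) (fun t => poisson s (t - th) * cabs p.[expi t]).
Proof.
move=> s01; have [g pg] := polar p.[s%:C%C * expi th].
have := @poisson_Re_poly (expi (- g) *: p) s a th s01.
have -> : (expi (- g) *: p).[s%:C%C * expi th] = (cabs p.[s%:C%C * expi th])%:C%C.
  by rewrite hornerZ {1}pg mulrCA -expiD addNr expi0 mulr1.
move=> /= <-.
apply: RI_le.
- by move=> t; apply: cvgM; [exact: continuous_poisson|exact: continuous_Re_poly].
- by move=> t; apply: cvgM; [exact: continuous_poisson|exact: continuous_cabs_poly].
move=> t _; apply: ler_wpM2l; first exact/ltW/poisson_gt0.
by rewrite hornerZ (le_trans (ler_norm _)) // (le_trans (Re_le_cabs _)) // cabsM cabs_expi mul1r.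
Qed.

Lemma poly_bounded p : exists B, 0 <= B /\ forall z, cabs z <= 1 -> cabs p.[z] <= B.
Proof.
exists (\sum_(k < size p) cabs p`_k); split; first by apply: sumr_ge0 => i _; exact: cabs_ge0.
move=> z z1; rewrite horner_coef; apply: le_trans (cabs_sum _ _ _) _.
apply: ler_sum => i _; rewrite cabsM cabsX ler_piMr ?cabs_ge0 //.
by rewrite exprn_ile1 // cabs_ge0.
Qed.

End TrigPolynomial.

(** * Approximate square roots and the mean value inequality *)

Section SquareRoot.
Variable R : realType.
Implicit Types (p q s : {poly R[i]}) (z b : R[i]).

(** The square root of a polynomial is rarely a polynomial; uniform approximation on the closed disc
    is enough to apply [poisson_cabs_poly] to [s]. *)
Definition approx_square q := forall e : R, 0 < e ->
  exists s, forall z, cabs z <= 1 -> cabs (s.[z] ^+ 2 - q.[z]) <= e.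

Lemma approx_squareM p q : approx_square p -> approx_square q -> approx_square (p * q).
Proof.
move=> ap aq e e0.
have [Bp [Bp0 hp]] := poly_bounded p; have [Bq [Bq0 hq]] := poly_bounded q.
pose d := Num.min 1 (e / (Bp + Bq + 1)).
have D0 : 0 < Bp + Bq + 1 by lra.
have d0 : 0 < d by rewrite lt_min ltr01 divr_gt0.
have d1 : d <= 1 by rewrite ge_min lexx.
have de : d * (Bp + Bq + 1) <= e by rewrite -ler_pdivlMr // ge_min lexx orbT.
have [s sp] := ap _ d0; have [s' sq] := aq _ d0.
exists (s * s') => z z1; rewrite !hornerM exprMn.
have -> : s.[z] ^+ 2 * s'.[z] ^+ 2 - p.[z] * q.[z] =
  (s.[z] ^+ 2 - p.[z]) * (s'.[z] ^+ 2 - q.[z]) + (s.[z] ^+ 2 - p.[z]) * q.[z] +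
  p.[z] * (s'.[z] ^+ 2 - q.[z]) by ring.
apply: le_trans (cabsD _ _) _; rewrite cabsM.
apply: le_trans (lerD (cabsD _ _) (lexx _)) _; rewrite !cabsM.
move: (sp _ z1) (sq _ z1) (hp _ z1) (hq _ z1).
move: (cabs_ge0 (s.[z] ^+ 2 - p.[z])) (cabs_ge0 (s'.[z] ^+ 2 - q.[z])).
move: (cabs_ge0 p.[z]) (cabs_ge0 q.[z]).
move: (cabs _) (cabs (_ - p.[z])) (cabs _) (cabs (_ - q.[z])) => x1 x2 x3 x4 *.
suff: x2 * x4 + x2 * x1 + x3 * x4 <= d * (Bp + Bq + 1) by lra.
have : x2 * x4 <= d * 1 by apply: ler_pM; lra.
have : x2 * x1 <= d * Bq by apply: ler_pM; lra.
have : x3 * x4 <= Bp * d by apply: ler_pM; lra.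
lra.
Qed.

Lemma approx_squareC b : approx_square b%:P.
Proof.
move=> e e0; exists (sqrtc b)%:P => z _.
by rewrite !hornerC sqr_sqrtc subrr cabs0 ltW.
Qed.

Lemma exp_small (x e : R) : 0 <= x < 1 -> 0 < e -> exists n, x ^+ n <= e.
Proof.
move=> x01 e0; apply: contrapT => h.
have : e <= 0; last by rewrite leNgt e0.
apply: (@geometric_squeeze _ x _ 1 x01) => m; rewrite mulr1 leNgt; apply/negP => hm.
by apply: h; exists m; exact: ltW.
Qed.

(* Picard iteration for [y = (w + y^2) / 2], whose fixed point is [1 - sqrt (1 - w)] *)
Fixpoint sqrt_iter b n : {poly R[i]} :=
  if n is m.+1 then (2^-1 : R[i]) *: (b *: 'X + sqrt_iter b m ^+ 2) else 0.

Lemma sqrt_iterS b n z :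
  (sqrt_iter b n.+1).[z] = 2^-1 * (b * z + (sqrt_iter b n).[z] ^+ 2).
Proof. by rewrite /= !hornerE. Qed.

(** [Y] is the fixed point of the iteration for the modulus [r] of [b]. The iterates stay in the
    ball of radius [Y] and contract there by the factor Y < 1. The defect (1 - y_n)^2 - (1 - b z)
    equals 2 (y_{n+1} - y_n), so it decays like Y^n. *)
Lemma approx_square_lin_lt b : cabs b < 1 -> approx_square (1 - b *: 'X).
Proof.
move=> b1 e e0; pose r := cabs b; have r0 : 0 <= r := cabs_ge0 b.
pose Y := 1 - Num.sqrt (1 - r).
have sq : Num.sqrt (1 - r) ^+ 2 = 1 - r by rewrite sqr_sqrtr // subr_ge0 ltW.
have sq0 : 0 < Num.sqrt (1 - r) by rewrite sqrtr_gt0 subr_gt0.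
have sq1 : Num.sqrt (1 - r) <= 1 by rewrite -[leRHS]sqrtr1 ler_wsqrtr // gerBl.
have Y01 : 0 <= Y < 1 by rewrite /Y subr_ge0 sq1 /= gtrBl.
have YE : r + Y ^+ 2 = 2 * Y by rewrite /Y sqrrB sq; ring.
have half : cabs (2^-1 : R[i]) = 2^-1.
  by rewrite cabsV -[2]/(2%:R) -(rmorph_nat (real_complex R)) /= cabsR ger0_norm.
have yb n z : cabs z <= 1 -> cabs (sqrt_iter b n).[z] <= Y.
  move=> z1; elim: n => [|n IH]; first by rewrite horner0 cabs0; case/andP: Y01.
  rewrite sqrt_iterS cabsM half ler_pdivrMl // -YE.
  apply: le_trans (cabsD _ _) _; rewrite cabsM cabsX; apply: lerD.
    by rewrite ler_piMr.
  by rewrite lerXn2r ?nnegrE ?cabs_ge0 //; case/andP: Y01.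
have yd n z : cabs z <= 1 ->
    cabs ((sqrt_iter b n.+1).[z] - (sqrt_iter b n).[z]) <= Y ^+ n.
  move=> z1; elim: n => [|n IH].
    rewrite sqrt_iterS horner0 subr0 expr0n /= addr0 cabsM half cabsM.
    have : cabs b * cabs z <= 1 * 1 by apply: ler_pM; rewrite ?cabs_ge0 // ltW.
    lra.
  rewrite sqrt_iterS [in X in _ - X]sqrt_iterS.
  set u := (sqrt_iter b n.+1).[z] in IH *; set v := (sqrt_iter b n).[z] in IH *.
  have -> : 2^-1 * (b * z + u ^+ 2) - 2^-1 * (b * z + v ^+ 2) =
            2^-1 * ((u - v) * (u + v)) by ring.
  rewrite !cabsM half exprS mulrCA.
  have : cabs (u + v) <= 2 * Y.
    by apply: le_trans (cabsD _ _) _; have := yb n.+1 z z1; have := yb n z z1;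
      rewrite -/u -/v; lra.
  case/andP: Y01 => Y0 _; have := cabs_ge0 (u + v); have := cabs_ge0 (u - v).
  move: (exprn_ge0 n Y0) IH; move: (cabs _) (cabs _) (Y ^+ n) => x y yn ? ? ? ? ?.
  have : y * x <= yn * (2 * Y) by apply: ler_pM.
  lra.
have [n hn] := @exp_small Y (e / 2) Y01 ltac:(lra).
exists (1 - sqrt_iter b n) => z z1.
have -> : (1 - sqrt_iter b n).[z] ^+ 2 - (1 - b *: 'X).[z] =
   2 * ((sqrt_iter b n.+1).[z] - (sqrt_iter b n).[z]).
  by rewrite sqrt_iterS !hornerE; field.
rewrite cabsM.
have -> : cabs (2 : R[i]) = 2.
  by rewrite -[2]/(2%:R) -(rmorph_nat (real_complex R)) /= cabsR ger0_norm.
by have := yd n z z1; lra.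
Qed.

(** Shrinking [b] to [r * b] reaches the case |b| = 1, where the contraction degenerates; the linear
    factor moves by at most 1 - r on the disc. *)
Lemma approx_square_lin b : cabs b <= 1 -> approx_square (1 - b *: 'X).
Proof.
move=> b1 e e0; pose r : R := 1 - Num.min (1/2) (e / 2).
have r01 : 0 < r < 1.
  have h1 : Num.min (1/2) (e/2) <= 1/2 by rewrite ge_min lexx.
  have h0 : 0 < Num.min (1/2) (e/2) by rewrite lt_min; apply/andP; split; lra.
  by rewrite /r; lra.
have re : 1 - r <= e / 2 by rewrite /r opprB addrC subrK ge_min lexx orbT.
have [|s hs] := @approx_square_lin_lt (r%:C%C * b) _ (e / 2) ltac:(lra).
  rewrite cabsM cabsR gtr0_norm; last lra.
  by have := cabs_ge0 b; nra.
exists s => z z1.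
have -> : s.[z] ^+ 2 - (1 - b *: 'X).[z] =
  (s.[z] ^+ 2 - (1 - (r%:C%C * b) *: 'X).[z]) + (1 - r)%:C%C * b * z.
  have hr : (1 - r)%:C%C = 1 - r%:C%C :> R[i] by rewrite rmorphB rmorph1.
  by rewrite !hornerE hr; ring.
apply: le_trans (cabsD _ _) _; rewrite !cabsM cabsR.
have := hs z z1.
have : `|1 - r| * cabs b * cabs z <= (1 - r) * 1 * 1.
  rewrite ger0_norm; last lra.
  by apply: ler_pM => //; rewrite ?mulr_ge0 ?cabs_ge0 //; first lra; apply: ler_pM;
   rewrite ?cabs_ge0 //; lra.
lra.
Qed.

(** The identity that makes the Blaschke factor (z - a) / (1 - conj a z) contractive in the disc and
    unimodular on the circle. *)
Lemma blaschke_factor (a z : R[i]) :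
  cabs (1 - a^*%C * z) ^+ 2 - cabs (z - a) ^+ 2 =
  (1 - cabs a ^+ 2) * (1 - cabs z ^+ 2).
Proof.
case: a => a1 a2; case: z => z1 z2; rewrite !sqr_cabs !ReB !ImB !ReM !ImM /=; ring.
Qed.

(* The zeros of [p] inside the disc are reflected to the outside, which gives an outer majorant with the same modulus on the circle. *)
Lemma outer_majorant p : exists q, approx_square q /\ forall z, cabs z <= 1 ->
  cabs p.[z] <= cabs q.[z] /\ (cabs z = 1 -> cabs q.[z] = cabs p.[z]).
Proof.
have [r ->] := closed_field_poly_normal p.
suff [q [aq hq]] : exists q, approx_square q /\ forall z, cabs z <= 1 ->
    cabs (\prod_(x <- r) ('X - x%:P)).[z] <= cabs q.[z] /\
    (cabs z = 1 -> cabs q.[z] = cabs (\prod_(x <- r) ('X - x%:P)).[z]).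
  exists ((lead_coef p)%:P * q); split; first by apply: approx_squareM => //; exact: approx_squareC.
  move=> z z1; have [h1 h2] := hq z z1; rewrite hornerM hornerZ hornerC !cabsM.
  by split=> [|/h2 ->//]; rewrite ler_wpM2l ?cabs_ge0.
elim: r => [|a r [q [aq hq]]].
  exists 1; rewrite big_nil; split=> //; exact: approx_squareC.
suff [l [al hl]] : exists q, approx_square q /\ forall z, cabs z <= 1 ->
    cabs ('X - a%:P).[z] <= cabs q.[z] /\ (cabs z = 1 -> cabs q.[z] = cabs ('X - a%:P).[z]).
  exists (l * q); split; first exact: approx_squareM.
  move=> z z1; have [h1 h2] := hq z z1; have [h3 h4] := hl z z1.
  rewrite big_cons !hornerM !cabsM; split; first by apply: ler_pM; rewrite ?cabs_ge0.
  by move=> /[dup] /h2 -> /h4 ->.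
have [a1|a1] := lerP (cabs a) 1.
  exists (1 - a^*%C *: 'X); split.
    by apply: approx_square_lin; rewrite /cabs; case: (a) a1 => x y; rewrite /cabs /= sqrrN.
  move=> z z1; rewrite !hornerE; have h := blaschke_factor a z.
  have a0 := cabs_ge0 a; have z0 := cabs_ge0 z.
  split=> [|ze].
    rewrite -(ler_pXn2r (ltn0Sn 1)) ?nnegrE ?cabs_ge0 // -subr_ge0 h.
    by apply: mulr_ge0; rewrite subr_ge0 expr_le1.
  apply/eqP; rewrite -(eqrXn2 (ltn0Sn 1)) ?cabs_ge0 // -subr_eq0 h ze.
  by rewrite expr1n subrr mulr0.
have an0 : a != 0 by rewrite -cabs_eq0 gt_eqF // (lt_trans _ a1).
(* A root outside the disc keeps its factor, rewritten so that the coefficient of the variable has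
   modulus at most 1. *)
exists ((- a)%:P * (1 - a^-1 *: 'X)); split.
  apply: approx_squareM; first exact: approx_squareC.
  by apply: approx_square_lin; rewrite cabsV invf_le1 ?ltW // (lt_trans _ a1).
move=> z z1; have -> : ((- a)%:P * (1 - a^-1 *: 'X)).[z] = ('X - a%:P).[z].
  by rewrite !hornerE mulrBr mulr1 mulNr opprK mulrA divff // mul1r addrC.
by split.
Qed.

(** Let u^2 be close to the outer majorant q. Inside the disc |p|^{1/2} <= |q|^{1/2}, which is close
    to |u|; |u| is dominated by the Poisson integral of its boundary values; and on the circle
    |q|^{1/2} = |p|^{1/2}. *)
Lemma sqrt_submean p (s a th : R) : 0 <= s < 1 ->
  2 * pi * Num.sqrt (cabs p.[s%:C%C * expi th]) <=
  RI a (a + 2 * pi) (fun t => poisson s (t - th) * Num.sqrt (cabs p.[expi t])).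
Proof.
move=> s01; have pi2 : 0 < 2 * pi :> R by have := pi_gt0 R; lra.
have csq : continuous (fun t : R => Num.sqrt (cabs p.[expi t])).
  move=> t; apply: (@continuous_comp _ _ _ (fun t : R => cabs p.[expi t]) Num.sqrt).
    exact: continuous_cabs_poly.
  exact: sqrt_continuous.
have cP := @continuous_poisson _ s th s01.
have sD (x y : R) : 0 <= x -> 0 <= y -> Num.sqrt (x + y) <= Num.sqrt x + Num.sqrt y.
  move=> x0 y0; rewrite -(ler_pXn2r (ltn0Sn 1)) ?nnegrE ?addr_ge0 ?sqrtr_ge0 //.
  rewrite sqrrD !sqr_sqrtr ?addr_ge0 //.
  by have := sqrtr_ge0 x; have := sqrtr_ge0 y; nra.
have [q [aq hq]] := outer_majorant p.
apply/ler_addgt0Pr => e e0.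
(* The error [d] is paid twice, inside and on the circle, each time with mass 2 pi. The tolerance
   for the square is d^2, because a square root turns an error d^2 into at most d. *)
pose d := e / (4 * pi); have d0 : 0 < d by rewrite divr_gt0 //; lra.
have [u hu] := aq (d ^+ 2) (exprn_gt0 2 d0).
set z := s%:C%C * expi th.
have z1 : cabs z <= 1.
  by rewrite cabsM cabs_expi mulr1 cabsR ger0_norm; case/andP: s01 => // _ /ltW.
have h1 : Num.sqrt (cabs p.[z]) <= cabs u.[z] + d.
  apply: (@le_trans _ _ (Num.sqrt (cabs u.[z] ^+ 2 + d ^+ 2))).
    rewrite ler_wsqrtr //; have [h _] := hq z z1; apply: le_trans h _.
    rewrite -cabsX addrC -lerBlDr; apply: le_trans (cabsB_ge _ _) _.
    by rewrite cabsC; exact: hu.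
  by apply: le_trans (sD _ _ _ _) _; rewrite ?sqr_ge0 // !sqrtr_sqr !ger0_norm ?cabs_ge0 // ltW.
have h2 t : cabs u.[expi t] <= Num.sqrt (cabs p.[expi t]) + d.
  have t1 : cabs (expi t) <= 1 by rewrite cabs_expi.
  rewrite -[leLHS]ger0_norm ?cabs_ge0 // -sqrtr_sqr.
  apply: (@le_trans _ _ (Num.sqrt (cabs p.[expi t] + d ^+ 2))).
    rewrite ler_wsqrtr //; have [_ <-] := hq _ t1; last exact: cabs_expi.
    rewrite -cabsX addrC -lerBlDr; apply: le_trans (cabsB_ge _ _) _.
    exact: hu.
  by apply: le_trans (sD _ _ _ _) _; rewrite ?sqr_ge0 ?cabs_ge0 // sqrtr_sqr ger0_norm // ltW.
have h3 := @poisson_cabs_poly _ u s a th s01.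
have h4 : RI a (a + 2 * pi) (fun t => poisson s (t - th) * cabs u.[expi t]) <=
  RI a (a + 2 * pi) (fun t => poisson s (t - th) * Num.sqrt (cabs p.[expi t])) + d * (2 * pi).
  have -> : d * (2 * pi) = RI a (a + 2 * pi) (fun t => d * poisson s (t - th)).
    by rewrite RIZ // poisson_mass.
  rewrite -RID; last 2 first.
  - by move=> t; apply: cvgM; [exact: cP|exact: csq].
  - by move=> t; apply: cvgM; [exact: cvg_cst|exact: cP].
  apply: RI_le.
  - by move=> t; apply: cvgM; [exact: cP|exact: continuous_cabs_poly].
  - move=> t; apply: cvgD; apply: cvgM; [exact: cP|exact: csq|exact: cvg_cst|exact: cP].
  move=> t _; rewrite [d * _]mulrC -mulrDr ler_wpM2l //.
  exact/ltW/poisson_gt0.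
have de : d * (4 * pi) = e by rewrite divfK // gt_eqF //; lra.
have : 2 * pi * Num.sqrt (cabs p.[z]) <= 2 * pi * (cabs u.[z] + d) by rewrite ler_wpM2l // ltW.
lra.
Qed.

End SquareRoot.

(** * Carleson windows *)

Section PlaneMeasurability.
Variable R : realType.
Implicit Types (f g : (R * R)%type -> R) (p : {poly R[i]}).

Lemma measurable_set_gt d (T : measurableType d) (f : T -> R) (c : R) :
  measurable_fun setT f -> measurable [set x | c < f x].
Proof.
move=> mf; rewrite (_ : [set x | c < f x] = setT `&` f @^-1` `]c, +oo[%classic).
  exact: mf.
by rewrite setTI; apply/seteqP; split=> x /=; rewrite in_itv /= andbT.
Qed.

Lemma measurable_set_ge d (T : measurableType d) (f : T -> R) (c : R) :
  measurable_fun setT f -> measurable [set x | c <= f x].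
Proof.
move=> mf; rewrite (_ : [set x | c <= f x] = setT `&` f @^-1` `[c, +oo[%classic).
  exact: mf.
by rewrite setTI; apply/seteqP; split=> x /=; rewrite in_itv /= andbT.
Qed.

Lemma measurable_set_le d (T : measurableType d) (f : T -> R) (c : R) :
  measurable_fun setT f -> measurable [set x | f x <= c].
Proof.
move=> mf; rewrite (_ : [set x | f x <= c] = setT `&` f @^-1` `]-oo, c]%classic).
  exact: mf.
by rewrite setTI; apply/seteqP; split=> x /=; rewrite in_itv.
Qed.

Lemma measurable_set_lt d (T : measurableType d) (f : T -> R) (c : R) :
  measurable_fun setT f -> measurable [set x | f x < c].
Proof.
move=> mf; rewrite (_ : [set x | f x < c] = setT `&` f @^-1` `]-oo, c[%classic).
  exact: mf.
by rewrite setTI; apply/seteqP; split=> x /=; rewrite in_itv.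
Qed.

Lemma measurable_cabs d (T : measurableType d) (D : set T) (F : T -> R[i]) :
  measurable_fun D (fun x => complex.Re (F x)) ->
  measurable_fun D (fun x => complex.Im (F x)) ->
  measurable_fun D (fun x => cabs (F x)).
Proof.
move=> mR mI; rewrite /cabs.
apply: (@measurableT_comp _ _ _ _ _ _ (@Num.sqrt R)).
  by apply: continuous_measurable_fun; exact: sqrt_continuous.
by apply: measurable_funD; apply: measurable_funX.
Qed.

Lemma measurable_cabs_toC : measurable_fun setT (fun q : (R * R)%type => cabs (toC q)).
Proof. by apply: measurable_cabs; [exact: measurable_fst|exact: measurable_snd]. Qed.

Lemma measurable_poly p :
  measurable_fun setT (fun q : (R * R)%type => complex.Re p.[toC q]) /\
  measurable_fun setT (fun q : (R * R)%type => complex.Im p.[toC q]).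
Proof.
elim/poly_ind: p => [|p c [IHR IHI]].
  split; rewrite (_ : (fun _ => _) = cst 0) //; apply/funext => q; rewrite horner0 //.
split.
  rewrite (_ : (fun _ => _) = fun q : (R * R)%type => complex.Re p.[toC q] * q.1
    - complex.Im p.[toC q] * q.2 + complex.Re c); last first.
    by apply/funext => q; rewrite !hornerE ReD ReM.
  by apply: measurable_funD => //; apply: measurable_funB; apply: measurable_funM.
rewrite (_ : (fun _ => _) = fun q : (R * R)%type => complex.Re p.[toC q] * q.2
    + complex.Im p.[toC q] * q.1 + complex.Im c); last first.
  by apply/funext => q; rewrite !hornerE ImD ImM.
by apply: measurable_funD => //; apply: measurable_funD; apply: measurable_funM.
Qed.

Lemma measurable_cabs_poly p :
  measurable_fun setT (fun q : (R * R)%type => cabs p.[toC q]).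
Proof. by have [? ?] := measurable_poly p; exact: measurable_cabs. Qed.

(** Removes the existential angle, to make measurability visible: the condition becomes Re (z e^{-i
    th}) > |z| cos h. This uses that the cosine decreases on [0, pi] and that |z| > 0, both
    available for h < 1. *)
Lemma windowE (th h : R) : 0 < h < 1 -> window th h =
  [set q | 1 - h < cabs (toC q)] `&` [set q | cabs (toC q) <= 1] `&`
  [set q | 0 < complex.Re (toC q * expi (- th)) - cabs (toC q) * cos h].
Proof.
move=> /andP[h0 h1]; have p2 := pi_ge2 R.
have hpi : h \in `[0, pi] by rewrite in_itv /=; apply/andP; split; lra.
apply/seteqP; split=> q /=.
  move=> [/andP[q1 q2] [phi [qE phih]]]; split=> //.
  change (0 < complex.Re (toC q * expi (- th)) - cabs (toC q) * cos h).
  have -> : toC q * expi (- th) = (cabs (toC q))%:C%C * expi (phi - th).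
    by rewrite {1}qE -mulrA -expiD.
  rewrite subr_gt0 ReM /= mul0r subr0.
  rewrite ltr_pM2l; last lra.
  rewrite -[ltRHS]cos_norm ltr_cos // in_itv /= normr_ge0 /=; lra.
move=> [[q1 q2] q3]; split; first by rewrite q1.
change (is_true (0 < complex.Re (toC q * expi (- th)) - cabs (toC q) * cos h)) in q3.
have [g gpi qg] := polar_pi (toC q * expi (- th)).
have cq : cabs (toC q * expi (- th)) = cabs (toC q) by rewrite cabsM cabs_expi mulr1.
exists (th + g); split.
  rewrite expiD mulrCA -{1}cq -qg mulrCA -expiD addrN expi0 mulr1 //.
move: q3; rewrite subr_gt0 qg cq ReM /= mul0r subr0 ltr_pM2l; last lra.
rewrite -[ltRHS]cos_norm ltr_cos // ?in_itv /= ?normr_ge0 ?gpi //.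
by rewrite addrAC subrr add0r.
Qed.

Lemma measurable_window (th h : R) : 0 < h < 1 -> measurable (window th h).
Proof.
move=> h01; rewrite windowE //; apply: measurableI; first apply: measurableI.
- exact: measurable_set_gt measurable_cabs_toC.
- exact: measurable_set_le measurable_cabs_toC.
apply: measurable_set_gt; apply: measurable_funB; last first.
  by apply: measurable_funM => //; exact: measurable_cabs_toC.
rewrite (_ : (fun _ => _) = fun q : (R * R)%type => q.1 * cos (- th) - q.2 * sin (- th)).
  by apply: measurable_funB; apply: measurable_funM.
by apply/funext => q; rewrite ReM.
Qed.

End PlaneMeasurability.

Section PoissonBound.
Variable R : realType.
Implicit Types (s x : R).

(** If cos y <= 1/2, the crude bound pi <= 4 gives y^2 / 32 <= 1/2. Otherwise the mean value theorem
    gives sin y >= y / 2, and the squared sine bounds 1 - cos y from below. *)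
Lemma one_sub_cos_ge x : `|x| <= pi -> x ^+ 2 / 32 <= 1 - cos x.
Proof.
rewrite -[cos x]cos_norm -[x ^+ 2]real_normK ?num_real //.
move: (normr_ge0 x); move: `|x| => y y0 ypi; have p4 := pihalf_02 R.
have p4' : (pi : R) <= 4 by lra.
have [c12|c12] := lerP (cos y) (1/2); first by nra.
move: y0; rewrite le_eqVlt => /predU1P[<-|y0]; first by rewrite cos0 expr0n /=; lra.
have siny : y / 2 <= sin y.
  have [t ty] := @MVT R sin cos 0 y y0 (fun t _ => is_derive_sin t)
    (continuous_subspaceT (@continuous_sin R)).
  rewrite sin0 !subr0 => ->; rewrite mulrC ler_pM2r //.
  move: ty; rewrite in_itv /= => /andP[t0 ty].
  apply: ltW; rewrite -[2^-1]mul1r; apply: lt_trans c12 _.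
  by rewrite ltr_cos // in_itv /=; apply/andP; split; lra.
have := cos2Dsin2 y; have := cos_le1 y; nra.
Qed.

(** 130 is 2 times 65: the 2 comes from 1 - s^2 <= 2 (1 - s), and 65 from d^2 + x^2 <= 65 [pden].
    For s >= 1/2 that follows from [one_sub_cos_ge]; for s < 1/2 from x^2 <= 16 <= 64 d^2. *)
Lemma poisson_le s x : 0 <= s < 1 -> `|x| <= pi ->
  poisson s x <= 130 * ((1 - s) / ((1 - s) ^+ 2 + x ^+ 2)).
Proof.
move=> /andP[s0 s1] xpi; set d := 1 - s; have d0 : 0 < d by rewrite /d; lra.
have D0 : 0 < d ^+ 2 + x ^+ 2 by rewrite ltr_pwDl ?exprn_gt0 ?sqr_ge0.
have h := one_sub_cos_ge xpi.
have denE : pden s x = d ^+ 2 + 2 * s * (1 - cos x) by rewrite /pden /d; ring.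
have den_ge : d ^+ 2 + x ^+ 2 <= 65 * pden s x.
  rewrite denE; have [s2|s2] := lerP (1/2) s; first by nra.
  have x16 : x ^+ 2 <= 16.
    rewrite -[x ^+ 2]real_normK ?num_real //; have p4 := pihalf_02 R.
    by have := normr_ge0 x; nra.
  have : 1 / 4 <= d ^+ 2 by rewrite /d; nra.
  by have := cos_le1 x; nra.
have den0 : 0 < pden s x by apply: pden_gt0; rewrite s0.
rewrite /poisson ler_pdivrMr //; apply: (@le_trans _ _ (2 * d * 1)).
  by rewrite /d; nra.
have -> : 130 * (d / (d ^+ 2 + x ^+ 2)) * pden s x =
  2 * d * (65 * pden s x / (d ^+ 2 + x ^+ 2)) by field; rewrite gt_eqF.
rewrite ler_wpM2l //; first lra.
by rewrite ler_pdivlMr // mul1r.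
Qed.

End PoissonBound.

(** * Dyadic stopping time *)

Section DyadicTree.
Variable R : realType.
Variables (mu : {measure set (R * R)%type -> \bar R}) (w : R -> R) (kap B lo hi : R).
Implicit Types (a l d th x y : R).
Hypothesis cw : continuous w.
Hypothesis w0 : forall t, 0 <= w t.
Hypothesis kap0 : 0 < kap.
Hypothesis B0 : 0 <= B.

(** Angular half-width 2 l about the midpoint: the window contains every point of depth at most l
    lying over the arc or over one of its two neighbours of the same length. *)
Definition arc_window (a l : R) : set (R * R)%type := window (a + l / 2) (2 * l).

Definition good_arc (a l : R) : bool := kap * l <= RI a (a + l) w.

(** Union of the windows over the maximal dyadic subarcs, down to generation [m], on which the mean
    of [w] reaches [kap]. Stopping at the first such arc makes the selected arcs non-overlapping. *)
Fixpoint stopping_region m (a l : R) : set (R * R)%type :=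
  if good_arc a l then arc_window a l else
  if m is k.+1 then
    stopping_region k a (l / 2) `|` stopping_region k (a + l / 2) (l / 2)
  else set0.

Hypothesis arcB : forall a l : R, 0 < l -> lo <= a -> a + l <= hi -> good_arc a l ->
  measurable (arc_window a l) /\ (mu (arc_window a l) <= (B * l)%:E)%E.

(** A selected arc pays B l <= (B / kap) times its integral of [w], and these integrals add up under
    bisection. *)
Lemma stopping_region_measure m a l : 0 < l -> lo <= a -> a + l <= hi ->
  measurable (stopping_region m a l) /\
  (mu (stopping_region m a l) <= (B / kap * RI a (a + l) w)%:E)%E.
Proof.
elim: m a l => [|m IH] a l l0 la hl /=; case: ifPn => [g|_].
- have [mW le] := arcB l0 la hl g; split=> //; apply: le_trans le _.
  by rewrite lee_fin -mulrA ler_wpM2l // ler_pdivlMl.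
- split=> //; rewrite measure0 lee_fin; apply: mulr_ge0; last exact: RI_ge0.
  by rewrite divr_ge0 // ltW.
- have [mW le] := arcB l0 la hl g; split=> //; apply: le_trans le _.
  by rewrite lee_fin -mulrA ler_wpM2l // ler_pdivlMl.
- have [m1 le1] := IH a (l / 2) ltac:(lra) la ltac:(lra).
  have [m2 le2] := IH (a + l / 2) (l / 2) ltac:(lra) ltac:(lra) ltac:(lra).
  split; first exact: measurableU.
  apply: le_trans (measureU2 _ m1 m2) _.
  apply: le_trans (leeD le1 le2) _; rewrite -EFinD lee_fin -mulrDr.
  have -> : a + l / 2 + l / 2 = a + l by field.
  by rewrite -RI_split //; lra.
Qed.

Variable v : R -> R.
Hypothesis cv : continuous v.
Hypothesis v0 : forall t, 0 <= v t.
Hypothesis vw : forall t, v t <= w t + kap.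

Lemma not_good_arc a l : 0 < l -> ~~ good_arc a l -> RI a (a + l) v <= 2 * kap * l.
Proof.
rewrite -ltNge => l0 h.
have : RI a (a + l) v <= RI a (a + l) w + kap * l.
  have -> : kap * l = RI a (a + l) (fun=> kap) by rewrite RI_cst; [congr (_ * _); ring|lra].
  rewrite -RID //; last by move=> ?; exact: cvg_cst.
  by apply: RI_le => // t; apply: cvgD; [exact: cw|exact: cvg_cst].
lra.
Qed.

(** Up to a constant, the Poisson kernel of the half-plane at height [d]; by [poisson_le] it
    majorizes the kernel of the disc. *)
Definition kernel (d x : R) := d / (d ^+ 2 + x ^+ 2).

Lemma continuous_kernel d th : 0 < d -> continuous (fun t : R => kernel d (t - th)).
Proof.
move=> d0 t; apply: cvgM; first exact: cvg_cst.
apply: cvgV; first by rewrite gt_eqF // ltr_pwDl ?exprn_gt0 ?sqr_ge0.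
have c : continuous (fun t : R => t - th) by move=> u; apply: cvgB; [exact: cvg_id|exact: cvg_cst].
apply: cvgD; first exact: cvg_cst.
by apply: (@continuous_comp _ _ _ (fun t : R => t - th) (fun x => x ^+ 2)); [exact: c|exact: exprn_continuous].
Qed.

Lemma kernel_ge0 d x : 0 < d -> 0 <= kernel d x.
Proof. by move=> d0; rewrite divr_ge0 ?ltW // ltr_pwDl ?exprn_gt0 ?sqr_ge0. Qed.

Lemma kernel_le_inv d x : 0 < d -> kernel d x <= d^-1.
Proof.
move=> d0; rewrite ler_pdivrMr ?ltr_pwDl ?exprn_gt0 ?sqr_ge0 //.
by rewrite mulrDr expr2 mulrA mulVf ?gt_eqF // mul1r lerDl mulr_ge0 ?invr_ge0 ?sqr_ge0 ?ltW.
Qed.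

Lemma kernel_le_far d x y : 0 < d -> 0 < y -> y <= `|x| -> kernel d x <= d / y ^+ 2.
Proof.
move=> d0 y0 yx; apply: ler_wpM2l; first exact: ltW.
rewrite lef_pV2 ?posrE ?ltr_pwDl ?exprn_gt0 ?sqr_ge0 //.
rewrite -[x ^+ 2]real_normK ?num_real // ler_wpDl ?sqr_ge0 //.
by rewrite lerXn2r ?nnegrE // ltW.
Qed.

Lemma RI_kernel_le d th a b c : 0 <= c -> 0 < d -> a <= b ->
  (forall t, a <= t <= b -> kernel d (t - th) <= c) ->
  RI a b (fun t => kernel d (t - th) * v t) <= c * RI a b v.
Proof.
move=> c0 d0 ab h; rewrite -RIZ //; apply: RI_le.
- by move=> t; apply: cvgM; [exact: continuous_kernel|exact: cv].
- by move=> t; apply: cvgM; [exact: cvg_cst|exact: cv].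
by move=> t tab; rewrite ler_wpM2r // h.
Qed.

Lemma RI_triple_le a l : 0 < l -> ~~ good_arc (a - l) l -> ~~ good_arc a l ->
  ~~ good_arc (a + l) l -> RI (a - l) (a + 2 * l) v <= 6 * kap * l.
Proof.
move=> l0 /(not_good_arc l0) h1 /(not_good_arc l0) h2 /(not_good_arc l0) h3.
move: h1 h3; rewrite subrK (_ : a + l + l = a + 2 * l); last ring.
move=> h1 h3.
have i1 : a - l <= a by rewrite gerBl ltW.
have i2 : a <= a + l by rewrite lerDl ltW.
have i3 : a + l <= a + 2 * l by rewrite lerD2l ler_peMl ?(ltW l0) // ler1n.
rewrite (RI_split cv i1 (le_trans i2 i3)) (RI_split cv i2 i3).
clear i1 i2 i3; lra.
Qed.

(** Bottom of the descent, at a scale comparable to [d], where the bound 1 / d of the kernel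
    suffices: it gives 12 kap, and 36 - 24 (d / l) is at least 12 since d <= l. *)
Lemma kernel_base a l th d : 0 < d -> d <= l -> l < 2 * d ->
  RI (a - l) (a + 2 * l) v <= 6 * kap * l ->
  RI (a - l) (a + 2 * l) (fun t => kernel d (t - th) * v t) <= kap * (36 - 24 * (d / l)).
Proof.
move=> d0 dl l2d h; have l0 : 0 < l by lra.
have dl1 : d / l <= 1 by rewrite ler_pdivrMr // mul1r.
apply: le_trans (@RI_kernel_le d th _ _ d^-1 _ d0 _ _) _.
- by rewrite invr_ge0 ltW.
- lra.
- by move=> t _; exact: kernel_le_inv.
have kd : 6 * kap * l <= 12 * kap * d.
  have : 0 <= kap * (2 * d - l) by rewrite mulr_ge0 ?(ltW kap0) // subr_ge0 ltW.
  lra.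
apply: (@le_trans _ _ (d^-1 * (12 * kap * d))).
  by rewrite ler_wpM2l ?invr_ge0 ?(ltW d0) //; exact: le_trans h kd.
have -> : d^-1 * (12 * kap * d) = 12 * kap by field; rewrite gt_eqF.
have : kap * 12 <= kap * (36 - 24 * (d / l)) by rewrite ler_wpM2l ?(ltW kap0) //; lra.
lra.
Qed.

(* Descending towards [th], the part of the tripled arc lost at each halving lies at distance at least [l / 2] from [th]. *)
Lemma kernel_descent a a' l th d : 0 < d -> 0 < l ->
  RI (a - l) (a + 2 * l) v <= 6 * kap * l ->
  a - l <= a' - l / 2 -> a' + 2 * (l / 2) <= a + 2 * l -> a' <= th <= a' + l / 2 ->
  RI (a' - l / 2) (a' + 2 * (l / 2)) (fun t => kernel d (t - th) * v t) <=
    kap * (36 - 24 * (d / (l / 2))) ->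
  RI (a - l) (a + 2 * l) (fun t => kernel d (t - th) * v t) <= kap * (36 - 24 * (d / l)).
Proof.
move=> d0 l0 v3 h1 h2 /andP[h3 h4] h5.
have far (t : R) : l / 2 <= `|t - th| -> kernel d (t - th) <= 4 * d / l ^+ 2.
  move=> ht; have := @kernel_le_far d (t - th) (l / 2) d0 ltac:(lra) ht.
  by rewrite expr_div_n invf_div mulrA; congr (_ <= _); rewrite -natrX; ring.
have cQv : continuous (fun t => kernel d (t - th) * v t).
  by move=> t; apply: cvgM; [exact: continuous_kernel|exact: cv].
have c0 : 0 <= 4 * d / l ^+ 2 by rewrite divr_ge0 ?mulr_ge0 ?sqr_ge0 // ltW.
have i1 : a' - l / 2 <= a' + 2 * (l / 2) by clear h1 h2 h3 h4 h5 v3 far cQv c0; lra.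
have i2 : a' - l / 2 <= a + 2 * l by exact: le_trans i1 h2.
have e1 : RI (a - l) (a' - l / 2) (fun t => kernel d (t - th) * v t) <=
    4 * d / l ^+ 2 * RI (a - l) (a' - l / 2) v.
  apply: RI_kernel_le => // t /andP[_ t2]; apply: far.
  rewrite ler0_norm; clear d0 h1 h2 h4 h5 v3 cQv c0 i1 i2; lra.
have e2 : RI (a' + 2 * (l / 2)) (a + 2 * l) (fun t => kernel d (t - th) * v t) <=
    4 * d / l ^+ 2 * RI (a' + 2 * (l / 2)) (a + 2 * l) v.
  apply: RI_kernel_le => // t /andP[t1 _]; apply: far.
  rewrite ger0_norm; clear d0 h1 h2 h3 h5 v3 cQv c0 i1 i2 e1; lra.
have s1 := RI_split cv h1 i2; have s2 := RI_split cv i1 h2.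
have s3 : 0 <= RI (a' - l / 2) (a' + 2 * (l / 2)) v by exact: RI_ge0.
rewrite (RI_split cQv h1 i2) (RI_split cQv i1 h2).
have e3 : 4 * d / l ^+ 2 * (RI (a - l) (a' - l / 2) v + RI (a' + 2 * (l / 2)) (a + 2 * l) v)
    <= 4 * d / l ^+ 2 * (6 * kap * l).
  by rewrite ler_wpM2l //; clear far cQv c0 e1 e2 h1 h2 h3 h4 h5 i1 i2 d0 l0; lra.
have e4 : 4 * d / l ^+ 2 * (6 * kap * l) = 24 * kap * (d / l) by field; rewrite gt_eqF.
(* The term subtracted from 36 doubles at each halving. The slack so gained, 24 (d / l), is exactly
   the cost [e4] of the part of the tripled arc that is lost. *)
have e5 : d / (l / 2) = 2 * (d / l) by field; rewrite gt_eqF.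
rewrite e4 mulrDr in e3; rewrite e5 in h5; clear far cQv c0 h1 h2 h3 h4 i1 i2 d0 l0 s1 s2 s3 v3 e4 e5; lra.
Qed.

(** Outside the three regions, the arc containing [th] and both its neighbours are never selected on
    the way down, so the mean of [v] over the tripled arc stays bounded at every scale. The
    condition relating [l] and 2^m ensures that the scale [d] is reached before the generations run
    out. *)
Lemma kernel_off_region m a l th d (q : R * R) : 0 < d -> d <= l -> l < 2 ^+ m * (2 * d) ->
  a <= th <= a + l -> toC q = (1 - d)%:C%C * expi th -> d <= 1 ->
  ~ stopping_region m (a - l) l q -> ~ stopping_region m a l q ->
  ~ stopping_region m (a + l) l q ->
  RI (a - l) (a + 2 * l) (fun t => kernel d (t - th) * v t) <= kap * (36 - 24 * (d / l)).
Proof.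
move=> d0; elim: m a l => [|m IH] a l dl lm /andP[th1 th2] qE d1 n1 n2 n3.
all: have l0 : 0 < l by lra.
all: have cq : cabs (toC q) = 1 - d by rewrite qE cabsM cabs_expi mulr1 cabsR ger0_norm; lra.
all: have inW (b : R) : `|th - (b + l / 2)| < 2 * l -> arc_window b l q
  by move=> hb; split; [rewrite cq; lra|exists th; split=> //; rewrite cq].
all: have g1 : ~~ good_arc (a - l) l by apply/negP => g; apply: n1; rewrite /= g; apply: inW;
  rewrite ltr_norml; lra.
all: have g2 : ~~ good_arc a l by apply/negP => g; apply: n2; rewrite /= g; apply: inW;
  rewrite ltr_norml; lra.
all: have g3 : ~~ good_arc (a + l) l by apply/negP => g; apply: n3; rewrite /= g; apply: inW;
  rewrite ltr_norml; lra.
all: have v3 := RI_triple_le l0 g1 g2 g3.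
  by apply: kernel_base => //; rewrite expr0 mul1r in lm.
have [l2d|l2d] := ltrP l (2 * d); first exact: kernel_base.
move: n1 n2 n3; rewrite /= (negbTE g1) (negbTE g2) (negbTE g3).
move=> /not_orP[n11 n12] /not_orP[n21 n22] /not_orP[n31 n32].
have lm' : l / 2 < 2 ^+ m * (2 * d) by move: lm; rewrite exprS; lra.
(* The half containing [th] becomes the new middle arc; it and its neighbours are among the six
   halves of the three arcs just divided. *)
have [thm|thm] := lerP th (a + l / 2).
  apply: (kernel_descent d0 l0 v3 (a' := a)); try lra.
  apply: IH => //; try (clear v3 cq l0; lra).
  by rewrite (_ : a - l / 2 = a - l + l / 2) //; field.
apply: (kernel_descent d0 l0 v3 (a' := a + l / 2)); try lra.
apply: IH => //; try (clear v3 cq l0; lra).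
- by rewrite addrK.
- by rewrite -addrA -splitr.
Qed.

End DyadicTree.

(** * The weak-type estimate *)

Section WeakType.
Variable R : realType.
Variable mu : {measure set (R * R)%type -> \bar R}.
Implicit Types (p : {poly R[i]}) (kap a l th d delta B : R).

Lemma continuous_sqrt_poly p : continuous (fun t : R => Num.sqrt (cabs p.[expi t])).
Proof.
by apply: continuous_fcomp; [exact: continuous_cabs_poly|exact: sqrt_continuous].
Qed.

Lemma continuous_excess (v : R -> R) kap :
  continuous v -> continuous (fun t => Num.max (v t - kap) 0).
Proof.
move=> cv t; apply: (@continuous_max _ _ (fun t => v t - kap) (fun=> 0)).
  by apply: cvgB; [exact: cv|exact: cvg_cst].
exact: cvg_cst.
Qed.

Lemma sqrt_le_sqr (x y : R) : 0 <= x -> Num.sqrt x <= y -> x <= y ^+ 2.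
Proof.
move=> x0 xy; rewrite -[leLHS]sqr_sqrtr // lerXn2r ?nnegrE ?sqrtr_ge0 //.
exact: le_trans (sqrtr_ge0 _) xy.
Qed.

(** The descent starts from the arc [0, 2 pi], whose neighbours are the adjacent periods; hence the
    interval [-2 pi, 4 pi]. *)
Lemma RI_three_periods (f : R -> R) : continuous f ->
  RI (- (2 * pi)) (4 * pi) f = RI (- (2 * pi)) (- (2 * pi) + 2 * pi) f +
    RI 0 (0 + 2 * pi) f + RI (2 * pi) (2 * pi + 2 * pi) f.
Proof.
move=> cf; have p2 := pi_ge2 R.
rewrite (@RI_split R (- (2 * pi)) 0 (4 * pi)) //; try lra.
rewrite (@RI_split R 0 (2 * pi) (4 * pi)) //; try lra.
rewrite addNr add0r (_ : 2 * pi + 2 * pi = 4 * pi); last ring.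
by rewrite addrA.
Qed.

Lemma RI_periodic (f : R -> R) : continuous f -> (forall t, f (t + 2 * pi) = f t) ->
  RI (- (2 * pi)) (4 * pi) f = 3 * RI 0 (2 * pi) f.
Proof.
move=> cf per; have p2 := pi_ge2 R; rewrite RI_three_periods // add0r.
have E1 : RI 0 (2 * pi) f = RI (- (2 * pi)) (- (2 * pi) + 2 * pi) f.
  have := @RI_shift R (- (2 * pi)) 0 (2 * pi) f ltac:(lra) cf.
  by rewrite addNr add0r => ->; apply: eq_RI => t _; exact: per.
have E2 : RI (2 * pi) (2 * pi + 2 * pi) f = RI 0 (2 * pi) f.
  have := @RI_shift R 0 (2 * pi) (2 * pi) f ltac:(lra) cf.
  by rewrite add0r => ->; apply: eq_RI => t _; exact: per.
by rewrite -E1 E2; ring.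
Qed.

(** 4680 is 130 times 36: the comparison constant of [poisson_le] times the constant of
    [kernel_off_region]. The factor 2 pi on the left of [sqrt_submean] is simply bounded below by
    1. *)
Lemma off_region_le p kap delta N (q : R * R) : 0 < kap -> 0 < delta ->
  2 * pi < 2 ^+ N * (2 * delta) -> cabs (toC q) <= 1 - delta ->
  let T a := stopping_region (fun t => Num.max (Num.sqrt (cabs p.[expi t]) - kap) 0)
    kap N a (2 * pi) in
  ~ T (- (2 * pi)) q -> ~ T 0 q -> ~ T (2 * pi) q ->
  cabs p.[toC q] <= (4680 * kap) ^+ 2.
Proof.
move=> kap0 delta0 hN q1 /=; set w := (fun t : R => _) => n1 n2 n3.
have p2 := pi_ge2 R.
have cv := @continuous_sqrt_poly p.
have cw : continuous w by exact: continuous_excess.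
have vw t : Num.sqrt (cabs p.[expi t]) <= w t + kap by rewrite -lerBlDr le_max lexx.
have [th th2 qE] := polar_2pi (toC q).
set v := (fun t : R => Num.sqrt (cabs p.[expi t])) in cv vw.
have v0 t : 0 <= v t by exact: sqrtr_ge0.
move: qE q1 (cabs_ge0 (toC q)); set s := cabs (toC q) => qE q1 s0.
have s01 : 0 <= s < 1 by clear -s0 q1 delta0; lra.
have d0 : 0 < 1 - s by clear -q1 delta0; lra.
have s1 : 1 - s <= 1 by clear -s0; lra.
have d2 : 1 - s <= 2 * pi by clear -s0 p2; lra.
have pp : 0 < 2 * pi :> R by clear -p2; lra.
have hN' : 2 * pi < 2 ^+ N * (2 * (1 - s)).
  apply: lt_le_trans hN _; rewrite ler_wpM2l ?exprn_ge0 //; clear -q1; lra.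
have th2' : 0 <= th <= 0 + 2 * pi by rewrite add0r.
have qE' : toC q = (1 - (1 - s))%:C%C * expi th by rewrite opprB addrC subrK.
have {}n1 : ~ stopping_region w kap N (0 - 2 * pi) (2 * pi) q by rewrite sub0r.
have {}n3 : ~ stopping_region w kap N (0 + 2 * pi) (2 * pi) q by rewrite add0r.
have := @kernel_off_region R w kap cw kap0 v cv v0 vw N 0 (2 * pi) th (1 - s) q
  d0 d2 hN' th2' qE' s1 n1 n2 n3.
rewrite !add0r => k1.
have {k1} k : RI (- (2 * pi)) (2 * (2 * pi)) (fun t => kernel (1 - s) (t - th) * v t) <= kap * 36.
  apply: le_trans k1 _; rewrite ler_wpM2l ?(ltW kap0) // gerBl mulr_ge0 //.
  by rewrite divr_ge0 // ltW.
(* The period is centred at [th], so that [poisson_le] applies on all of it; it still lies inside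
   [-2 pi, 4 pi]. *)
have := @sqrt_submean R p s (th - pi) th s01; rewrite -qE -/v => sm.
have cK : continuous (fun t => kernel (1 - s) (t - th) * v t).
  by move=> t; apply: cvgM; [exact: continuous_kernel|exact: cv].
have sm2 : RI (th - pi) (th - pi + 2 * pi) (fun t => poisson s (t - th) * v t) <=
    130 * (kap * 36).
  apply: (@le_trans _ _ (RI (th - pi) (th - pi + 2 * pi)
      (fun t => 130 * (kernel (1 - s) (t - th) * v t)))).
    apply: RI_le.
    - by move=> t; apply: cvgM; [exact: continuous_poisson|exact: cv].
    - by move=> t; apply: cvgM; [exact: cvg_cst|exact: cK].
    move=> t /andP[t1 t2]; rewrite mulrA ler_wpM2r //.
    apply: poisson_le => //; rewrite ler_norml; clear -t1 t2 p2; lra.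
  rewrite RIZ // ler_wpM2l //; apply: le_trans k; case/andP: th2 => th1 th2.
  apply: RI_subset => //; try (clear -th1 th2 p2; lra).
  by move=> t; rewrite mulr_ge0 // kernel_ge0.
have {sm2} sm : 2 * pi * Num.sqrt (cabs p.[toC q]) <= 4680 * kap.
  by apply: le_trans sm _; apply: le_trans sm2 _; clear; lra.
have sq0 := sqrtr_ge0 (cabs p.[toC q]).
have vz : Num.sqrt (cabs p.[toC q]) <= 4680 * kap.
  apply: le_trans sm; rewrite ler_peMl //; clear -p2; lra.
exact: sqrt_le_sqr (cabs_ge0 _) vz.
Qed.

(** Keeping the distance [delta] from the circle makes finitely many generations sufficient, while
    the resulting bound does not involve [delta]. *)
Lemma weak_type p kap delta B : 0 < kap -> 0 < delta -> 0 <= B ->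
  let w t := Num.max (Num.sqrt (cabs p.[expi t]) - kap) 0 in
  (forall a l, 0 < l -> - (2 * pi) <= a -> a + l <= 4 * pi -> good_arc w kap a l ->
    measurable (arc_window a l) /\ (mu (arc_window a l) <= (B * l)%:E)%E) ->
  (mu [set q : (R * R)%type | (cabs (toC q) <= 1 - delta)%R /\
      ((4680 * kap) ^+ 2 < cabs p.[toC q])%R] <=
    (B / kap * RI (- (2 * pi)) (4 * pi) w)%:E)%E.
Proof.
move=> kap0 delta0 B0 w arcB; set E := [set q | _].
have p2 := pi_ge2 R.
have cv := @continuous_sqrt_poly p.
have cw : continuous w by exact: continuous_excess.
have w0 t : 0 <= w t by rewrite le_max lexx orbT.
have [N hN] : exists N, 2 * pi < 2 ^+ N * (2 * delta).
  have [N hN] := @exp_small R 2^-1 (delta / (2 * pi)) ltac:(lra) ltac:(rewrite divr_gt0 //; lra).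
  exists N; move: hN; rewrite exprVn ler_pdivlMr; last lra.
  rewrite ler_pdivrMl ?exprn_gt0 // => hN.
  have : 0 < 2 ^+ N * delta :> R by rewrite mulr_gt0 ?exprn_gt0.
  lra.
pose T a := stopping_region w kap N a (2 * pi).
have pp : 0 < 2 * pi :> R by lra.
have Tm a : - (2 * pi) <= a -> a + 2 * pi <= 4 * pi -> measurable (T a) /\
    (mu (T a) <= (B / kap * RI a (a + 2 * pi) w)%:E)%E.
  exact: (@stopping_region_measure R mu w kap B _ _ cw w0 kap0 B0 arcB N a _ pp).
have [m1 l1] := Tm (- (2 * pi)) ltac:(lra) ltac:(lra).
have [m2 l2] := Tm 0 ltac:(lra) ltac:(lra).
have [m3 l3] := Tm (2 * pi) ltac:(lra) ltac:(lra).
have mE : measurable E.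
  rewrite (_ : E = [set q | cabs (toC q) <= 1 - delta] `&`
    [set q | (4680 * kap) ^+ 2 < cabs p.[toC q]]) //.
  apply: measurableI; first exact: measurable_set_le (@measurable_cabs_toC R).
  exact: measurable_set_gt (measurable_cabs_poly p).
have ET : E `<=` T (- (2 * pi)) `|` T 0 `|` T (2 * pi).
  move=> q [q1 q2]; apply: contrapT => /not_orP[/not_orP[n1 n2] n3].
  have := @off_region_le p kap delta N q kap0 delta0 hN q1 n1 n2 n3.
  by rewrite leNgt q2.
have mT : measurable (T (- (2 * pi)) `|` T 0) by exact: measurableU.
apply: (@le_trans _ _ (mu (T (- (2 * pi)) `|` T 0 `|` T (2 * pi)))).
  by apply: le_measure => //; rewrite inE //; exact: measurableU.
apply: le_trans (measureU2 _ mT m3) _.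
apply: le_trans (leeD (le_trans (measureU2 _ m1 m2) (leeD l1 l2)) l3) _.
by rewrite -!EFinD lee_fin (RI_three_periods cw) !mulrDr.
Qed.

End WeakType.

(** * Summation over dyadic levels *)

Section DyadicLevels.
Variable R : realType.
Variables (Psi : R -> R).
Hypothesis oPsi : orlicz Psi.

Lemma RI_sum (a b : R) n (f : nat -> R -> R) : (forall j, continuous (f j)) ->
  a <= b -> continuous (fun t => \sum_(j < n) f j t) /\
  RI a b (fun t => \sum_(j < n) f j t) = \sum_(j < n) RI a b (f j).
Proof.
move=> cf ab; elim: n => [|n [IHc IH]].
  split; first by apply: (@eq_continuous _ (fun=> 0)) => [t|t]; rewrite ?big_ord0 //; exact: cvg_cst.
  rewrite big_ord0 -[RHS](mul0r (b - a)) -RI_cst //.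
  by apply: eq_RI => t _; rewrite big_ord0.
have E t : \sum_(j < n) f j t + f n t = \sum_(j < n.+1) f j t by rewrite big_ord_recr.
split; first by apply: (eq_continuous E) => t; apply: cvgD; [exact: IHc|exact: cf].
rewrite big_ord_recr /= -IH -RID //.
by apply: eq_RI => t _; rewrite E.
Qed.

Lemma orlicz_mono_div (x y eps : R) : 0 < eps -> 0 <= x -> x <= y ->
  0 <= Psi (x / eps) <= Psi (y / eps).
Proof.
move=> e0 x0 xy; have xe : 0 <= x / eps by rewrite divr_ge0 // ltW.
rewrite (orlicz_ge0 oPsi) //=; apply: (orlicz_mono oPsi) => //.
by rewrite ler_wpM2r // invr_ge0 ltW.
Qed.

(** One term suffices: for the last j with t j < x one has x <= t j.+1. If there is no such j then x
    <= t 0, and the left side vanishes by the choice of [T]. *)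
Lemma layer_sum (T x eps : R) (t : nat -> R) J : 0 < eps -> 0 <= x -> (forall j, 0 <= t j) ->
  Psi (t 0%N / eps) <= T -> x <= t J ->
  Num.max (Psi (x / eps) - T) 0 <=
    \sum_(j < J) (if t j < x then Psi (t j.+1 / eps) else 0).
Proof.
move=> e0 x0 t0 hT; elim: J => [|J IH] xJ.
  rewrite big_ord0 ge_max lexx andbT subr_le0; apply: le_trans hT.
  by case/andP: (orlicz_mono_div e0 x0 xJ).
rewrite big_ord_recr /=; case: (ltP (t J) x) => [xt|xt]; last by rewrite addr0; exact: IH.
have s0 : 0 <= \sum_(j < J) (if t j < x then Psi (t j.+1 / eps) else 0).
  apply: sumr_ge0 => j _; case: ifP => // _.
  by case/andP: (orlicz_mono_div e0 (t0 j.+1) (lexx _)).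
have T0 : 0 <= T by apply: le_trans hT; case/andP: (orlicz_mono_div e0 (t0 0%N) (lexx _)).
have /andP[P0 P] := orlicz_mono_div e0 x0 xJ.
by rewrite ge_max; apply/andP; split; lra.
Qed.

(** This is where the square root pays off: homogeneity at the squares bounds the term of level k <
    v by (k / v) Psi (v^2), and the levels below [v] form a geometric progression with sum at most 2
    v. *)
Lemma excess_sum (k0 v : R) J : 0 < k0 -> 0 <= v ->
  \sum_(j < J) Psi ((k0 * 2 ^+ j) ^+ 2) / (k0 * 2 ^+ j) * Num.max (v - k0 * 2 ^+ j) 0
  <= 2 * Psi (v ^+ 2).
Proof.
move=> k00 v0; pose k j := k0 * 2 ^+ j; have kp j : 0 < k j by rewrite mulr_gt0 // exprn_gt0.
have P0 : 0 <= Psi (v ^+ 2) by apply: (orlicz_ge0 oPsi); rewrite sqr_ge0.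
move: v0; rewrite le_eqVlt => /predU1P[v0|v0].
  rewrite big1 ?mulr_ge0 // => j _; rewrite -v0 sub0r max_r ?mulr0 // oppr_le0.
  by have := kp j; rewrite /k => /ltW.
have term j : Psi (k j ^+ 2) / k j * Num.max (v - k j) 0 <=
    (if k j < v then k j else 0) * (Psi (v ^+ 2) / v).
  case: ltP => kv; last by rewrite mul0r max_r ?mulr0 // subr_le0.
  rewrite max_l ?subr_ge0 ?(ltW kv) //.
  have h : Psi (k j ^+ 2) <= (k j / v) ^+ 2 * Psi (v ^+ 2).
    have {1}-> : k j ^+ 2 = (k j / v) ^+ 2 * v ^+ 2.
      by rewrite -exprMn divfK // gt_eqF.
    apply: (orlicz_scale oPsi); last exact: sqr_ge0.
    have kv0 : 0 <= k j / v by rewrite divr_ge0 ?(ltW v0) ?(ltW (kp j)).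
    by rewrite sqr_ge0 /= expr_le1 // ler_pdivrMr // mul1r ltW.
  apply: (@le_trans _ _ (Psi (k j ^+ 2) / k j * v)).
    rewrite ler_wpM2l ?divr_ge0 ?(ltW (kp j)) ?(orlicz_ge0 oPsi) ?sqr_ge0 //.
    by rewrite gerBl ltW.
  have -> : k j * (Psi (v ^+ 2) / v) = (k j / v) ^+ 2 * Psi (v ^+ 2) / k j * v.
    by field; rewrite !gt_eqF // kp.
  by rewrite ler_wpM2r ?(ltW v0) // ler_wpM2r // invr_ge0 (ltW (kp j)).
apply: le_trans (ler_sum _ (fun (j : 'I_J) _ => term j)) _; rewrite -mulr_suml.
(* The bound by k_J is carried along to close the induction: when k_J < v, the new sum is at most 2
   k_J < 2 v. *)
have S : \sum_(j < J) (if k j < v then k j else 0) <= Num.min (k J) (2 * v).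
  elim: J => [|J IH]; first by rewrite big_ord0 le_min ltW //= ltW // mulr_gt0.
  move: IH; rewrite big_ord_recr /= !le_min => /andP[h1 h2].
  have -> : k J.+1 = 2 * k J by rewrite /k exprS; ring.
  have kJ := kp J; set S := \sum_(j < J) _ in h1 h2 *.
  by case: (ltP (k J) v) => kv; apply/andP; split; lra.
move: S; rewrite le_min => /andP[_ S].
apply: (@le_trans _ _ (2 * v * (Psi (v ^+ 2) / v))).
  by rewrite ler_wpM2r // divr_ge0 // ltW.
rewrite (_ : _ * _ = 2 * Psi (v ^+ 2)) //; field; exact: lt0r_neq0.
Qed.

End DyadicLevels.

Section LayeredIntegral.
Context d (T : measurableType d) (R : realType) (mu : {measure set T -> \bar R}).

Lemma integral_layers_le (D : set T) n (c b : nat -> R) (E : nat -> set T) (g : T -> R) :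
  measurable D -> (forall j, measurable (E j)) -> (forall j, 0 <= c j) ->
  (forall x, D x -> 0 <= g x <= \sum_(j < n) c j * \1_(E j) x) ->
  (forall j, (j < n)%N -> ((c j)%:E * mu (E j) <= (b j)%:E)%E) ->
  (\int[mu]_(x in D) (g x)%:E <= (\sum_(j < n) b j)%:E)%E.
Proof.
move=> mD mE c0 gc cb.
apply: (@le_trans _ _ (\int[mu]_(x in D) \sum_(j < n) ((c j)%:E * (\1_(E j) x)%:E))%E).
  apply: ge0_le_integral_nomeas => x Dx; have /andP[g0 g1] := gc x Dx; first by rewrite lee_fin.
  by rewrite (eq_bigr (fun j : 'I_n => (c j * \1_(E j) x)%:E)) // sumEFin lee_fin.
rewrite ge0_integral_sum //; last 2 first.
- by move=> j; apply: emeasurable_funM => //; apply/measurable_EFinP; exact: measurable_funTS.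
- by move=> j x _; rewrite mule_ge0 ?lee_fin.
rewrite -sumEFin; apply: lee_sum => j _.
rewrite ge0_integralZl_EFin //; last first.
  by apply/measurable_EFinP; exact: measurable_funTS.
rewrite integral_indic //; apply: le_trans (cb j (ltn_ord j)).
rewrite lee_wpmul2l ?lee_fin //; apply: le_measure; rewrite ?inE //.
by apply: measurableI.
Qed.

End LayeredIntegral.

(** * Uniform tail estimate for polynomials *)

Section PolynomialEstimate.
Variables (R : realType) (mu : {measure set (R * R)%type -> \bar R}) (Psi1 Psi2 : R -> R).
Hypotheses (o1 : orlicz Psi1) (o2 : orlicz Psi2).
Hypothesis KC : K_cond Psi1 Psi2 mu.
Implicit Types (p : {poly R[i]}) (kap delta eps eta : R).

Lemma continuous_orlicz_poly (Psi : R -> R) (c : R) p : orlicz Psi -> 0 <= c ->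
  continuous (fun t : R => Psi (cabs p.[expi t] / c)).
Proof.
move=> oP c0; apply: (@eq_continuous _ (fun t => Psi (Num.max 0 (cabs p.[expi t] / c)))).
  by move=> t; rewrite max_r // divr_ge0 // cabs_ge0.
apply: (@continuous_fcomp _ (fun t : R => cabs p.[expi t] / c) (fun x => Psi (Num.max 0 x))).
  by move=> t; apply: cvgM; [exact: continuous_cabs_poly|exact: cvg_cst].
exact: orlicz_continuous oP.
Qed.

(** For v > kap the excess is at most v <= v^2 / kap, and (v / kap)^2 Psi1 (kap^2) <= Psi1 (v^2) by
    convexity. *)
Lemma excess_le_orlicz kap (v : R) : 0 < kap -> 0 <= v ->
  Num.max (v - kap) 0 <= kap / Psi1 (kap ^+ 2) * Psi1 (v ^+ 2).
Proof.
move=> k0 v0; have kp : 0 < Psi1 (kap ^+ 2) by apply: (orlicz_gt0 o1); rewrite exprn_gt0.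
have c0 : 0 <= kap / Psi1 (kap ^+ 2) by rewrite divr_ge0 // ltW.
have [vk|vk] := lerP v kap.
  rewrite max_r ?subr_le0 // mulr_ge0 // (orlicz_ge0 o1) // sqr_ge0 //.
rewrite max_l ?subr_ge0 ?(ltW vk) //.
have vp : 0 < v by exact: lt_trans vk.
have h : (v / kap) ^+ 2 * Psi1 (kap ^+ 2) <= Psi1 (v ^+ 2).
  have {1}-> : v ^+ 2 = (v / kap) ^+ 2 * kap ^+ 2 by rewrite -exprMn divfK // gt_eqF.
  apply: (orlicz_scale_ge o1); last exact: sqr_ge0.
  rewrite expr_ge1 ?divr_ge0 ?(ltW vp) ?(ltW k0) //.
  by rewrite ler_pdivlMr // mul1r ltW.
apply: (@le_trans _ _ (kap / Psi1 (kap ^+ 2) * ((v / kap) ^+ 2 * Psi1 (kap ^+ 2)))); last first.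
  by rewrite ler_wpM2l.
have -> : kap / Psi1 (kap ^+ 2) * ((v / kap) ^+ 2 * Psi1 (kap ^+ 2)) = v * (v / kap).
  by field; rewrite !lt0r_neq0.
apply: (@le_trans _ _ v); first by rewrite gerBl ltW.
by rewrite ler_peMr // ler_pdivlMr // mul1r ltW.
Qed.

(** A good arc is short: its integral of [w] is at least kap l, but at most kap / Psi1 (kap^2) times
    6 pi, the bound for three periods. Hence 2 l <= H, and the supremum defining Kmu H controls the
    window of size 2 l. *)
Lemma arc_measure_le p kap (eta A : R) (a l : R) :
  let w t := Num.max (Num.sqrt (cabs p.[expi t]) - kap) 0 in
  let H := 12 * pi / Psi1 (kap ^+ 2) in
  0 < kap -> H < 1 ->
  (Kmu mu H <= (eta * (H^-1 / Psi2 (A * orlicz_inv Psi1 H^-1)))%:E)%E ->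
  RI (- (2 * pi)) (4 * pi) (fun t => Psi1 (cabs p.[expi t] / 1)) <= 6 * pi ->
  0 < l -> - (2 * pi) <= a -> a + l <= 4 * pi -> good_arc w kap a l ->
  measurable (arc_window a l) /\
  (mu (arc_window a l) <=
    (2 * (eta * (H^-1 / Psi2 (A * orlicz_inv Psi1 H^-1))) * l)%:E)%E.
Proof.
move=> w H k0 H1 KH hp l0 la hl; rewrite /good_arc => g.
have p2 := pi_ge2 R.
have kp : 0 < Psi1 (kap ^+ 2) by apply: (orlicz_gt0 o1); rewrite exprn_gt0.
have cP := @continuous_orlicz_poly Psi1 1 p o1 ler01.
have cw : continuous w by apply: continuous_excess; exact: continuous_sqrt_poly.
have wl : RI a (a + l) w <= kap / Psi1 (kap ^+ 2) * (6 * pi).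
  apply: (@le_trans _ _ (kap / Psi1 (kap ^+ 2) * RI a (a + l) (fun t => Psi1 (cabs p.[expi t] / 1)))).
    rewrite -RIZ //; apply: RI_le => //.
      by move=> t; apply: cvgM; [exact: cvg_cst|exact: cP].
    move=> t _; have := @excess_le_orlicz kap _ k0 (sqrtr_ge0 (cabs p.[expi t])).
    by rewrite sqr_sqrtr ?cabs_ge0 // divr1.
  rewrite ler_wpM2l ?divr_ge0 ?(ltW k0) ?(ltW kp) //; apply: le_trans hp.
  apply: RI_subset => //; last by rewrite lerDl ltW.
  by move=> t; rewrite divr1 (orlicz_ge0 o1) // cabs_ge0.
have lH : 2 * l <= H.
  have : kap * l <= kap * (6 * pi / Psi1 (kap ^+ 2)).
    by apply: le_trans g (le_trans wl _); rewrite mulrAC -mulrA.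
  rewrite ler_pM2l // => h.
  have -> : H = 2 * (6 * pi / Psi1 (kap ^+ 2)) by rewrite /H; field; exact: lt0r_neq0.
  by rewrite ler_pM2l.
have l2 : 0 < 2 * l by rewrite mulr_gt0.
split; first by apply: measurable_window; rewrite l2 (le_lt_trans lH).
have rl : (rho mu (2 * l) * ((2 * l)^-1)%:E <= Kmu mu H)%E.
  by apply: ereal_sup_ubound; exists (2 * l) => //=; rewrite l2.
have {rl} rl := le_trans rl KH.
rewrite lee_pdivrMr // -EFinM in rl.
rewrite [2 * _]mulrC -mulrA; apply: le_trans rl.
by apply: ereal_sup_ubound; exists (a + l / 2).
Qed.

(** The point is that [T] depends neither on [p] nor on [delta], which is what later passages to the
    limit require. *)
Lemma poly_estimate eps eta : 0 < eps -> 0 < eta -> exists T : R, 0 <= T /\ forall p delta,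
  0 < delta -> RI 0 (2 * pi) (fun t => Psi1 (cabs p.[expi t] / 1)) <= 2 * pi ->
  (\int[mu]_(q in [set q : (R * R)%type | (cabs (toC q) <= 1 - delta)%R])
    (Num.max (Psi2 (cabs p.[toC q] / eps) - T) 0)%:E <= (2 * eta)%:E)%E.
Proof.
move=> e0 eta0; have p2 := pi_ge2 R.
(* The constant 4680 is made abstract, since only its positivity matters below. *)
have [C0 [C00 weak]] : exists C0 : R, 0 < C0 /\ forall (p : {poly R[i]}) (kap delta B : R), 0 < kap -> 0 < delta -> 0 <= B ->
  let w t := Num.max (Num.sqrt (cabs p.[expi t]) - kap) 0 in
  (forall a l : R, 0 < l -> - (2 * pi) <= a -> a + l <= 4 * pi -> good_arc w kap a l ->
    measurable (arc_window a l) /\ (mu (arc_window a l) <= (B * l)%:E)%E) ->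
  (mu [set q : (R * R)%type | (cabs (toC q) <= 1 - delta)%R /\
      ((C0 * kap) ^+ 2 < cabs p.[toC q])%R] <=
    (B / kap * RI (- (2 * pi)) (4 * pi) w)%:E)%E.
  by exists 4680; split; [rewrite ltr0n|exact: weak_type].
(* Chosen so that A kap^2 / (12 pi) = (C0 (2 kap))^2 / eps, the argument of [Psi2] one level above
   kap. *)
pose A := 48 * pi * C0 ^+ 2 / eps.
have A0 : 0 < A by rewrite divr_gt0 // mulr_gt0 ?exprn_gt0 // mulr_gt0 //; lra.
have [d [d0 Kd]] := KC A0 eta0.
pose h0 := Num.min d 1; have h00 : 0 < h0 by rewrite lt_min d0 ltr01.
(* From the level [k0] on, the scale 12 pi / Psi1 (kap^2) is below both 1 and the threshold [d] of
   [K_cond]. *)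
have [k0 k01 hk0] := orlicz_superlinear o1 (12 * pi / h0 + 1).
have k00 : 0 < k0 by lra.
have P12 : 0 < 12 * pi :> R by lra.
have Hk (kap : R) : k0 <= kap -> 0 < 12 * pi / Psi1 (kap ^+ 2) < h0.
  move=> kk; have k1 : 1 <= kap by exact: le_trans kk.
  have kp : 0 < Psi1 (kap ^+ 2) by apply: (orlicz_gt0 o1); rewrite exprn_gt0 //; lra.
  rewrite divr_gt0 //= ltr_pdivrMr // -ltr_pdivrMl //.
  have kk2 : k0 <= kap ^+ 2 by apply: le_trans kk _; rewrite expr2 ler_peMr //; lra.
  apply: lt_le_trans (hk0 _ kk2); rewrite mulrC.
  have q0 : 0 < 12 * pi / h0 by rewrite divr_gt0.
  have kap2 : 1 <= kap ^+ 2 by exact: le_trans kk2.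
  by rewrite mulrDl mul1r; have := ler_peMr (ltW q0) kap2; lra.
pose T := Psi2 ((C0 * k0) ^+ 2 / eps).
exists T; split; first by apply: (orlicz_ge0 o2); rewrite divr_ge0 ?sqr_ge0 // ltW.
move=> p delta delta0 hp.
have cP := @continuous_orlicz_poly Psi1 1 p o1 ler01.
have hp3 : RI (- (2 * pi)) (4 * pi) (fun t => Psi1 (cabs p.[expi t] / 1)) <= 6 * pi.
  rewrite RI_periodic //; first lra.
  by move=> t; rewrite expi_2pi.
pose E kap := [set q : (R * R)%type | (cabs (toC q) <= 1 - delta)%R /\
      ((C0 * kap) ^+ 2 < cabs p.[toC q])%R].
have mD : measurable [set q : (R * R)%type | cabs (toC q) <= 1 - delta].
  exact: measurable_set_le (@measurable_cabs_toC R).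
have mE kap : measurable (E kap).
  rewrite (_ : E kap = [set q | cabs (toC q) <= 1 - delta] `&`
    [set q | (C0 * kap) ^+ 2 < cabs p.[toC q]]) //.
  by apply: measurableI => //; exact: measurable_set_gt (measurable_cabs_poly p).
pose w kap t := Num.max (Num.sqrt (cabs p.[expi t]) - kap) 0.
have cw kap : continuous (w kap) by apply: continuous_excess; exact: continuous_sqrt_poly.
have level (kap : R) : k0 <= kap ->
  ((Psi2 ((C0 * (2 * kap)) ^+ 2 / eps))%:E * mu (E kap) <=
    (eta / (6 * pi) * (Psi1 (kap ^+ 2) / kap * RI (- (2 * pi)) (4 * pi) (w kap)))%:E)%E.
  move=> kk; have kap0 : 0 < kap by exact: lt_le_trans kk.
  have kp : 0 < Psi1 (kap ^+ 2) by apply: (orlicz_gt0 o1); rewrite exprn_gt0.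
  set H := 12 * pi / Psi1 (kap ^+ 2); have /andP[H0 Hh] := Hk _ kk.
  rewrite -/H in H0 Hh; have Hd : 0 < H < d by rewrite H0 (lt_le_trans Hh) // ge_min lexx.
  have H1 : H < 1 by rewrite (lt_le_trans Hh) // ge_min lexx orbT.
  have HE : H^-1 = Psi1 (kap ^+ 2) / (12 * pi) by rewrite /H invf_div.
  (* Convexity: Psi1 (kap^2 / (12 pi)) <= Psi1 (kap^2) / (12 pi), which is 1 / H. *)
  have invH : kap ^+ 2 / (12 * pi) <= orlicz_inv Psi1 H^-1.
    apply: (orlicz_inv_ge o1); first by rewrite divr_ge0 ?sqr_ge0 // ltW.
    rewrite HE [_ / _]mulrC [leRHS]mulrC; apply: (orlicz_scale o1); last exact: sqr_ge0.
    by rewrite invr_ge0 (ltW P12) /= invf_le1 //; lra.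
  set D := Psi2 (A * orlicz_inv Psi1 H^-1).
  have k12 : 0 < kap ^+ 2 / (12 * pi) by rewrite divr_gt0 // exprn_gt0.
  have cD : Psi2 ((C0 * (2 * kap)) ^+ 2 / eps) <= D.
    apply: (orlicz_mono o2); first by rewrite divr_ge0 ?sqr_ge0 // ltW.
    apply: (@le_trans _ _ (A * (kap ^+ 2 / (12 * pi)))); last by rewrite ler_wpM2l // ltW.
    rewrite le_eqVlt; apply/orP; left; apply/eqP; rewrite /A; field.
    by rewrite !lt0r_neq0 //; lra.
  have D0 : 0 < D.
    by apply: (orlicz_gt0 o2); rewrite mulr_gt0 // (lt_le_trans k12).
  have Kh := Kd H Hd; rewrite -/D in Kh.
  have B0 : 0 <= 2 * (eta * (H^-1 / D)).
    by rewrite mulr_ge0 // mulr_ge0 ?(ltW eta0) // divr_ge0 ?(ltW D0) // invr_ge0 ltW.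
  have rw0 : 0 <= RI (- (2 * pi)) (4 * pi) (w kap).
    by apply: RI_ge0 => t _; rewrite le_max lexx orbT.
  have mw := weak p kap delta _ kap0 delta0 B0 _.
  have {}mw := mw (fun a l => @arc_measure_le p kap eta A a l kap0 H1 Kh hp3).
  have c0 : 0 <= Psi2 ((C0 * (2 * kap)) ^+ 2 / eps).
    by apply: (orlicz_ge0 o2); rewrite divr_ge0 ?sqr_ge0 // ltW.
  apply: le_trans (lee_wpmul2l _ mw) _; first by rewrite lee_fin.
  rewrite -EFinM lee_fin.
  rewrite (_ : eta / (6 * pi) * _ = eta / (6 * pi) * (Psi1 (kap ^+ 2) / kap) *
    RI (- (2 * pi)) (4 * pi) (w kap)); last by rewrite mulrA.
  rewrite [X in X <= _]mulrA; apply: ler_wpM2r => //.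
  (* The growth of [Psi2] cancels here: [D] bounds the height of the layer and divides the bound on
     its mass, leaving only 1 / H, a multiple of Psi1 (kap^2). *)
  apply: (@le_trans _ _ (D * (2 * (eta * (H^-1 / D)) / kap))).
    by rewrite ler_wpM2r // divr_ge0 // ltW.
  rewrite le_eqVlt; apply/orP; left; apply/eqP; rewrite HE; field.
  by rewrite !lt0r_neq0 //; lra.
pose k j := k0 * 2 ^+ j; have kk j : k0 <= k j by rewrite ler_peMr ?(ltW k00) // exprn_ege1 //; lra.
have kS j : k j.+1 = 2 * k j by rewrite /k exprS; ring.
have [Bp [Bp0 hBp]] := poly_bounded p.
(* A polynomial is bounded on the disc, so finitely many levels suffice; their number does not enter
   the final bound. *)
have [J hJ] : exists J, Bp <= (C0 * k J) ^+ 2.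
  have [J hJ] := @exp_small R 2^-1 (C0 * k0 / (Bp + 1)) ltac:(lra) ltac:(by rewrite divr_gt0 ?mulr_gt0 //; lra).
  exists J; move: hJ; rewrite exprVn ler_pdivlMr; last lra.
  rewrite ler_pdivrMl ?exprn_gt0 // => hJ.
  have -> : C0 * k J = 2 ^+ J * (C0 * k0) by rewrite /k; ring.
  have : Bp + 1 <= (Bp + 1) * (Bp + 1) by rewrite ler_peMr //; lra.
  set X := 2 ^+ J * _ in hJ *; have : (Bp + 1) * (Bp + 1) <= X * X by apply: ler_pM => //; lra.
  by rewrite expr2; lra.
pose c j := Psi2 ((C0 * k j.+1) ^+ 2 / eps).
pose b j := eta / (6 * pi) * (Psi1 (k j ^+ 2) / k j * RI (- (2 * pi)) (4 * pi) (w (k j))).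
apply: (@le_trans _ _ (\sum_(j < J) b j)%:E).
  apply: (@integral_layers_le _ _ _ _ _ J c b (fun j => E (k j))) => //.
  - by move=> j; apply: (orlicz_ge0 o2); rewrite divr_ge0 ?sqr_ge0 // ltW.
  - move=> q Dq; rewrite le_max lexx orbT /=.
    have q1 : cabs (toC q) <= 1 by rewrite (le_trans Dq) //; lra.
    have := @layer_sum R Psi2 o2 T (cabs p.[toC q]) eps (fun j => (C0 * k j) ^+ 2) J e0
      (cabs_ge0 _) (fun j => sqr_ge0 _) _ (le_trans (hBp _ q1) hJ).
    rewrite /k expr0 mulr1 -/k => /(_ (lexx _)) h; apply: le_trans h _.
    apply: ler_sum => j _; rewrite indicE.
    case: ifPn => hj; last by rewrite mulr_ge0 // (orlicz_ge0 o2) // divr_ge0 ?sqr_ge0 // ltW.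
    by rewrite mem_set ?mulr1.
  - by move=> j _; rewrite /c /b kS; exact: level.
rewrite lee_fin /b -mulr_sumr.
have c6 : 0 < 6 * pi :> R by lra.
rewrite mulrAC ler_pdivrMr //.
have -> : 2 * eta * (6 * pi) = eta * (2 * (6 * pi)) by ring.
rewrite ler_wpM2l ?(ltW eta0) //.
have cjw j : continuous (fun t => Psi1 (k j ^+ 2) / k j * w (k j) t).
  by move=> t; apply: cvgM; [exact: cvg_cst|exact: cw].
have [cS ES] := @RI_sum R (- (2 * pi)) (4 * pi) J _ cjw ltac:(lra).
rewrite (eq_bigr (fun j : 'I_J => RI (- (2 * pi)) (4 * pi) (fun t => Psi1 (k j ^+ 2) / k j * w (k j) t))).
  rewrite -ES.
  apply: (@le_trans _ _ (RI (- (2 * pi)) (4 * pi) (fun t => 2 * Psi1 (cabs p.[expi t] / 1)))).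
    apply: RI_le => //; first by move=> t; apply: cvgM; [exact: cvg_cst|exact: cP].
    move=> t _; have := @excess_sum R Psi1 o1 k0 (Num.sqrt (cabs p.[expi t])) J k00 (sqrtr_ge0 _).
    by rewrite sqr_sqrtr ?cabs_ge0 // divr1.
  by rewrite RIZ // ler_wpM2l.
by move=> j _; rewrite RIZ.
Qed.

End PolynomialEstimate.

(** * Power series and Hardy-Orlicz functions *)

Section ComplexLimits.
Variable R : realType.
Implicit Types (u v : nat -> R[i]) (l : R[i]).

Definition ccvg u l := forall e : R, 0 < e ->
  exists N : nat, forall n, (N <= n)%N -> cabs (u n - l) < e.

Lemma ccvgB u v l m : ccvg u l -> ccvg v m -> ccvg (fun n => u n - v n) (l - m).
Proof.
move=> hu hv e e0; have [N1 h1] := hu (e / 2) ltac:(lra); have [N2 h2] := hv (e / 2) ltac:(lra).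
exists (maxn N1 N2) => n; rewrite geq_max => /andP[/h1 l1 /h2 l2].
have -> : u n - v n - (l - m) = (u n - l) - (v n - m) by ring.
by apply: le_lt_trans (cabsB _ _) _; lra.
Qed.

Lemma ccvg_cst l : ccvg (fun=> l) l.
Proof. by move=> e e0; exists 0%N => n _; rewrite subrr cabs0. Qed.

Lemma ccvg_lipschitz u l (F : R[i] -> R) : (forall z w, `|F z - F w| <= cabs (z - w)) ->
  ccvg u l -> (fun n => F (u n)) @ \oo --> F l.
Proof.
move=> hF hu; apply/cvgrPdist_lt => e /hu[N hN].
exists N => // n /= Nn; apply: le_lt_trans (hF _ _) _.
by rewrite cabsC; exact: hN.
Qed.

Lemma cabs_lipschitz (z w : R[i]) : `|cabs z - cabs w| <= cabs (z - w).
Proof.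
rewrite ler_norml; have := cabsB_ge z w; have := cabsB_ge w z; rewrite (cabsC w z); lra.
Qed.

Lemma ccvg_cabs u l : ccvg u l -> (fun n => cabs (u n)) @ \oo --> cabs l.
Proof. by apply: ccvg_lipschitz => z w; exact: cabs_lipschitz. Qed.

Lemma ccvg_Re u l : ccvg u l -> (fun n => complex.Re (u n)) @ \oo --> complex.Re l.
Proof. by apply: ccvg_lipschitz => z w; rewrite -ReB Re_le_cabs. Qed.

Lemma ccvg_Im u l : ccvg u l -> (fun n => complex.Im (u n)) @ \oo --> complex.Im l.
Proof. by apply: ccvg_lipschitz => z w; rewrite -ImB Im_le_cabs. Qed.

End ComplexLimits.

Section PowerSeries.
Variable R : realType.
Implicit Types (a : nat -> R[i]) (r s B : R) (z w : R[i]) (p : {poly R[i]}) (n m : nat).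

Definition psum a n z : R[i] := \sum_(k < n) a k * z ^+ k.

Lemma psum_tail a B s r n m z : 0 <= r -> r < s -> (forall k, cabs (a k) * s ^+ k <= B) ->
  cabs z <= r -> (n <= m)%N ->
  cabs (psum a m z - psum a n z) <= B * (r / s) ^+ n / (1 - r / s).
Proof.
move=> r0 rs hB zr nm; have s0 : 0 < s by lra.
set q := r / s; have q0 : 0 <= q by rewrite divr_ge0 // ltW.
have q1 : q < 1 by rewrite ltr_pdivrMr // mul1r.
have B0 : 0 <= B by apply: le_trans (hB 0%N); rewrite mulr_ge0 ?cabs_ge0 ?exprn_ge0 // ltW.
have term k : cabs (a k * z ^+ k) <= B * q ^+ k.
  rewrite cabsM cabsX /q expr_div_n mulrA ler_pdivlMr ?exprn_gt0 // mulrAC.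
  have z0 := cabs_ge0 z; apply: ler_pM => //; rewrite ?exprn_ge0 //.
    by rewrite mulr_ge0 ?cabs_ge0 ?exprn_ge0 ?(ltW s0).
  by rewrite lerXn2r ?nnegrE.
have h j : cabs (psum a (n + j) z - psum a n z) <= B * (q ^+ n - q ^+ (n + j)) / (1 - q).
  elim: j => [|i IH]; first by rewrite addn0 !subrr cabs0 mulr0 mul0r.
  rewrite addnS /psum big_ord_recr /= -/(psum a (n + i) z) addrAC.
  apply: le_trans (cabsD _ _) _; apply: le_trans (lerD IH (term _)) _.
  rewrite le_eqVlt; apply/orP; left; apply/eqP; rewrite exprS; field.
  by rewrite lt0r_neq0 // subr_gt0.
rewrite -(subnKC nm); apply: le_trans (h _) _.
rewrite ler_wpM2r ?invr_ge0 ?subr_ge0 ?(ltW q1) //.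
by rewrite ler_wpM2l // gerBl exprn_ge0.
Qed.

Lemma le_limit_psum a B n z l : ccvg (fun m => psum a m z) l ->
  (forall m, (n <= m)%N -> cabs (psum a m z - psum a n z) <= B) -> cabs (l - psum a n z) <= B.
Proof.
move=> hl h; apply/ler_addgt0Pr => e /hl[N hN].
have := h (maxn n N) (leq_maxl _ _); have := hN (maxn n N) (leq_maxr _ _).
set S := psum a (maxn n N) z; set S0 := psum a n z => h1 h2.
have -> : l - S0 = (S - S0) - (S - l) by ring.
by apply: le_trans (cabsB _ _) _; lra.
Qed.

Lemma ccvg_term_bounded a s l : 0 <= s -> ccvg (fun n => psum a n s%:C%C) l ->
  exists B, forall k, cabs (a k) * s ^+ k <= B.
Proof.
move=> s0 /(_ 1 ltr01)[N hN].
exists (2 + \sum_(k < N) cabs (a k) * s ^+ k) => k.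
have t0 (j : nat) : 0 <= cabs (a j) * s ^+ j by rewrite mulr_ge0 ?cabs_ge0 ?exprn_ge0.
have [kN|Nk] := ltnP k N.
  rewrite (bigD1 (Ordinal kN)) //= addrCA -[leLHS]addr0 lerD2l addr_ge0 // sumr_ge0 //.
have sum0 : 0 <= \sum_(j < N) cabs (a j) * s ^+ j by apply: sumr_ge0.
have -> : cabs (a k) * s ^+ k = cabs (a k * s%:C%C ^+ k) by rewrite cabsM cabsX cabsR ger0_norm.
have -> : a k * s%:C%C ^+ k = (psum a k.+1 s%:C%C - l) - (psum a k s%:C%C - l).
  by rewrite /psum big_ord_recr /=; ring.
apply: le_trans (cabsB _ _) _; have := hN k Nk; have := hN k.+1 (leqW Nk); lra.
Qed.

Definition has_coefs a (f : R[i] -> R[i]) := forall z, cabs z < 1 -> ccvg (fun n => psum a n z) (f z).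

Lemma analytic_coefs f : analytic_disc f -> exists a, has_coefs a f.
Proof.
move=> [a ha]; exists a => z z1 e e0; have [N hN] := ha z z1 e e0.
by exists N => n Nn; rewrite cabsC; exact: hN.
Qed.

(** Convergence at the intermediate radius (1 + r) / 2 bounds the terms there, which gives a
    geometric tail of ratio r / s on the smaller disc. *)
Lemma psum_uniform a f r e : has_coefs a f -> 0 <= r < 1 -> 0 < e ->
  exists n0, forall n, (n0 <= n)%N -> forall z, cabs z <= r -> cabs (f z - psum a n z) <= e.
Proof.
move=> ha /andP[r0 r1] e0; pose s := (1 + r) / 2.
have s01 : r < s < 1 by rewrite /s; lra.
have [B hB] := @ccvg_term_bounded a s _ ltac:(lra) (ha s%:C%C ltac:(rewrite cabsR ger0_norm; lra)).
have B0 : 0 <= B by apply: le_trans (hB 0%N); rewrite mulr_ge0 ?cabs_ge0 ?exprn_ge0 //; lra.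
have q01 : 0 <= r / s < 1 by rewrite divr_ge0 /= ?ltr_pdivrMr ?mul1r; lra.
have q1 : 0 < 1 - r / s by rewrite subr_gt0; case/andP: q01.
have [n0 hn0] := @exp_small R (r / s) (e * (1 - r / s) / (B + 1)) q01
  ltac:(rewrite divr_gt0 ?mulr_gt0 //; lra).
exists n0 => n n0n z zr.
have hn : (r / s) ^+ n <= e * (1 - r / s) / (B + 1).
  apply: le_trans hn0; case/andP: q01 => q0 /ltW q1'; exact: ler_wiXn2l.
apply: (@le_limit_psum a _ n z); first by apply: ha; exact: le_lt_trans r1.
move=> m nm; apply: le_trans (@psum_tail a B s r n m z r0 _ hB zr nm) _; first by case/andP: s01.
rewrite ler_pdivrMr //; apply: (@le_trans _ _ ((B + 1) * (e * (1 - r / s) / (B + 1)))).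
  apply: ler_pM => //; first by rewrite exprn_ge0 //; case/andP: q01.
  by lra.
by rewrite mulrC divfK // lt0r_neq0 //; lra.
Qed.

Definition scaled_psum a r n : {poly R[i]} := \poly_(k < n) (a k * r%:C%C ^+ k).

Lemma scaled_psumE a r n z : (scaled_psum a r n).[z] = psum a n (r%:C%C * z).
Proof.
rewrite horner_poly; apply: eq_bigr => k _; by rewrite exprMn mulrA.
Qed.

Lemma poly_radial p : exists L, 0 <= L /\ forall z r, cabs z <= 1 -> 0 <= r <= 1 ->
  cabs (p.[r%:C%C * z] - p.[z]) <= L * (1 - r).
Proof.
elim/poly_ind: p => [|p c [L [L0 IH]]].
  by exists 0; split=> // z r _ _; rewrite !horner0 subrr cabs0 mul0r.
have [B [B0 hB]] := poly_bounded p.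
exists (L + B); split; first exact: addr_ge0.
move=> z r z1 r01; rewrite !hornerMXaddC.
have -> : p.[r%:C%C * z] * (r%:C%C * z) + c - (p.[z] * z + c) =
  (p.[r%:C%C * z] - p.[z]) * (r%:C%C * z) - p.[z] * z * (1 - r)%:C%C.
  by rewrite rmorphB rmorph1 /=; ring.
apply: le_trans (cabsB _ _) _; rewrite !cabsM !cabsR mulrDl.
have h1 := IH z r z1 r01; have h2 := hB z z1; case/andP: r01 => r0 r1.
rewrite !ger0_norm ?subr_ge0 //; apply: lerD.
  have rz : r * cabs z <= 1 by rewrite -[1]mulr1; apply: ler_pM; rewrite ?cabs_ge0.
  rewrite -[leRHS]mulr1; apply: ler_pM; rewrite ?mulr_ge0 ?cabs_ge0 //.
rewrite ler_wpM2r ?subr_ge0 // -[leRHS]mulr1; apply: ler_pM; rewrite ?cabs_ge0 //.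
Qed.

Lemma has_coefs_radial a f z e : has_coefs a f -> cabs z < 1 -> 0 < e ->
  exists2 d, 0 < d & forall r, 0 <= r <= 1 -> 1 - r < d -> cabs (f (r%:C%C * z) - f z) < e.
Proof.
move=> ha z1 e0; have [n /(_ n (leqnn n)) hn] := @psum_uniform a f (cabs z) (e / 4) ha
  ltac:(rewrite cabs_ge0 z1; done) ltac:(lra).
have [L [L0 hL]] := poly_radial (scaled_psum a 1 n).
exists (e / 4 / (L + 1)); first by rewrite !divr_gt0 //; lra.
move=> r r01 rd; have /andP[r0 r1] := r01.
have h1 := hn z (lexx _).
have rz : cabs (r%:C%C * z) <= cabs z by rewrite cabsM cabsR ger0_norm // ler_piMl ?cabs_ge0.
have h2 := hn _ rz; have h3 := hL z r (ltW z1) r01.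
rewrite !scaled_psumE rmorph1 !mul1r in h3.
have -> : f (r%:C%C * z) - f z = (f (r%:C%C * z) - psum a n (r%:C%C * z)) -
  (f z - psum a n z) + (psum a n (r%:C%C * z) - psum a n z) by ring.
apply: le_lt_trans (cabsD _ _) _; apply: le_lt_trans (lerD (cabsB _ _) (lexx _)) _.
have : L * (1 - r) <= e / 4.
  have : (L + 1) * (1 - r) <= (L + 1) * (e / 4 / (L + 1)) by rewrite ler_wpM2l ?(ltW rd) //; lra.
  rewrite [in leRHS]mulrC divfK ?lt0r_neq0 //; last lra.
  by lra.
lra.
Qed.

End PowerSeries.

(** * Polynomial approximation in Hardy-Orlicz spaces *)

Section HardyOrliczApprox.
Variables (R : realType) (Psi : R -> R).
Hypothesis oP : orlicz Psi.
Implicit Types (f : R[i] -> R[i]) (a : nat -> R[i]) (M C r e : R) (p : {poly R[i]}).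
Notation leb := (@lebesgue_measure R).

(** The strict inequality M < C avoids asking whether the infimum in the Luxemburg norm is attained:
    some admissible constant lies below [C]. *)
Lemma hnorm_integral f M C r : (hnorm Psi f <= M%:E)%E -> M < C -> 0 < C -> 0 <= r < 1 ->
  (\int[leb]_(t in `[0%R, (2 * pi)%R[) (Psi (cabs (f (r%:C%C * expi t)) / C))%:E <= (2 * pi)%:E)%E.
Proof.
move=> hM MC C0 r01.
pose fr (t : R) : R := cabs (f (r%:C%C * expi t)).
have : (luxT Psi fr < C%:E)%E.
  apply: (@le_lt_trans _ _ M%:E); last by rewrite lte_fin.
  by apply: le_trans hM; apply: ereal_sup_ubound; exists r.
move=> /ereal_inf_lt[_ [D [D0 hD] <-]]; rewrite lte_fin => DC.
have pp : 0 < 2 * pi :> R by have := pi_gt0 R; lra.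
apply: (@le_trans _ _ (\int[leb]_(t in `[0%R, (2 * pi)%R[) (Psi (cabs (f (r%:C%C * expi t)) / D))%:E)%E).
  apply: ge0_le_integral_nomeas => t _.
    by rewrite lee_fin (orlicz_ge0 oP) // divr_ge0 ?cabs_ge0 // ltW.
  rewrite lee_fin (orlicz_mono oP) ?divr_ge0 ?cabs_ge0 ?(ltW C0) //.
  by rewrite ler_wpM2l ?cabs_ge0 // lef_pV2 ?posrE // ltW.
rewrite muleC lee_pdivrMr // mul1e in hD.
exact: hD.
Qed.

(** Doubling [C] pays for the truncation error through convexity at the midpoint. The inequality is
    arranged with a continuous function [g] below Psi (|f| / C), so that measurability of [f] on
    circles is never invoked. *)
Lemma scaled_psum_mean f a M C r e n : (hnorm Psi f <= M%:E)%E -> M < C -> 0 < C ->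
  0 <= r < 1 -> 0 <= e -> Psi (e / C) <= 1 ->
  (forall z, cabs z <= r -> cabs (f z - psum a n z) <= e) ->
  RI 0 (2 * pi) (fun t => Psi (cabs (scaled_psum a r n).[expi t] / (2 * C))) <= 2 * pi.
Proof.
move=> hM MC C0 r01 e0 ePsi hn; set p := scaled_psum a r n.
have pp : 0 < 2 * pi :> R by have := pi_gt0 R; lra.
have C2 : 0 <= 2 * C by lra.
have cp := @continuous_orlicz_poly R Psi (2 * C) p oP C2.
pose g t := Num.max (2 * Psi (cabs p.[expi t] / (2 * C)) - 1) 0.
have cg : continuous g.
  apply: (@continuous_excess _ (fun t => 2 * Psi (cabs p.[expi t] / (2 * C)))).
  by move=> t; apply: cvgM; [exact: cvg_cst|exact: cp].
have gle : RI 0 (2 * pi) g <= 2 * pi.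
  rewrite -lee_fin -RI_EFin_co //; apply: le_trans (hnorm_integral hM MC C0 r01).
  apply: ge0_le_integral_nomeas => t _; first by rewrite lee_fin le_max lexx orbT.
  rewrite lee_fin ge_max; set x := cabs (f _); have x0 : 0 <= x := cabs_ge0 _.
  have xC : 0 <= x / C by rewrite divr_ge0 // ltW.
  have eC : 0 <= e / C by rewrite divr_ge0 // ltW.
  rewrite (orlicz_ge0 oP) // andbT.
  have h1 : cabs p.[expi t] / (2 * C) <= (x / C + e / C) / 2.
    have -> : (x / C + e / C) / 2 = (x + e) / (2 * C) by field; exact: lt0r_neq0.
    rewrite ler_wpM2r ?invr_ge0 // scaled_psumE -lerBlDl.
    apply: le_trans (cabsB_ge _ _) _; rewrite cabsC; apply: hn.
    by rewrite cabsM cabs_expi mulr1 cabsR ger0_norm //; case/andP: r01.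
  have h2 := orlicz_mono oP (divr_ge0 (cabs_ge0 _) C2) h1.
  by have := orlicz_mid oP xC eC; lra.
have : RI 0 (2 * pi) (fun t => 2 * Psi (cabs p.[expi t] / (2 * C)) - 1) <= RI 0 (2 * pi) g.
  apply: RI_le => //.
    move=> t; apply: cvgB; last exact: cvg_cst.
    by apply: cvgM; [exact: cvg_cst|exact: cp].
  by move=> t _; rewrite le_max lexx.
rewrite RIB; last 2 first.
- by move=> t; apply: cvgM; [exact: cvg_cst|exact: cp].
- by move=> t; exact: cvg_cst.
rewrite RIZ // RI_cst ?(ltW pp) // subr0 mul1r; lra.
Qed.

Lemma small_orlicz C : 0 < C -> exists2 e, 0 < e & Psi (e / C) <= 1.
Proof.
move=> C0; have P1 := orlicz_gt0 oP (@ltr01 R).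
exists (C / (Psi 1 + 1)); first by rewrite divr_gt0 //; lra.
rewrite mulrAC divff ?lt0r_neq0 // mul1r -[X in Psi X]mulr1.
have i1 : 0 <= (Psi 1 + 1)^-1 <= 1 by rewrite invr_ge0 invf_le1; lra.
apply: le_trans (orlicz_scale oP i1 ler01) _.
by rewrite ler_pdivrMl ?mulr1; lra.
Qed.

(** A substitute for the ball of the Hardy-Orlicz space that mentions no boundary function;
    [poly_approxB] shows its behaviour under differences. *)
Definition poly_approx C f := exists p : nat -> {poly R[i]},
  (forall n, RI 0 (2 * pi) (fun t => Psi (cabs (p n).[expi t] / C)) <= 2 * pi) /\
  (forall z, cabs z < 1 -> ccvg (fun n => (p n).[z]) (f z)).

(** Dilate by r_n = 1 - 1 / (n + 1), then truncate with error e_n: both converge, and e_n <= e0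
    preserves the bound on the mean. *)
Lemma H_poly_approx f M C : analytic_disc f -> (hnorm Psi f <= M%:E)%E -> M < C -> 0 < C ->
  poly_approx (2 * C) f.
Proof.
move=> /analytic_coefs[a ha] hM MC C0.
have [e0 e00 he0] := small_orlicz C0.
pose r (n : nat) : R := 1 - n.+1%:R^-1.
have r01 n : 0 <= r n < 1.
  rewrite /r subr_ge0 invf_le1 ?ltr0n // ler1n /= gtrBl invr_gt0 ltr0n //.
pose e (n : nat) := Num.min e0 n.+1%:R^-1.
have e_gt0 n : 0 < e n by rewrite lt_min e00 invr_gt0 ltr0n.
have [N hN] := choice (fun n => @psum_uniform R a f (r n) (e n) ha (r01 n) (e_gt0 n)).
have hN' n : forall z, cabs z <= r n -> cabs (f z - psum a (N n) z) <= e n by exact: hN.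
exists (fun n => scaled_psum a (r n) (N n)); split=> [n|z z1].
  apply: (scaled_psum_mean hM MC C0 (r01 n) (ltW (e_gt0 n)) _ (hN' n)).
  apply: le_trans he0; apply: (orlicz_mono oP); first by rewrite divr_ge0 ?ltW.
  by rewrite ler_wpM2r ?invr_ge0 ?(ltW C0) // ge_min lexx.
move=> eps eps0; have [d d0 hd] := has_coefs_radial ha z1 (divr_gt0 eps0 (ltr0n R 2)).
have m0 : 0 < Num.min d (eps / 2) by rewrite lt_min d0 divr_gt0.
have [K hK] : exists K : nat, (K.+1%:R)^-1 < Num.min d (eps / 2).
  exists (Num.truncn (Num.min d (eps / 2))^-1); rewrite invf_plt ?posrE ?ltr0n //.
  exact: truncnS_gt.
exists K => n Kn.
have nK : n.+1%:R^-1 < Num.min d (eps / 2).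
  by apply: le_lt_trans hK; rewrite lef_pV2 ?posrE ?ltr0n // ler_nat ltnS.
move: nK; rewrite lt_min => /andP[nd ne].
have rz : cabs ((r n)%:C%C * z) <= r n.
  by have /andP[r0 r1] := r01 n; rewrite cabsM cabsR ger0_norm // ler_piMr // ltW.
have h1 := hN' n _ rz.
have h2 := hd (r n) ltac:(by have /andP[-> /ltW] := r01 n) ltac:(by rewrite /r opprB addrC subrK).
rewrite scaled_psumE.
have -> : psum a (N n) ((r n)%:C%C * z) - f z =
  (f ((r n)%:C%C * z) - f z) - (f ((r n)%:C%C * z) - psum a (N n) ((r n)%:C%C * z)) by ring.
apply: le_lt_trans (cabsB _ _) _.
have he : e n < eps / 2 by apply: le_lt_trans ne; rewrite ge_min lexx orbT.
by rewrite [ltRHS]splitr ltrD // (le_lt_trans h1).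
Qed.

Lemma poly_approxB C f g : 0 < C -> poly_approx C f -> poly_approx C g ->
  poly_approx (2 * C) (fun z => f z - g z).
Proof.
move=> C0 [p [p1 p2]] [q [q1 q2]]; exists (fun n => p n - q n); split=> [n|z z1]; last first.
  move=> e e0; have [N hN] := ccvgB (p2 z z1) (q2 z z1) e0.
  by exists N => n Nn; rewrite hornerD hornerN; exact: hN.
have c0 := ltW C0; have c2 : 0 <= 2 * C by lra.
have cp := @continuous_orlicz_poly R Psi C (p n) oP c0.
have cq := @continuous_orlicz_poly R Psi C (q n) oP c0.
have cpq := @continuous_orlicz_poly R Psi (2 * C) (p n - q n) oP c2.
apply: (@le_trans _ _ (RI 0 (2 * pi) (fun t => 2^-1 *
  (Psi (cabs (p n).[expi t] / C) + Psi (cabs (q n).[expi t] / C))))).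
  apply: RI_le => //.
    by move=> t; apply: cvgM; [exact: cvg_cst|apply: cvgD; [exact: cp|exact: cq]].
  move=> t _; rewrite [leRHS]mulrC.
  have xp : 0 <= cabs (p n).[expi t] / C by rewrite divr_ge0 ?cabs_ge0.
  have xq : 0 <= cabs (q n).[expi t] / C by rewrite divr_ge0 ?cabs_ge0.
  apply: le_trans (orlicz_mid oP xp xq); apply: (orlicz_mono oP); first by rewrite divr_ge0 ?cabs_ge0.
  rewrite -mulrDl -mulrA -invfM [C * 2]mulrC ler_wpM2r ?invr_ge0 //.
  by rewrite hornerD hornerN cabsB.
rewrite RIZ; last by move=> t; apply: cvgD; [exact: cp|exact: cq].
by rewrite RID //; have := p1 n; have := q1 n; lra.
Qed.

Lemma poly_mean_abs : exists2 X, 0 < X & forall p C, 0 < C ->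
  RI 0 (2 * pi) (fun t => Psi (cabs p.[expi t] / C)) <= 2 * pi ->
  RI 0 (2 * pi) (fun t => cabs p.[expi t]) <= C * X * (2 * pi).
Proof.
have [x1 x11 hx] := orlicz_superlinear oP 1.
have pp : 0 < 2 * pi :> R by have := pi_gt0 R; lra.
exists (x1 + 1) => [|p C C0 hp]; first lra.
have cp := @continuous_orlicz_poly R Psi C p oP (ltW C0).
apply: (@le_trans _ _ (RI 0 (2 * pi) (fun t => C * (x1 + Psi (cabs p.[expi t] / C))))).
  apply: RI_le; first exact: continuous_cabs_poly.
    by move=> t; apply: cvgM; [exact: cvg_cst|apply: cvgD; [exact: cvg_cst|exact: cp]].
  move=> t _; have y0 : 0 <= cabs p.[expi t] / C by rewrite divr_ge0 ?cabs_ge0 // ltW.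
  rewrite -ler_pdivrMl // mulrC; set y := _ / C in y0 *.
  have := orlicz_ge0 oP y0; have [yx|xy] := lerP x1 y; last lra.
  by have := hx y yx; rewrite mul1r; lra.
rewrite RIZ; last by move=> t; apply: cvgD; [exact: cvg_cst|exact: cp].
rewrite RID //; last by move=> t; exact: cvg_cst.
rewrite RI_cst ?(ltW pp) // subr0 -mulrA ler_pM2l //.
by rewrite [leRHS]mulrDl mul1r lerD2l.
Qed.

End HardyOrliczApprox.

(** * Uniform bounds on Taylor coefficients *)

Section Coefficients.
Variable R : realType.
Implicit Types (p : {poly R[i]}) (c : nat -> R[i]).

(** Orthogonality of the exponentials, in real form. The factor [u] is free so that a rotation can
    make [u * c k] nonnegative in [coef_le_mean]. *)
Lemma RI_Re_coef n c k (u : R[i]) :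
  continuous (fun t : R => complex.Re (u * ((\sum_(j < n) c j * expi t ^+ j) * expi (- (k%:R * t))))) /\
  RI 0 (2 * pi) (fun t : R => complex.Re (u * ((\sum_(j < n) c j * expi t ^+ j) * expi (- (k%:R * t))))) =
  if (k < n)%N then 2 * pi * complex.Re (u * c k) else 0.
Proof.
have pp : 0 <= 2 * pi :> R by have := pi_ge0 R; lra.
elim: n => [|n [IHc IH]].
  split; first by apply: (@eq_continuous _ (fun=> 0)) => [t|t]; [rewrite big_ord0 mul0r mulr0|exact: cvg_cst].
  rewrite ltn0 -[RHS](mul0r (2 * pi - 0)) -RI_cst //.
  by apply: eq_RI => t _; rewrite big_ord0 mul0r mulr0.
have [g ug] := polar (u * c n).
pose h (t : R) := complex.Re (u * (c n * expi t ^+ n * expi (- (k%:R * t)))).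
have hE t : h t = cabs (u * c n) * cos ((n%:R - k%:R) * t + g).
  rewrite /h mulrA mulrA {1}ug expiX -!mulrA -!expiD ReM /= mul0r subr0; congr (_ * cos _); ring.
have ch : continuous h.
  apply: (@eq_continuous _ (fun t : R => cabs (u * c n) * cos ((n%:R - k%:R) * (t - 0) + g))).
    by move=> t; rewrite subr0 hE.
  by move=> t; apply: cvgM; [exact: cvg_cst|exact: continuous_cosk].
have E (t : R) : complex.Re (u * ((\sum_(j < n) c j * expi t ^+ j) * expi (- (k%:R * t)))) + h t =
   complex.Re (u * ((\sum_(j < n.+1) c j * expi t ^+ j) * expi (- (k%:R * t)))).
  by rewrite big_ord_recr /= -ReD mulrDl mulrDr.
split; first by apply: (eq_continuous E) => t; apply: cvgD; [exact: IHc|exact: ch].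
rewrite -(eq_RI (fun t _ => E t)) RID // IH.
have RIh : RI 0 (2 * pi) h = if n == k then 2 * pi * complex.Re (u * c k) else 0.
  case: eqP => [nk|/eqP nk].
    rewrite -nk {1}ug ReM /= mul0r subr0.
    transitivity (RI 0 (2 * pi) (fun=> cabs (u * c n) * cos g)).
      by apply: eq_RI => t _; rewrite hE nk subrr mul0r add0r.
    by rewrite RI_cst // subr0 mulrC.
  have z (j : nat) b : (0 < j)%N -> RI 0 (2 * pi) (fun t => cabs (u * c n) * cos (j%:R * (t - 0) + b)) = 0.
    move=> j0; rewrite RIZ; last exact: continuous_cosk.
    by have := @RI_cos R 0 0 b j j0; rewrite add0r => ->; rewrite mulr0.
  case: (ltngtP n k) nk => // nk _.
    rewrite -[RHS](@z (k - n)%N (- g)) ?subn_gt0 //; apply: eq_RI => t _.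
    rewrite hE subr0 natrB ?(ltnW nk) // -cosN; congr (_ * cos _); ring.
  rewrite -[RHS](@z (n - k)%N g) ?subn_gt0 //; apply: eq_RI => t _.
  by rewrite hE subr0 natrB ?(ltnW nk).
rewrite RIh ltnS; case: (ltngtP n k) => //; rewrite ?addr0 ?add0r //.
Qed.

Lemma coef_le_mean p k : 2 * pi * cabs p`_k <= RI 0 (2 * pi) (fun t => cabs p.[expi t]).
Proof.
have pp : 0 <= 2 * pi :> R by have := pi_ge0 R; lra.
have [kp|kp] := ltnP k (size p); last first.
  rewrite nth_default // cabs0 mulr0; apply: RI_ge0 => t _; exact: cabs_ge0.
have [g gE] := polar p`_k.
have [c] := @RI_Re_coef (size p) (fun j => p`_j) k (expi (- g)); rewrite kp => h.
have -> : cabs p`_k = complex.Re (expi (- g) * p`_k).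
  by rewrite {2}gE mulrCA -expiD addNr expi0 mulr1.
rewrite -h; apply: RI_le => //; first exact: continuous_cabs_poly.
move=> t _; rewrite -horner_coef; apply: le_trans (ler_norm _) _; apply: le_trans (Re_le_cabs _) _.
by rewrite !cabsM !cabs_expi mul1r mulr1.
Qed.

Lemma le_of_radial (x c : R) k : 0 <= x ->
  (forall r, 0 <= r < 1 -> x * r ^+ k <= c) -> x <= c.
Proof.
move=> x0 h; apply/ler_addgt0Pr => e e0.
have bern (d : R) : 0 <= d <= 1 -> 1 - k%:R * d <= (1 - d) ^+ k.
  move=> d01; elim: k {h} => [|j IH]; first by rewrite mul0r subr0.
  rewrite exprS; have d1 : 0 <= 1 - d by lra.
  have := ler_wpM2l d1 IH; rewrite -natr1.
  have d0 : 0 <= d by lra.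
  have : 0 <= j%:R * d * d by rewrite !mulr_ge0.
  lra.
pose y := x * k%:R; have y0 : 0 <= y by rewrite mulr_ge0.
pose d := Num.min 1 (e / (y + 1)).
have d0 : 0 < d by rewrite lt_min ltr01 divr_gt0 //; lra.
have d1 : d <= 1 by rewrite ge_min lexx.
have yd : y * d <= e.
  apply: (@le_trans _ _ ((y + 1) * (e / (y + 1)))).
    by apply: ler_pM; rewrite ?(ltW d0) //; [lra|rewrite ge_min lexx orbT].
  by rewrite mulrC divfK // lt0r_neq0 //; lra.
have := h (1 - d) ltac:(lra); have b := ler_wpM2l x0 (bern d ltac:(lra)).
have xE : x = x * (1 - k%:R * d) + y * d by rewrite /y; ring.
by move=> hd; rewrite [leLHS]xE; apply: lerD yd; exact: le_trans b hd.
Qed.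

(** The coefficient of the dilated partial sum is a_k r^k, bounded by its mean on the circle
    uniformly in [r]; then r tends to 1. *)
Lemma H_coef_bound (Psi : R -> R) : orlicz Psi -> exists2 X, 0 < X & forall f a M C,
  has_coefs a f -> (hnorm Psi f <= M%:E)%E -> M < C -> 0 < C ->
  forall k, cabs (a k) <= C * X.
Proof.
move=> oP; have [X X0 hX] := poly_mean_abs oP.
have pp : 0 < 2 * pi :> R by have := pi_gt0 R; lra.
exists (2 * X) => [|f a M C ha hM MC C0 k]; first lra.
apply: (@le_of_radial _ _ k); first exact: cabs_ge0.
move=> r r01; have [e e0 he] := small_orlicz oP C0.
have [n0 hn0] := @psum_uniform R a f r e ha r01 e0.
pose n := maxn n0 k.+1.
have hn := hn0 n (leq_maxl _ _).
have m := scaled_psum_mean oP hM MC C0 r01 (ltW e0) he hn.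
have := hX _ (2 * C) ltac:(lra) m.
have := coef_le_mean (scaled_psum a r n) k.
have kn : (k < n)%N by rewrite leq_max leqnn orbT.
rewrite coef_poly kn cabsM cabsX cabsR ger0_norm; last by case/andP: r01.
move=> h1 h2; have := le_trans h1 h2.
rewrite [2 * pi * _]mulrC ler_pM2r // => h; apply: le_trans h _.
by rewrite le_eqVlt; apply/orP; left; apply/eqP; ring.
Qed.

End Coefficients.

(** * Compactness of the embedding *)

Section DiscEstimates.
Variables (R : realType) (mu : {measure set (R * R)%type -> \bar R}).
Implicit Types (f : R[i] -> R[i]).

Definition odisc : set (R * R)%type := [set q | cabs (toC q) < 1].

Lemma measurable_odisc : measurable odisc.
Proof. exact: measurable_set_lt (@measurable_cabs_toC R). Qed.

Lemma measurable_cdisc : measurable (@cdisc R).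
Proof. exact: measurable_set_le (@measurable_cabs_toC R). Qed.

Lemma measurable_ucircle : measurable (@ucircle R).
Proof.
rewrite (_ : @ucircle R = [set q | cabs (toC q) <= 1] `&` [set q | 1 <= cabs (toC q)]).
  apply: measurableI; first exact: measurable_cdisc.
  exact: measurable_set_ge (@measurable_cabs_toC R).
apply/seteqP; split=> q /=; first by move=> ->; rewrite lexx.
by move=> [q1 q2]; apply/le_anti; rewrite q1 q2.
Qed.

Lemma cdiscE : @cdisc R = odisc `|` @ucircle R.
Proof.
apply/seteqP; split=> q /=.
  by rewrite /cdisc /= le_eqVlt => /predU1P[q1|q1]; [right|left].
by move=> [/ltW //|q1]; rewrite /cdisc /= q1.
Qed.

Lemma odisc_circle_disjoint : [disjoint odisc & @ucircle R].
Proof.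
apply/disj_setPLR => q; rewrite /odisc /ucircle /= => q1 q2; by rewrite q2 ltxx in q1.
Qed.

Lemma fatou_le d (T : measurableType d) (nu : {measure set T -> \bar R}) (D : set T)
    (h : nat -> T -> R) (g : T -> R) (c : \bar R) : measurable D ->
  (forall n, measurable_fun D (h n)) -> (forall n x, D x -> 0 <= h n x) ->
  (forall x, D x -> (fun n => h n x) @ \oo --> g x) ->
  (forall n, (\int[nu]_(x in D) (h n x)%:E <= c)%E) ->
  (\int[nu]_(x in D) (g x)%:E <= c)%E.
Proof.
move=> mD mh h0 hg hc.
have := @fatou _ _ _ nu D mD (fun n x => (h n x)%:E) _ _.
move=> /(_ (fun n => (measurable_EFinP _ _).2 (mh n))).
move=> /(_ (fun n x Dx => h0 n x Dx)) F.
rewrite (@eq_integral _ _ _ nu D (fun x => limn_einf (fun n => (h n x)%:E))); last first.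
  move=> x; rewrite inE => Dx.
  have hx : (fun n => (h n x)%:E) @ \oo --> (g x)%:E by apply: cvg_EFin; [exact: nearW|exact: hg].
  by have [-> _] := cvg_limn_einf_sup hx.
apply: le_trans F _; apply: le_trans (limn_einf_sup _) _.
rewrite limn_esup_lim; apply: lime_le; first exact: is_cvg_esups.
by apply: nearW => n; apply: ge_ereal_sup => _ [k _ <-]; exact: hc.
Qed.

End DiscEstimates.

Section SubsequenceExtraction.
Variable R : realType.

(* A free ultrafilter converges along every bounded coordinate at once, so no diagonal extraction is needed. *)
Lemma bounded_coords_subsequence (x : nat -> nat -> R) (B : R) :
  (forall n k, `|x n k| <= B) ->
  exists (phi : nat -> nat) (b : nat -> R),
    [/\ (forall m n, (m < n)%N -> (phi m < phi n)%N), (forall k, `|b k| <= B) &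
        (forall m k, (k <= m)%N -> `|x (phi m) k - b k| < m.+1%:R^-1)].
Proof.
move=> xB.
have [U [uU sU]] := @ultraFilterLemma nat (nbhs \oo) _.
have pU : ProperFilter U by exact: ultra_proper.
have fU : Filter U by case: pU.
have lim k : exists b : R, `|b| <= B /\ forall e, 0 < e -> U [set n | `|x n k - b| < e].
  have FA : fmap (x^~ k) U `[- B, B]%classic.
    by apply: (@filterS _ U _ setT _ _ filterT) => n _ /=; rewrite in_itv /= -ler_norml.
  have [b [bB cb]] := @segment_compact R (- B) B _ (fmap_proper_filter (x^~ k) pU) FA.
  exists b; split; first by move: bB; rewrite /= in_itv /= -ler_norml.
  move=> e e0; have [//|hC] := @in_ultra_setVsetC _ U [set n | `|x n k - b| < e] uU.
  have nb : nbhs b [set y | `|y - b| < e].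
    by apply/nbhs_ballP; exists e => //= y; rewrite /ball /= distrC.
  have [|y [/= y1 y2]] := cb [set y | e <= `|y - b|] [set y | `|y - b| < e] _ nb.
    by apply: (@filterS _ U _ _ _ _ hC) => n nn; rewrite /= leNgt; apply/negP.
  by rewrite ltNge y1 in y2.
have [b hb] := choice lim.
have big N : U [set n | (N <= n)%N] by apply: sU; exists N.
have near m j : U [set n | forall k, (k < j)%N -> `|x n k - b k| < m.+1%:R^-1].
  elim: j => [|j IH]; first by apply: (@filterS _ U _ setT _ _ filterT).
  have [_ hbj] := hb j.
  have hm : 0 < m.+1%:R^-1 :> R by rewrite invr_gt0 ltr0n.
  have FI : U (_ `&` _) := @filterI _ _ fU _ _ IH (hbj _ hm).
  apply: (@filterS _ _ fU _ _ _ FI) => n [/= h1 h2] k.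
  by rewrite ltnS leq_eqVlt => /predU1P[->//|]; exact: h1.
have pick (p : nat * nat) : exists n, (p.1 <= n)%N /\
    forall k, (k <= p.2)%N -> `|x n k - b k| < p.2.+1%:R^-1.
  have [n [/= n1 n2]] := @filter_ex _ _ pU _ (@filterI _ _ fU _ _ (big p.1) (near p.2 p.2.+1)).
  by exists n; split=> // k kp; apply: n2; rewrite ltnS.
have [g hg] := choice pick.
pose phi := fix phi m := g (if m is k.+1 then (phi k).+1 else 0%N, m).
have phiE m : phi m = g (if m is k.+1 then (phi k).+1 else 0%N, m) by case: m.
exists phi, b; split.
- have phiS m : (phi m < phi m.+1)%N by rewrite [phi m.+1]phiE; case: (hg ((phi m).+1, m.+1)).
  move=> m n; elim: n => // n IH; rewrite ltnS leq_eqVlt => /predU1P[->|/IH]; first exact: phiS.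
  by move=> h; apply: ltn_trans h (phiS n).
- by move=> k; have [] := hb k.
- by move=> m k km; rewrite phiE; case: (hg (if m is k.+1 then (phi k).+1 else 0%N, m)) => _; apply.
Qed.

End SubsequenceExtraction.

Section PowerSeriesLimits.
Variable R : realType.
Implicit Types (a b : nat -> R[i]) (B : R) (z : R[i]).

(** Real and imaginary parts are interleaved into real coordinates. The index 2 m + 1 is used so
    that the coordinates 2 k and 2 k + 1 are both under control for k <= m. *)
Lemma bounded_coefs_subsequence (a : nat -> nat -> R[i]) B :
  (forall n k, cabs (a n k) <= B) ->
  exists (phi : nat -> nat) (b : nat -> R[i]),
    [/\ (forall m n, (m < n)%N -> (phi m < phi n)%N), (forall k, cabs (b k) <= 2 * B) &
        (forall m k, (k <= m)%N -> cabs (a (phi m) k - b k) < 2 / m.+1%:R)].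
Proof.
move=> aB.
pose x n j := if odd j then complex.Im (a n j./2) else complex.Re (a n j./2).
have xB n j : `|x n j| <= B.
  rewrite /x; case: ifP => _; apply: le_trans (aB n j./2); [exact: Im_le_cabs|exact: Re_le_cabs].
have [phi [b [p1 p2 p3]]] := bounded_coords_subsequence xB.
have phi_inc m n : (m <= n)%N -> (phi m <= phi n)%N.
  by rewrite leq_eqVlt => /predU1P[->//|/p1/ltnW].
exists (fun m => phi m.*2.+1), (fun k => (b k.*2 +i* b k.*2.+1)%C); split.
- by move=> m n mn; apply: p1; rewrite ltnS ltn_double.
- move=> k; apply: le_trans (cabs_le_ReIm _) _ => /=.
  by have := p2 k.*2; have := p2 k.*2.+1; lra.
move=> m k km; apply: le_lt_trans (cabs_le_ReIm _) _; rewrite ReB ImB /=.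
have h1 := p3 m.*2.+1 k.*2 ltac:(by rewrite leqW // leq_double).
have h2 := p3 m.*2.+1 k.*2.+1 ltac:(by rewrite ltnS leq_double).
rewrite /x odd_double doubleK in h1.
rewrite /x /= odd_double uphalf_double /= in h2.
apply: lt_le_trans (ltrD h1 h2) _; rewrite -mulr2n -[leLHS]mulr_natl ler_wpM2l //.
by rewrite lef_pV2 ?posrE ?ltr0n // ler_nat !ltnS -addnn leqW // leq_addr.
Qed.

Lemma psum_ccvg_bounded b B z : (forall k, cabs (b k) <= B) -> cabs z < 1 ->
  exists l, ccvg (fun n => psum b n z) l.
Proof.
move=> bB z1; have B0 : 0 <= B by exact: le_trans (cabs_ge0 _) (bB 0%N).
have bB1 k : cabs (b k) * 1 ^+ k <= B by rewrite expr1n mulr1.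
have q1 : 0 < 1 - cabs z by rewrite subr_gt0.
have tail e : 0 < e -> exists N, forall n, (N <= n)%N -> cabs (psum b n z - psum b N z) < e.
  move=> e0; have [N hN] := @exp_small R (cabs z) (e / 2 * (1 - cabs z) / (B + 1))
    ltac:(by rewrite cabs_ge0 z1) ltac:(by rewrite divr_gt0 ?mulr_gt0 ?divr_gt0 //; lra).
  exists N => n Nn.
  have := @psum_tail R b B 1 (cabs z) N n z (cabs_ge0 _) z1 bB1 (lexx _) Nn.
  rewrite divr1 => h; apply: le_lt_trans h _; rewrite ltr_pdivrMr //.
  apply: (@le_lt_trans _ _ ((B + 1) * (e / 2 * (1 - cabs z) / (B + 1)))).
    by apply: ler_pM => //; rewrite ?exprn_ge0 ?cabs_ge0 //; lra.
  rewrite mulrC divfK ?lt0r_neq0 ?ltr_pM2r //; lra.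
have conv (F : R[i] -> R) : (forall z w, `|F z - F w| <= cabs (z - w)) ->
    exists l, forall e, 0 < e -> exists N, forall n, (N <= n)%N -> `|F (psum b n z) - l| < e.
  move=> hF; have : cvg ((fun n => F (psum b n z)) @ \oo).
    apply/cauchy_cvgP/cauchy_exP => e /tail[N hN]; exists (F (psum b N z)).
    by exists N => // n /= /hN h; rewrite /ball /= distrC; apply: le_lt_trans (hF _ _) h.
  move=> /cvg_ex[l /cvgrPdist_lt hl]; exists l => e /hl[N _ hN].
  by exists N => n Nn; rewrite distrC; exact: hN.
have [x hx] := conv (@complex.Re R) ltac:(by move=> u v; rewrite -ReB Re_le_cabs).
have [y hy] := conv (@complex.Im R) ltac:(by move=> u v; rewrite -ImB Im_le_cabs).
exists (x +i* y)%C => e e0.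
have [N1 h1] := hx (e / 2) ltac:(lra); have [N2 h2] := hy (e / 2) ltac:(lra).
exists (maxn N1 N2) => n; rewrite geq_max => /andP[/h1 l1 /h2 l2].
by apply: le_lt_trans (cabs_le_ReIm _) _; rewrite ReB ImB /=; lra.
Qed.

Lemma psum_limits_uniform (a : nat -> nat -> R[i]) b B (u : nat -> R[i] -> R[i]) g r :
  (forall m k, cabs (a m k) <= B) -> (forall k, cabs (b k) <= B) ->
  (forall m k, (k <= m)%N -> cabs (a m k - b k) < 2 / m.+1%:R) ->
  (forall m, has_coefs (a m) (u m)) -> has_coefs b g -> 0 <= r < 1 ->
  forall e, 0 < e -> exists N, forall m, (N <= m)%N ->
    forall z, cabs z <= r -> cabs (u m z - g z) <= e.
Proof.
move=> aB bB ab ua gb /andP[r0 r1] e e0.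
have B0 : 0 <= B by exact: le_trans (cabs_ge0 _) (bB 0%N).
have [n hn] := @exp_small R r (e / 3 * (1 - r) / (B + 1))
    ltac:(by rewrite r0 r1) ltac:(by rewrite divr_gt0 ?mulr_gt0 ?divr_gt0 //; lra).
have tail (c : nat -> R[i]) f z : (forall k, cabs (c k) <= B) -> has_coefs c f -> cabs z <= r ->
    cabs (f z - psum c n z) <= e / 3.
  move=> cB cf zr; apply: (@le_limit_psum R c _ n z); first by apply: cf; lra.
  move=> m nm; have c1 k : cabs (c k) * 1 ^+ k <= B by rewrite expr1n mulr1.
  have := @psum_tail R c B 1 r n m z r0 r1 c1 zr nm.
  rewrite divr1 => h; apply: le_trans h _; rewrite ler_pdivrMr; last lra.
  apply: (@le_trans _ _ ((B + 1) * (e / 3 * (1 - r) / (B + 1)))).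
    by apply: ler_pM => //; rewrite ?exprn_ge0 //; lra.
  by rewrite mulrC divfK ?lt0r_neq0 //; lra.
(* [n] makes both geometric tails at most e / 3; for [m] beyond 6 n / e, the [n] coefficient errors
   below 2 / (m + 1) also add up to at most e / 3. *)
pose N := maxn n (Num.truncn (6 * n%:R / e)).+1.
exists N => m; rewrite geq_max => /andP[nm Nm] z zr.
have ta := tail _ _ z (aB m) (ua m) zr; have tb := tail _ _ z bB gb zr.
have mid : cabs (psum (a m) n z - psum b n z) <= e / 3.
  rewrite /psum -sumrB; apply: le_trans (cabs_sum _ _ _) _.
  apply: (@le_trans _ _ (\sum_(k < n) 2 / m.+1%:R)).
    apply: ler_sum => k _; rewrite -mulrBl cabsM cabsX -[leRHS]mulr1.
    apply: ler_pM; rewrite ?cabs_ge0 ?exprn_ge0 ?cabs_ge0 //.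
      by apply/ltW/ab; exact: leq_trans (ltnW (ltn_ord k)) nm.
    by rewrite exprn_ile1 ?cabs_ge0 //; lra.
  rewrite sumr_const card_ord -[X in X <= _]mulr_natr mulrAC ler_pdivrMr ?ltr0n //.
  have h : 6 * n%:R / e < m.+1%:R.
    apply: lt_le_trans (truncnS_gt _) _; rewrite ler_nat; exact: leqW.
  move: h; rewrite ltr_pdivrMr // => h; lra.
have -> : u m z - g z = (u m z - psum (a m) n z) - (g z - psum b n z) +
  (psum (a m) n z - psum b n z) by ring.
apply: le_trans (cabsD _ _) _; apply: le_trans (lerD (cabsB _ _) (lexx _)) _; lra.
Qed.

End PowerSeriesLimits.

Lemma finite_measure_value (R : realType) d (T : measurableType d)
    (mu : {finite_measure set T -> \bar R}) (A : set T) : measurable A ->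
  exists2 m : R, 0 <= m & (mu : {measure set T -> \bar R}) A = m%:E.
Proof.
move=> mA; exists (fine (mu A)); first exact: fine_ge0.
by rewrite fineK // fin_num_measure.
Qed.

(** * Sufficiency of the condition on [Kmu] *)

Section Sufficiency.
Variables (R : realType) (mu : {finite_measure set (R * R)%type -> \bar R}) (Psi1 Psi2 : R -> R).
Hypotheses (o1 : orlicz Psi1) (o2 : orlicz Psi2).
Hypothesis KC : K_cond Psi1 Psi2 mu.
Implicit Types (f g : R[i] -> R[i]) (C eps eta T e : R).

Notation D := (@odisc R).

Definition measurable_on_disc f :=
  measurable_fun D (fun q => complex.Re (f (toC q))) /\
  measurable_fun D (fun q => complex.Im (f (toC q))).

Lemma poly_limit_measurable (p : nat -> {poly R[i]}) f :
  (forall z, cabs z < 1 -> ccvg (fun n => (p n).[z]) (f z)) -> measurable_on_disc f.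
Proof.
move=> h; split.
  apply: (@measurable_fun_cvg _ _ _ _ (fun n (q : (R * R)%type) => complex.Re (p n).[toC q])).
    by move=> n; apply: measurable_funTS; have [] := measurable_poly (p n).
  by move=> q qD; apply: ccvg_Re; exact: h.
apply: (@measurable_fun_cvg _ _ _ _ (fun n (q : (R * R)%type) => complex.Im (p n).[toC q])).
  by move=> n; apply: measurable_funTS; have [] := measurable_poly (p n).
by move=> q qD; apply: ccvg_Im; exact: h.
Qed.

Lemma measurable_on_discB f g : measurable_on_disc f -> measurable_on_disc g ->
  measurable_on_disc (fun z => f z - g z).
Proof.
move=> [f1 f2] [g1 g2]; split.
  rewrite (_ : (fun _ => _) = (fun q : (R * R)%type => complex.Re (f (toC q)) - complex.Re (g (toC q)))).
    exact: measurable_funB.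
  by apply/funext => q; rewrite ReB.
rewrite (_ : (fun _ => _) = (fun q : (R * R)%type => complex.Im (f (toC q)) - complex.Im (g (toC q)))).
  exact: measurable_funB.
by apply/funext => q; rewrite ImB.
Qed.

Definition orlicz_excess eps T (x : R) := Num.max (Psi2 (Num.max 0 (x / eps)) - T) 0.

Lemma continuous_orlicz_scaled eps : continuous (fun x : R => Psi2 (Num.max 0 (x / eps))).
Proof.
apply: (@continuous_fcomp _ (fun x : R => x / eps) (fun x => Psi2 (Num.max 0 x))).
  by move=> x; apply: cvgM; [exact: cvg_id|exact: cvg_cst].
exact: orlicz_continuous.
Qed.

Lemma continuous_excess_fun eps T : continuous (orlicz_excess eps T).
Proof. by apply: continuous_excess; exact: continuous_orlicz_scaled. Qed.

Lemma orlicz_excessE eps T x : 0 < eps -> 0 <= x ->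
  orlicz_excess eps T x = Num.max (Psi2 (x / eps) - T) 0.
Proof. by move=> e0 x0; rewrite /orlicz_excess [Num.max 0 _]max_r // divr_ge0 // ltW. Qed.

Lemma measurable_on_disc_comp f (G : R -> R) : measurable_on_disc f -> continuous G ->
  measurable_fun D (fun q => G (cabs (f (toC q)))).
Proof.
move=> [m1 m2] cG; apply: (@measurableT_comp _ _ _ _ _ _ G).
  exact: continuous_measurable_fun.
exact: measurable_cabs.
Qed.

(** Dividing the polynomials by [C] turns [eps] into [eps / C]. Cutting the n-th one off at radius 1
    - 1 / (n + 1) lets a single application of Fatou handle both the limit of the polynomials and
    the approach to the circle. *)
Lemma disc_estimate C eps eta : 0 < C -> 0 < eps -> 0 < eta -> exists T, 0 <= T /\
  forall f, poly_approx Psi1 C f ->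
  (\int[mu]_(q in D) (orlicz_excess eps T (cabs (f (toC q))))%:E <= (2 * eta)%:E)%E.
Proof.
move=> C0 e0 eta0.
have [T [T0 hT]] := @poly_estimate R mu Psi1 Psi2 o1 o2 KC (eps / C) eta (divr_gt0 e0 C0) eta0.
exists T; split=> // f [p [p1 p2]].
pose Dn (n : nat) := [set q : (R * R)%type | cabs (toC q) <= 1 - n.+1%:R^-1].
have mDn n : measurable (Dn n) by exact: measurable_set_le (@measurable_cabs_toC R).
pose F n (q : (R * R)%type) := orlicz_excess eps T (cabs (p n).[toC q]).
pose h n q := if cabs (toC q) <= 1 - n.+1%:R^-1 then F n q else 0.
have F0 n q : 0 <= F n q by rewrite le_max lexx orbT.
have mF n : measurable_fun setT (F n).
  apply: (@measurableT_comp _ _ _ _ _ _ (orlicz_excess eps T)).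
    by apply: continuous_measurable_fun; exact: continuous_excess_fun.
  exact: measurable_cabs_poly.
have hE n q : (h n q)%:E = ((fun q => (F n q)%:E) \_ (Dn n)) q.
  rewrite patchE /h; case: ifPn => qn; first by rewrite mem_set.
  by rewrite memNset //; exact/negP.
apply: (@fatou_le _ _ _ mu D h _ _ (@measurable_odisc R)).
- move=> n; apply/measurable_EFinP; rewrite (_ : _ \o _ = (fun q => (F n q)%:E) \_ (Dn n)).
    apply: measurable_funTS; apply/(measurable_restrictT _ (mDn n)).
    by apply/measurable_EFinP; exact: measurable_funTS.
  by apply/funext => q; rewrite -hE.
- by move=> n q _; rewrite /h; case: ifP.
- move=> q qD.
  have cF : (fun n => F n q) @ \oo --> orlicz_excess eps T (cabs (f (toC q))).
    apply: (@cvg_comp _ _ _ (fun n => cabs (p n).[toC q]) (orlicz_excess eps T)).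
      by apply: ccvg_cabs; exact: p2.
    exact: continuous_excess_fun.
  apply: cvg_trans cF; apply: near_eq_cvg.
  have q1 : 0 < 1 - cabs (toC q) by rewrite subr_gt0.
  exists (Num.truncn (1 - cabs (toC q))^-1) => // n /= Nn; rewrite /h ifT //.
  rewrite lerBrDr -lerBrDl invf_ple ?posrE ?ltr0n //.
  by apply/ltW/(lt_le_trans (truncnS_gt _)); rewrite ler_nat ltnS.
move=> n.
rewrite (@eq_integral _ _ _ mu D ((fun q => (F n q)%:E) \_ (Dn n))); last by move=> q _; rewrite hE.
rewrite -integral_mkcondr (_ : D `&` Dn n = Dn n); last first.
  apply/setIidPr => q; rewrite /Dn /odisc /= => h1; apply: le_lt_trans h1 _.
  by rewrite gtrBl invr_gt0 ltr0n.
have c1 : 0 < C^-1 by rewrite invr_gt0.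
have cC z : cabs ((C^-1)%:C%C *: p n).[z] = cabs (p n).[z] / C.
  by rewrite hornerZ cabsM cabsR gtr0_norm // mulrC.
have := hT ((C^-1)%:C%C *: p n) n.+1%:R^-1 ltac:(by rewrite invr_gt0 ltr0n) _.
rewrite (@eq_RI R 0 (2 * pi) _ (fun t => Psi1 (cabs (p n).[expi t] / C))); last first.
  by move=> t _; rewrite cC divr1.
move=> /(_ (p1 n)) hn; apply: le_trans hn; apply: ge0_le_integral_nomeas => q _.
  by rewrite lee_fin.
rewrite lee_fin /F orlicz_excessE ?cabs_ge0 // cC.
have -> : cabs (p n).[toC q] / C / (eps / C) = cabs (p n).[toC q] / eps.
  by field; rewrite !lt0r_neq0.
exact: lexx.
Qed.

Hypothesis circle0 : mu (@ucircle R) = 0%E.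

(** The measurable majorant equals +oo on the circle. It dominates whatever the boundary values are,
    and costs nothing on a null set. *)
Lemma integral_cdisc_le (h h' : (R * R)%type -> R) : (forall q, 0 <= h q) ->
  measurable_fun D h' -> (forall q, D q -> h q <= h' q) ->
  (\int[mu]_(q in @cdisc R) (h q)%:E <= \int[mu]_(q in D) (h' q)%:E)%E.
Proof.
move=> h0 mh' hh'; pose H q := if cabs (toC q) < 1 then (h' q)%:E else +oo%E.
have HD : {in D, (fun q => (h' q)%:E) =1 H}.
  by move=> q; rewrite inE /H => qD; rewrite ifT.
have HC : {in @ucircle R, (fun=> +oo%E) =1 H}.
  by move=> q; rewrite inE /H /ucircle /= => ->; rewrite ltxx.
have mD := @measurable_odisc R; have mC := @measurable_ucircle R.
have mHD : measurable_fun D H by apply: (eq_measurable_fun _ HD); exact/measurable_EFinP.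
have mHC : measurable_fun (@ucircle R) H by apply: (eq_measurable_fun _ HC); exact: measurable_cst.
have H0 q : (0 <= H q)%E.
  by rewrite /H; case: ifP => // qD; rewrite lee_fin (le_trans (h0 q)) // hh'.
apply: (@le_trans _ _ (\int[mu]_(q in @cdisc R) H q)%E).
  apply: ge0_le_integral_nomeas => q _; first by rewrite lee_fin.
  by rewrite /H; case: ifP => [qD|_]; [rewrite lee_fin hh'|rewrite leey].
rewrite cdiscE ge0_integral_setU //; last 2 first.
- exact/measurable_funU.
- exact: odisc_circle_disjoint.
rewrite (null_set_integral mC mHC circle0) adde0.
by rewrite (eq_integral _ _ HD).
Qed.

Lemma LPnorm_le (F : (R * R)%type -> R[i]) e : 0 < e ->
  (\int[mu]_(q in @cdisc R) (Psi2 (cabs (F q) / e))%:E <= 1)%E ->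
  (LPnorm Psi2 mu F <= e%:E)%E.
Proof. by move=> e0 h; apply: ereal_inf_lbound; exists e. Qed.

Lemma LPnorm_finite f (F : (R * R)%type -> R[i]) T : measurable_on_disc f -> 0 <= T ->
  (forall q, D q -> F q = f (toC q)) ->
  (\int[mu]_(q in D) (orlicz_excess 1 T (cabs (f (toC q))))%:E <= 2%:E)%E ->
  (LPnorm Psi2 mu F < +oo)%E.
Proof.
move=> mf T0 Ff h.
have [m m0 mE] := finite_measure_value mu (@measurable_odisc R).
(* 2 bounds the integral of the excess and T m the part below the threshold; W >= 1 allows Psi2 (x /
   W) <= Psi2 x / W. *)
pose W := 2 + T * m + 1; have W1 : 1 <= W by rewrite /W; have := mulr_ge0 T0 m0; lra.
have W0 : 0 < W by lra.
apply: (@le_lt_trans _ _ W%:E); last exact: ltry.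
apply: LPnorm_le => //.
have mex : measurable_fun D (fun q => orlicz_excess 1 T (cabs (f (toC q)))).
  by apply: measurable_on_disc_comp => //; exact: continuous_excess_fun.
apply: (@le_trans _ _ (\int[mu]_(q in D) (W^-1 * (orlicz_excess 1 T (cabs (f (toC q))) + T))%:E)%E).
  apply: integral_cdisc_le.
  - by move=> q; rewrite (orlicz_ge0 o2) // divr_ge0 ?cabs_ge0 // ltW.
  - by apply: measurable_funM => //; apply: measurable_funD.
  move=> q qD; rewrite Ff // orlicz_excessE ?cabs_ge0 // divr1 mulrC.
  have i1 : 0 <= W^-1 <= 1 by rewrite invr_ge0 (ltW W0) /= invf_le1.
  apply: le_trans (orlicz_scale o2 i1 (cabs_ge0 _)) _.
  rewrite ler_wpM2l ?invr_ge0 ?(ltW W0) // -lerBlDr le_max lexx //.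
under eq_integral do rewrite EFinM.
rewrite ge0_integralZl_EFin ?invr_ge0 ?(ltW W0) //; last 3 first.
- exact: measurable_odisc.
- by move=> q _; rewrite lee_fin addr_ge0 // le_max lexx orbT.
- by apply/measurable_EFinP; apply: measurable_funD.
rewrite muleC lee_pdivrMr // mul1e.
under eq_integral do rewrite EFinD.
rewrite ge0_integralD //; last 3 first.
- exact: measurable_odisc.
- by move=> q _; rewrite lee_fin le_max lexx orbT.
- exact/measurable_EFinP.
rewrite integral_cst; last exact: measurable_odisc.
rewrite mE -EFinM; apply: le_trans (leeD h (lexx _)) _.
by rewrite -EFinD lee_fin /W; lra.
Qed.

(** Continuity from above of a finite measure: the annuli omit the circle itself, so they decrease
    to the empty set. *)
Lemma thin_annulus eps0 : 0 < eps0 -> exists n : nat,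
  (mu [set q : (R * R)%type | (1 - n.+1%:R^-1 < cabs (toC q) < 1)%R] <= eps0%:E)%E.
Proof.
move=> e0; pose F (n : nat) := [set q : (R * R)%type | 1 - n.+1%:R^-1 < cabs (toC q) < 1].
have mF n : measurable (F n).
  rewrite (_ : F n = [set q | 1 - n.+1%:R^-1 < cabs (toC q)] `&` D).
    apply: measurableI; last exact: measurable_odisc.
    exact: measurable_set_gt (@measurable_cabs_toC R).
  by apply/seteqP; split=> q /=; rewrite /F /odisc /=; [move=> /andP[]|move=> [-> ->]].
have F0 : \bigcap_n F n = set0.
  apply/seteqP; split=> // q Fq; have /andP[_ q1] := Fq 0%N I.
  have q0 : 0 < 1 - cabs (toC q) by rewrite subr_gt0.
  have /andP[h _] := Fq (Num.truncn (1 - cabs (toC q))^-1) I.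
  move: h; rewrite ltrBlDr -ltrBlDl invf_pgt ?posrE ?ltr0n // => h.
  have := lt_trans (truncnS_gt (1 - cabs (toC q))^-1) (h).
  by rewrite ltxx.
have c : (mu \o F) @ \oo --> mu (\bigcap_n F n).
  apply: nonincreasing_cvg_mu => //.
  - by have [m _ ->] := finite_measure_value mu (mF 0%N); rewrite ltry.
  - by rewrite F0.
  move=> n m nm; apply/subsetPset => q; rewrite /F /= => /andP[h1 ->]; rewrite andbT.
  by apply: le_lt_trans h1; rewrite lerD2l lerN2 lef_pV2 ?posrE ?ltr0n // ler_nat ltnS.
rewrite F0 measure0 in c.
have /c [N _ hN] : nbhs 0%E [set x : \bar R | (x <= eps0%:E)%E].
  have : nbhs (0%R : R) [set x : R | x <= eps0].
    apply/nbhs_ballP; exists eps0 => //= x; rewrite /ball /= sub0r normrN => /ltW.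
    exact: le_trans (ler_norm _).
  by move=> h; apply: (@filterS _ (nbhs (0%R : R)) _ _ _ _ h) => x /=; rewrite lee_fin.
by exists N; apply: (hN N); exact: leqnn.
Qed.

Lemma sufficiency : compact_embedding Psi1 Psi2 mu.
Proof.
split.
  move=> f [af hf].
  have [M hM] : exists M : R, (hnorm Psi1 f <= M%:E)%E.
    by move: hf; case: (hnorm Psi1 f) => [r _|//|_]; [exists r|exists 0; rewrite leNye].
  pose C := Num.max M 0 + 1.
  have MC : M < C by apply: (@le_lt_trans _ _ (Num.max M 0)); [rewrite le_max lexx|rewrite ltrDl].
  have C0 : 0 < C by rewrite ltr_wpDl // le_max lexx orbT.
  have C20 : 0 < 2 * C by lra.
  have [T [T0 hT]] := @disc_estimate (2 * C) 1 1 C20 ltr01 ltr01.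
  have pf := H_poly_approx o1 af hM MC C0.
  have mf : measurable_on_disc f by case: pf => p [_ /poly_limit_measurable].
  apply: (@LPnorm_finite f _ T mf T0); first by move=> q qD; rewrite /fext ifT.
  by rewrite -[X in (_ <= X%:E)%E]mulr1; exact: hT.
move=> u uH [M hM].
pose C := Num.max M 0 + 1.
have MC : M < C by apply: (@le_lt_trans _ _ (Num.max M 0)); [rewrite le_max lexx|rewrite ltrDl].
have C0 : 0 < C by rewrite ltr_wpDl // le_max lexx orbT.
have C20 : 0 < 2 * C by lra.
have C40 : 0 < 2 * (2 * C) by lra.
have pu n : poly_approx Psi1 (2 * C) (u n).
  have [au _] := uH n; exact: (H_poly_approx o1 au (hM n) MC C0).
have mu_ n : measurable_on_disc (u n) by case: (pu n) => p [_ /poly_limit_measurable].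
have [a ha] := choice (fun n => analytic_coefs (proj1 (uH n))).
have [X X0 hX] := H_coef_bound o1.
pose B := C * X; have B0 : 0 < B by rewrite mulr_gt0.
have aB n k : cabs (a n k) <= B by exact: hX (ha n) (hM n) MC C0 k.
have [phi [b [phi_inc bB ab]]] := bounded_coefs_subsequence aB.
have [g hg] : exists g : R[i] -> R[i], has_coefs b g.
  have H z : exists l, cabs z < 1 -> ccvg (fun n => psum b n z) l.
    have [z1|z1] := ltP (cabs z) 1; last by exists 0.
    by have [l hl] := psum_ccvg_bounded bB z1; exists l.
  by have [g hg] := choice H; exists g => z; exact: hg.
have aB2 m k : cabs (a (phi m) k) <= 2 * B by apply: le_trans (aB _ _) _; lra.
have unif r := @psum_limits_uniform R (fun m => a (phi m)) b (2 * B) (fun m => u (phi m)) g r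
  aB2 bB ab (fun m => ha (phi m)) hg.
have ptw z : cabs z < 1 -> ccvg (fun m => u (phi m) z) (g z).
  move=> z1 e e0; have [N hN] := unif (cabs z) ltac:(by rewrite cabs_ge0 z1) (e / 2) ltac:(lra).
  by exists N => n Nn; apply: le_lt_trans (hN n Nn z (lexx _)) _; lra.
have mg : measurable_on_disc g.
  split.
    apply: (@measurable_fun_cvg _ _ _ _ (fun n (q : (R * R)%type) => complex.Re (u (phi n) (toC q)))).
      by move=> n; have [] := mu_ (phi n).
    by move=> q qD; apply: ccvg_Re; exact: ptw.
  apply: (@measurable_fun_cvg _ _ _ _ (fun n (q : (R * R)%type) => complex.Im (u (phi n) (toC q)))).
    by move=> n; have [] := mu_ (phi n).
  by move=> q qD; apply: ccvg_Im; exact: ptw.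
(* The value 0 on the null circle keeps the limit measurable on the closed disc, as
   [compact_embedding] demands. *)
pose G (q : (R * R)%type) : R[i] := if cabs (toC q) < 1 then g (toC q) else 0.
have GD q : D q -> G q = g (toC q) by move=> qD; rewrite /G ifT.
have mD := @measurable_odisc R; have mC := @measurable_ucircle R.
have mG (P : R[i] -> R) : measurable_fun D (fun q => P (g (toC q))) ->
    measurable_fun (@cdisc R) (fun q => P (G q)).
  move=> mP; rewrite cdiscE; apply/measurable_funU => //; split.
    by apply: eq_measurable_fun mP => q; rewrite inE => qD; rewrite GD.
  apply: (@eq_measurable_fun _ _ _ _ _ (fun=> P 0)) => [q|]; last exact: measurable_cst.
  by rewrite inE /ucircle /= /G => ->; rewrite ltxx.
exists phi, G; split=> //.
- by apply: (mG (@complex.Re R)); case: mg.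
- by apply: (mG (@complex.Im R)); case: mg.
- have [T [T0 hT]] := @disc_estimate (2 * C) 1 1 C20 ltr01 ltr01.
  apply: (@LPnorm_finite g _ T mg T0 GD).
  apply: (@fatou_le _ _ _ mu D (fun n q => orlicz_excess 1 T (cabs (u (phi n) (toC q)))) _ _ mD).
  + by move=> n; apply: measurable_on_disc_comp; [exact: mu_|exact: continuous_excess_fun].
  + by move=> n q _; rewrite le_max lexx orbT.
  + move=> q qD; apply: (@cvg_comp _ _ _ (fun n => cabs (u (phi n) (toC q))) (orlicz_excess 1 T)).
      by apply: ccvg_cabs; exact: ptw.
    exact: continuous_excess_fun.
  by move=> n; rewrite -[X in (_ <= X%:E)%E]mulr1; exact: hT.
move=> e e0.
(* The unit budget of the Luxemburg norm is split into 1/2 for the tail above [T], 1/4 for an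
   annulus, and 1/4 for the inner disc. [T] does not depend on the index, so the annulus, and then
   the index, can be chosen after it. *)
have [T [T0 hT]] := @disc_estimate (2 * (2 * C)) e 4^-1 C40 e0 ltac:(lra).
have diff n : (\int[mu]_(q in D) (orlicz_excess e T (cabs (u (phi n) (toC q) - g (toC q))))%:E
    <= (2 * 4^-1)%:E)%E.
  apply: (@fatou_le _ _ _ mu D
    (fun m q => orlicz_excess e T (cabs (u (phi n) (toC q) - u (phi m) (toC q)))) _ _ mD).
  + move=> m; apply: (@measurable_on_disc_comp (fun z => u (phi n) z - u (phi m) z)).
      by apply: measurable_on_discB; exact: mu_.
    exact: continuous_excess_fun.
  + by move=> m q _; rewrite le_max lexx orbT.
  + move=> q qD; apply: (@cvg_comp _ _ _
      (fun m => cabs (u (phi n) (toC q) - u (phi m) (toC q))) (orlicz_excess e T)).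
      by apply: ccvg_cabs; apply: ccvgB; [exact: ccvg_cst|exact: ptw].
    exact: continuous_excess_fun.
  move=> m; apply: (hT (fun z => u (phi n) z - u (phi m) z)).
  by apply: poly_approxB.
have [k hk] := thin_annulus (divr_gt0 (ltr01) (ltac:(lra) : 0 < 4 * (T + 1))).
have [m m0 mE] := finite_measure_value mu mD.
have P1 := orlicz_gt0 o2 (@ltr01 R).
pose s := (4 * (m + 1) * Psi2 1)^-1.
have s0 : 0 < s by rewrite invr_gt0 !mulr_gt0 //; lra.
(* Uniform distance required on the inner disc. The minimum with 1 meets the condition of
   [orlicz_scale], which gives Psi2 (d / e) <= s Psi2 1. *)
pose d := Num.min 1 s * e.
have d0 : 0 < d by rewrite mulr_gt0 // lt_min ltr01.
pose r : R := 1 - k.+1%:R^-1.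
have r01 : 0 <= r < 1.
  by rewrite /r subr_ge0 invf_le1 ?ltr0n // ler1n /= gtrBl invr_gt0 ltr0n.
have [N hN] := unif r r01 d d0.
exists N => n Nn; apply: LPnorm_le => //.
pose A := [set q : (R * R)%type | 1 - k.+1%:R^-1 < cabs (toC q) < 1].
have mA : measurable A.
  rewrite (_ : A = [set q | 1 - k.+1%:R^-1 < cabs (toC q)] `&` D).
    by apply: measurableI => //; exact: measurable_set_gt (@measurable_cabs_toC R).
  by apply/seteqP; split=> q /=; rewrite /A /odisc /=; [move=> /andP[]|move=> [-> ->]].
pose x q := cabs (u (phi n) (toC q) - g (toC q)).
pose h' q := orlicz_excess e T (x q) + (T * \1_A q + s * Psi2 1).
have mx : measurable_fun D (fun q => orlicz_excess e T (x q)).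
  apply: (@measurable_on_disc_comp (fun z => u (phi n) z - g z)).
    by apply: measurable_on_discB.
  exact: continuous_excess_fun.
have mTA : measurable_fun D (fun q => T * \1_A q + s * Psi2 1).
  by apply: measurable_funD => //; apply: measurable_funM => //; exact: measurable_funTS.
apply: (@le_trans _ _ (\int[mu]_(q in D) (h' q)%:E)%E).
  apply: integral_cdisc_le.
  - by move=> q; rewrite (orlicz_ge0 o2) // divr_ge0 ?cabs_ge0 // ltW.
  - exact: measurable_funD.
  move=> q qD; rewrite /fext ifT // GD // -/(x q) /h'.
  have xe : 0 <= orlicz_excess e T (x q) by rewrite le_max lexx orbT.
  have sP : 0 <= s * Psi2 1 by rewrite mulr_ge0 // ltW.
  have [qr|qr] := lerP (cabs (toC q)) r.
    have xd : x q <= d by exact: hN.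
    have i1 : 0 <= Num.min 1 s <= 1 by rewrite le_min ler01 (ltW s0) /= ge_min lexx.
    have : Psi2 (x q / e) <= s * Psi2 1.
      apply: (@le_trans _ _ (Psi2 (Num.min 1 s * 1))).
        apply: (orlicz_mono o2); first by rewrite divr_ge0 ?cabs_ge0 // ltW.
        by rewrite mulr1 ler_pdivrMr.
      apply: le_trans (orlicz_scale o2 i1 ler01) _.
      by rewrite ler_wpM2r ?(ltW P1) // ge_min lexx orbT.
    have : 0 <= T * \1_A q by rewrite mulr_ge0.
    lra.
  have qA : \1_A q = 1 :> R by rewrite indicE mem_set // /A /= -/r qr.
  rewrite qA mulr1; have : Psi2 (x q / e) - T <= orlicz_excess e T (x q).
    by rewrite orlicz_excessE ?cabs_ge0 // le_max lexx.
  lra.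
rewrite /h'; under eq_integral do rewrite EFinD.
rewrite ge0_integralD //; last 4 first.
- by move=> q _; rewrite lee_fin le_max lexx orbT.
- exact/measurable_EFinP.
- by move=> q _; rewrite lee_fin addr_ge0 ?mulr_ge0 // ltW.
- exact/measurable_EFinP.
under [X in (_ + X)%E]eq_integral do rewrite EFinD.
rewrite ge0_integralD //; last 3 first.
- by move=> q _; rewrite lee_fin mulr_ge0.
- by apply/measurable_EFinP; apply: measurable_funM => //; exact: measurable_funTS.
- by move=> q _; rewrite lee_fin mulr_ge0 // ltW.
rewrite integral_cst // mE -EFinM.
under [X in (_ + (X + _))%E]eq_integral do rewrite EFinM.
rewrite ge0_integralZl_EFin //; last first.
  by apply/measurable_EFinP; exact: measurable_funTS.
rewrite integral_indic //.
have AD : (mu (A `&` D) <= (1 / (4 * (T + 1)))%:E)%E.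
  by apply: le_trans hk; apply: le_measure; rewrite ?inE //; exact: measurableI.
apply: le_trans (leeD (diff n) (leeD (lee_wpmul2l _ AD) (lexx _))) _; first by rewrite lee_fin.
rewrite -EFinM -!EFinD lee_fin.
have t1 : T * (1 / (4 * (T + 1))) <= 4^-1.
  rewrite mul1r ler_pdivrMr; last lra.
  lra.
have t2 : s * Psi2 1 * m <= 4^-1.
  have -> : s * Psi2 1 * m = m / (4 * (m + 1)).
    by rewrite /s; field; rewrite !lt0r_neq0 //; lra.
  rewrite ler_pdivrMr; lra.
lra.
Qed.

End Sufficiency.

(** * Necessity *)

Section TestFunctions.
Variable R : realType.
Implicit Types (a h th s r x : R) (z w : R[i]).

Lemma sin_le_id x : 0 <= x -> sin x <= x.
Proof.
rewrite le_eqVlt => /predU1P[<-|x0]; first by rewrite sin0.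
have [t _] := @MVT R sin cos 0 x x0 (fun t _ => is_derive_sin t)
    (continuous_subspaceT (@continuous_sin R)).
by rewrite sin0 !subr0 => ->; rewrite ler_piMl ?(ltW x0) // cos_le1.
Qed.

Lemma one_sub_cos_le x : 1 - cos x <= x ^+ 2.
Proof.
rewrite -[cos x]cos_norm -[x ^+ 2]real_normK ?num_real //.
move: (normr_ge0 x); move: `|x| => y.
rewrite le_eqVlt => /predU1P[<-|y0]; first by rewrite cos0 subrr expr0n.
have [t] := @MVT R cos (fun t => - sin t) 0 y y0 (fun t _ => is_derive_cos t)
    (continuous_subspaceT (@continuous_cos R)).
rewrite in_itv /= => /andP[t0 ty]; rewrite cos0 subr0 => e.
have -> : 1 - cos y = sin t * y by rewrite -[LHS]opprB e mulNr opprK.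
rewrite expr2 ler_wpM2r ?(ltW y0) //; exact: le_trans (sin_le_id (ltW t0)) (ltW ty).
Qed.

(** With y = sqrt x, n x^n = (n y^n) y^n, and n y^n is at most a partial geometric sum. *)
Lemma linear_exp_small x e : 0 <= x < 1 -> 0 < e ->
  exists N, forall n, (N <= n)%N -> n%:R * x ^+ n < e.
Proof.
move=> /andP[x0 x1] e0; pose y := Num.sqrt x.
have y0 : 0 <= y by exact: sqrtr_ge0.
have yy : y ^+ 2 = x by rewrite sqr_sqrtr.
have y1 : y < 1 by rewrite -sqrtr1 ltr_sqrt.
have d0 : 0 < 1 - y by rewrite subr_gt0.
have ny n : n%:R * y ^+ n <= (1 - y)^-1.
  have : n%:R * y ^+ n <= \sum_(k < n) y ^+ k.
    rewrite mulr_natl -[X in _ *+ X](card_ord n) -sumr_const; apply: ler_sum => k _.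
    exact: ler_wiXn2l y0 (ltW y1) _ _ (ltnW (ltn_ord k)).
  move/le_trans; apply; rewrite -[leRHS]mul1r ler_pdivlMr // mulrC.
  have := subrX1 y n; rewrite -opprB -[y - 1]opprB mulNr => /oppr_inj <-.
  by rewrite gerBl exprn_ge0.
have [N hN] := @exp_small R y (e / 2 * (1 - y)) ltac:(by rewrite y0 y1)
  ltac:(by rewrite mulr_gt0 // divr_gt0).
exists N => n Nn; rewrite -yy -exprM mul2n -addnn exprD mulrA.
have yn : y ^+ n <= e / 2 * (1 - y) by apply: le_trans hN; exact: ler_wiXn2l y0 (ltW y1) _ _ Nn.
apply: (@le_lt_trans _ _ ((1 - y)^-1 * (e / 2 * (1 - y)))).
  by apply: ler_pM; rewrite ?mulr_ge0 ?exprn_ge0.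
by rewrite mulrCA mulVf ?lt0r_neq0 // mulr1; lra.
Qed.

Definition test_arg h th z : R[i] := (1 - h)%:C%C * expi (- th) * z.

Definition test_fun a h th z : R[i] := (a * h ^+ 2)%:C%C / (1 - test_arg h th z) ^+ 2.

Lemma test_arg_abs h th z : 0 < h < 1 -> cabs (test_arg h th z) = (1 - h) * cabs z.
Proof.
move=> h01; rewrite !cabsM cabs_expi mulr1 cabsR ger0_norm //; lra.
Qed.

Lemma test_den_ge h th z : 0 < h < 1 -> cabs z <= 1 -> h <= cabs (1 - test_arg h th z).
Proof.
move=> h01 z1; have := cabsB_ge 1 (test_arg h th z); rewrite cabs1 test_arg_abs //.
have : (1 - h) * cabs z <= (1 - h) * 1 by rewrite ler_wpM2l //; lra.
lra.
Qed.

Lemma test_abs a h th z : 0 < h < 1 -> 0 <= a -> cabs z <= 1 ->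
  cabs (test_fun a h th z) = a * (h ^+ 2 / cabs (1 - test_arg h th z) ^+ 2).
Proof.
move=> h01 a0 z1; have ah : 0 <= a * h ^+ 2 by rewrite mulr_ge0 ?sqr_ge0.
by rewrite cabsM cabsV cabsX cabsR (ger0_norm ah) mulrA.
Qed.

Lemma test_le a h th z : 0 < h < 1 -> 0 <= a -> cabs z <= 1 -> cabs (test_fun a h th z) <= a.
Proof.
move=> h01 a0 z1; rewrite test_abs // ler_piMr //.
have hd := test_den_ge th h01 z1; have h0 : 0 < h by case/andP: h01.
have d0 := lt_le_trans h0 hd.
rewrite ler_pdivrMr ?exprn_gt0 // mul1r lerXn2r ?nnegrE ?(ltW h0) ?(ltW d0) //.
Qed.

(** 6 is 4 + 2: on the window 1 - s <= 2 h and 1 - cos <= h^2, so the squared denominator is at most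
    (2 h)^2 + 2 h^2. *)
Lemma test_ge a h th (q : R * R) : 0 < h < 1 -> 0 <= a -> window th h q ->
  a / 6 <= cabs (test_fun a h th (toC q)).
Proof.
move=> h01 a0 [/andP[q1 q2] [phi [qE phih]]]; have /andP[h0 h1] := h01.
rewrite test_abs // ler_wpM2l //.
have hd := test_den_ge th h01 q2; have d0 := lt_le_trans h0 hd.
rewrite ler_pdivlMr ?exprn_gt0 //.
pose s := (1 - h) * cabs (toC q).
have -> : test_arg h th (toC q) = s%:C%C * expi (phi - th).
  rewrite /test_arg {1}qE /s rmorphM /= addrC expiD; ring.
rewrite -pdenE.
have -> : pden s (phi - th) = (1 - s) ^+ 2 + 2 * s * (1 - cos (phi - th)) by rewrite /pden; ring.
have s0 : 0 <= s by rewrite mulr_ge0 ?cabs_ge0 // subr_ge0 ltW.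
have s1 : s <= 1 by rewrite -[1]mulr1 /s; apply: ler_pM; rewrite ?cabs_ge0 //; lra.
have sh : 1 - s <= 2 * h.
  have : (1 - h) * (1 - h) <= s by rewrite /s ler_wpM2l //; lra.
  by have := sqr_ge0 h; rewrite expr2; lra.
have c1 : 1 - cos (phi - th) <= h ^+ 2.
  apply: le_trans (one_sub_cos_le _) _; rewrite -[leLHS]real_normK ?num_real //.
  by rewrite lerXn2r ?nnegrE ?(ltW h0) ?(ltW phih).
have c0 : 0 <= 1 - cos (phi - th) by rewrite subr_ge0 cos_le1.
have e1 : (1 - s) ^+ 2 <= (2 * h) ^+ 2.
  by rewrite lerXn2r ?nnegrE ?subr_ge0 // mulr_ge0 // ltW.
have e2 : s * (1 - cos (phi - th)) <= 1 * h ^+ 2 by exact: ler_pM.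
rewrite exprMn in e1; lra.
Qed.

Lemma test_lipschitz a h th z w : 0 < h < 1 -> 0 <= a -> cabs z <= 1 -> cabs w <= 1 ->
  cabs (test_fun a h th z - test_fun a h th w) <= 4 * a / h ^+ 2 * cabs (z - w).
Proof.
move=> h01 a0 z1 w1; have /andP[h0 h1] := h01.
have hz := test_den_ge th h01 z1; have hw := test_den_ge th h01 w1.
have nz : 1 - test_arg h th z != 0 by rewrite -cabs_eq0 gt_eqF // (lt_le_trans h0).
have nw : 1 - test_arg h th w != 0 by rewrite -cabs_eq0 gt_eqF // (lt_le_trans h0).
have -> : test_fun a h th z - test_fun a h th w = (a * h ^+ 2)%:C%C *
   (((test_arg h th z - test_arg h th w) * ((1 - test_arg h th z) + (1 - test_arg h th w))) /
   ((1 - test_arg h th z) ^+ 2 * (1 - test_arg h th w) ^+ 2)).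
  by rewrite /test_fun; field; rewrite nz nw.
have -> : test_arg h th z - test_arg h th w = test_arg h th (z - w) by rewrite /test_arg mulrBr.
set dz := 1 - test_arg h th z in hz nz *; set dw := 1 - test_arg h th w in hw nw *.
set ta := test_arg h th (z - w).
have taE : cabs ta = (1 - h) * cabs (z - w) by exact: test_arg_abs.
clearbody ta.
have ah : 0 <= a * h ^+ 2 by rewrite mulr_ge0 ?sqr_ge0.
rewrite !cabsM cabsV cabsM !cabsX cabsR (ger0_norm ah) taE.
have d2 z' : cabs z' <= 1 -> cabs (1 - test_arg h th z') <= 2.
  move=> z'1; apply: le_trans (cabsB _ _) _; rewrite cabs1 test_arg_abs //.
  have : (1 - h) * cabs z' <= 1 * 1 by apply: ler_pM; rewrite ?cabs_ge0 //; lra.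
  lra.
have sum4 : cabs (dz + dw) <= 4.
  by apply: le_trans (cabsD _ _) _; have := d2 z z1; have := d2 w w1; rewrite -/dz -/dw; lra.
have h4 : h ^+ 2 * h ^+ 2 <= cabs dz ^+ 2 * cabs dw ^+ 2.
  by apply: ler_pM; rewrite ?sqr_ge0 // lerXn2r ?nnegrE ?cabs_ge0 ?(ltW h0).
have h40 : 0 < h ^+ 2 * h ^+ 2 by rewrite mulr_gt0 ?exprn_gt0.
have num : (1 - h) * cabs (z - w) * cabs (dz + dw) <= cabs (z - w) * 4.
  apply: ler_pM; rewrite ?mulr_ge0 ?cabs_ge0 ?subr_ge0 ?(ltW h1) //.
  by rewrite ler_piMl ?cabs_ge0 // gerBl ltW.
apply: (@le_trans _ _ (a * h ^+ 2 * (cabs (z - w) * 4 / (h ^+ 2 * h ^+ 2)))); last first.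
  rewrite le_eqVlt; apply/orP; left; apply/eqP; field; exact: lt0r_neq0.
apply: (ler_wpM2l ah); apply: ler_pM => //.
- by rewrite !mulr_ge0 ?cabs_ge0 ?subr_ge0 ?(ltW h1).
- by rewrite invr_ge0 mulr_ge0 ?sqr_ge0.
by rewrite lef_pV2 ?posrE // (lt_le_trans h40).
Qed.

(** The derivative of the geometric series, with its partial sums in closed form; the remainder has
    order n (1 - h)^n. *)
Lemma test_analytic a h th : 0 < h < 1 -> 0 <= a -> analytic_disc (test_fun a h th).
Proof.
move=> h01 a0; have /andP[h0 h1] := h01.
exists (fun k => (a * h ^+ 2)%:C%C * (k.+1%:R * ((1 - h)%:C%C * expi (- th)) ^+ k)).
move=> z z1 e e0; have z1' := ltW z1.
have hz := test_den_ge th h01 z1'; set w := test_arg h th z in hz.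
have d0 := lt_le_trans h0 hz.
have nz : 1 - w != 0 by rewrite -cabs_eq0 gt_eqF.
have S n : \sum_(k < n) (a * h ^+ 2)%:C%C * (k.+1%:R * ((1 - h)%:C%C * expi (- th)) ^+ k) * z ^+ k
   = (a * h ^+ 2)%:C%C * ((1 - (n.+1%:R * w ^+ n - n%:R * w ^+ n.+1)) / (1 - w) ^+ 2).
  elim: n => [|n IH].
    by rewrite big_ord0 mul0r subr0 mul1r expr0 subrr mul0r mulr0.
  rewrite big_ord_recr /= IH -!mulrA -exprMn -/(test_arg h th z) -/w -mulrDr; congr (_ * _).
  by rewrite !exprS -[n.+2%:R]natr1 -[n.+1%:R]natr1; field.
have [N hN] := @linear_exp_small (1 - h) (e / (3 * (a + 1))) ltac:(lra) ltac:(rewrite divr_gt0 //; lra).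
exists N.+1 => n Nn; rewrite S /test_fun -/w -mulrBr.
have -> : ((1 - w) ^+ 2)^-1 - (1 - (n.+1%:R * w ^+ n - n%:R * w ^+ n.+1)) / (1 - w) ^+ 2 =
  (n.+1%:R * w ^+ n - n%:R * w ^+ n.+1) / (1 - w) ^+ 2 by field.
have cn (k : nat) : cabs (k%:R : R[i]) = k%:R.
  by rewrite -(rmorph_nat (real_complex R)) /= cabsR ger0_norm.
have wz : cabs w <= 1 - h.
  by rewrite test_arg_abs // ler_piMr //; lra.
have w0 := cabs_ge0 w.
have num : cabs (n.+1%:R * w ^+ n - n%:R * w ^+ n.+1) <= 3 * (n%:R * (1 - h) ^+ n).
  apply: le_trans (cabsB _ _) _; rewrite !cabsM !cn !cabsX.
  have p0 : 0 <= (1 - h) ^+ n by rewrite exprn_ge0 //; lra.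
  have wn : cabs w ^+ n <= (1 - h) ^+ n by rewrite lerXn2r ?nnegrE //; lra.
  have t1 : n.+1%:R * cabs w ^+ n <= n.+1%:R * (1 - h) ^+ n by rewrite ler_wpM2l.
  have t2 : n%:R * cabs w ^+ n.+1 <= n%:R * (1 - h) ^+ n.
    by rewrite ler_wpM2l // exprS; apply: le_trans wn; rewrite ler_piMl ?exprn_ge0 //; lra.
  have n1 : 1 <= n%:R :> R by rewrite ler1n (leq_trans _ Nn).
  have t3 : (1 - h) ^+ n <= n%:R * (1 - h) ^+ n by rewrite ler_peMl.
  move: t1; rewrite -natr1 mulrDl mul1r [(_ + 1) * _]mulrDl mul1r; lra.
have ah : 0 <= a * h ^+ 2 by rewrite mulr_ge0 ?sqr_ge0.
rewrite cabsM cabsR (ger0_norm ah) cabsM cabsV cabsX.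
have q1 : h ^+ 2 * (cabs (1 - w) ^+ 2)^-1 <= 1.
  rewrite ler_pdivrMr ?exprn_gt0 // mul1r lerXn2r ?nnegrE ?(ltW h0) ?(ltW d0) //.
have -> : a * h ^+ 2 * (cabs (n.+1%:R * w ^+ n - n%:R * w ^+ n.+1) / cabs (1 - w) ^+ 2) =
  a * cabs (n.+1%:R * w ^+ n - n%:R * w ^+ n.+1) * (h ^+ 2 * (cabs (1 - w) ^+ 2)^-1) by ring.
apply: (@le_lt_trans _ _ (a * (3 * (n%:R * (1 - h) ^+ n)) * 1)).
  apply: ler_pM => //; rewrite ?mulr_ge0 ?cabs_ge0 ?invr_ge0 ?sqr_ge0 ?(ltW h0) //.
  by rewrite ler_wpM2l.
have := hN n (ltnW Nn); rewrite ltr_pdivlMr; last lra.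
have : 0 <= n%:R * (1 - h) ^+ n by rewrite mulr_ge0 // exprn_ge0 //; lra.
set X := n%:R * _ => X0 hX; rewrite mulr1.
have : a * (3 * X) <= X * (3 * (a + 1)) by rewrite mulrDr mulr1; lra.
lra.
Qed.

Lemma test_hnorm (Psi : R -> R) h th : orlicz Psi -> 0 < h < 1 ->
  (hnorm Psi (test_fun (orlicz_inv Psi h^-1) h th) <= 1%:E)%E.
Proof.
move=> oP h01; have /andP[h0 h1] := h01.
have hi : 0 <= h^-1 by rewrite invr_ge0 ltW.
have [a0 aE] := orlicz_invP oP hi; set a := orlicz_inv Psi h^-1 in a0 aE *.
have pp : 0 < 2 * pi :> R by have := pi_gt0 R; lra.
apply: ge_ereal_sup => _ /= [s /andP[s0 s1] <-].
apply: ereal_inf_lbound; exists 1 => //; split=> //.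
rewrite muleC lee_pdivrMr // mul1e.
pose r := (1 - h) * s.
have r01 : 0 <= r < 1.
  rewrite mulr_ge0 ?subr_ge0 ?(ltW h1) //=; have := ler_wpM2l (ltac:(lra) : 0 <= 1 - h) (ltW s1).
  by rewrite /r mulr1; lra.
have rh : r <= 1 - h by rewrite /r ler_piMr ?(ltW s1) // subr_ge0 ltW.
have hr : h <= 1 - r ^+ 2.
  have : r ^+ 2 <= r * 1 by rewrite expr2 ler_wpM2l //; case/andP: r01 => // _ /ltW.
  lra.
have hr0 : 0 < 1 - r ^+ 2 by lra.
(* Psi (c a) <= c Psi a = c / h with c = h^2 / [pden] gives h / [pden], which is [k] times the
   Poisson kernel; [hr] shows k <= 1. *)
pose k := h / (1 - r ^+ 2).
have k1 : k <= 1 by rewrite ler_pdivrMr // mul1r.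
have k0 : 0 <= k by exact: divr_ge0 (ltW h0) (ltW hr0).
have cP := @continuous_poisson R r th r01.
have cm : continuous (fun t => k * poisson r (t - th)).
  by move=> t; apply: cvgM; [exact: cvg_cst|exact: cP].
apply: (@le_trans _ _ (\int[@lebesgue_measure R]_(t in `[0%R, (2 * pi)%R[)
   (k * poisson r (t - th))%:E)%E).
  apply: ge0_le_integral_nomeas => t _.
    by rewrite lee_fin (orlicz_ge0 oP) // divr1 cabs_ge0.
  rewrite lee_fin divr1.
  have z1 : cabs (s%:C%C * expi t) <= 1 by rewrite cabsM cabs_expi mulr1 cabsR ger0_norm // ltW.
  rewrite test_abs // [a * _]mulrC.
  have wE : test_arg h th (s%:C%C * expi t) = r%:C%C * expi (t - th).
    by rewrite /test_arg /r rmorphM /= addrC expiD; ring.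
  rewrite wE -pdenE.
  have hd := test_den_ge th h01 z1; rewrite wE in hd.
  have pd := pden_gt0 (t - th) r01.
  have u01 : 0 <= h ^+ 2 / pden r (t - th) <= 1.
    rewrite divr_ge0 ?sqr_ge0 ?(ltW pd) //= ler_pdivrMr // mul1r pdenE.
    by rewrite lerXn2r ?nnegrE ?cabs_ge0 // ltW.
  apply: le_trans (orlicz_scale oP u01 a0) _; rewrite aE /k /poisson.
  rewrite le_eqVlt; apply/orP; left; apply/eqP; field.
  by rewrite !lt0r_neq0.
rewrite RI_EFin_co // lee_fin RIZ //.
have := @poisson_mass R r 0 th r01; rewrite add0r => ->.
by rewrite ler_piMl // ltW.
Qed.

Lemma radlim_unique (f : R[i] -> R[i]) xi l l' : radlim f xi l -> radlim f xi l' -> l = l'.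
Proof.
move=> hl hl'; apply/eqP; rewrite -subr_eq0 -cabs_eq0 eq_le cabs_ge0 andbT.
apply/ler_addgt0Pr => e e0; rewrite add0r.
have [d [d0 hd]] := hl (e / 2) ltac:(lra); have [d' [d'0 hd']] := hl' (e / 2) ltac:(lra).
pose r := 1 - Num.min d d' / 2.
have m0 : 0 < Num.min d d' by rewrite lt_min d0 d'0.
have md : Num.min d d' <= d by rewrite ge_min lexx.
have md' : Num.min d d' <= d' by rewrite ge_min lexx orbT.
have h1 := hd r ltac:(rewrite /r; lra); have h2 := hd' r ltac:(rewrite /r; lra).
have -> : l - l' = (f (r%:C%C * xi) - l') - (f (r%:C%C * xi) - l) by ring.
by apply: le_trans (cabsB _ _) _; lra.
Qed.

(** On the circle [fext] takes a radial limit chosen by [xget]; the Lipschitz bound provides one,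
    and its uniqueness determines the choice. *)
Lemma fext_test a h th (q : R * R) : 0 < h < 1 -> 0 <= a -> @cdisc R q ->
  fext (test_fun a h th) q = test_fun a h th (toC q).
Proof.
move=> h01 a0; rewrite /cdisc /= => q1; rewrite /fext; case: ltP => // q2.
have {q1 q2} q1 : cabs (toC q) = 1 by apply/le_anti; rewrite q1 q2.
have lim : radlim (test_fun a h th) (toC q) (test_fun a h th (toC q)).
  move=> e e0; pose L := 4 * a / h ^+ 2.
  have L0 : 0 <= L by exact: divr_ge0 (mulr_ge0 _ a0) (sqr_ge0 _).
  exists (Num.min 1 (e / (L + 1))); split; first by rewrite lt_min ltr01 divr_gt0 //; lra.
  move=> r /andP[r0 r1].
  have r0' : 0 <= r.
    have : Num.min 1 (e / (L + 1)) <= 1 by rewrite ge_min lexx.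
    lra.
  have re : 1 - r < e / (L + 1).
    have : Num.min 1 (e / (L + 1)) <= e / (L + 1) by rewrite ge_min lexx orbT.
    lra.
  apply: le_lt_trans (test_lipschitz _ h01 a0 _ _) _; last 1 first.
  - have -> : r%:C%C * toC q - toC q = - ((1 - r)%:C%C * toC q).
      by rewrite rmorphB rmorph1 /=; ring.
    rewrite cabsN cabsM q1 mulr1 cabsR ger0_norm; last by rewrite subr_ge0 ltW.
    rewrite ltr_pdivlMr in re; last lra.
    by rewrite -/L mulrC; have : 0 < 1 - r; [rewrite subr_gt0|lra].
  - by rewrite cabsM q1 mulr1 cabsR ger0_norm // ltW.
  - by rewrite q1.
apply: xget_subset1 => // l l' hl hl'; exact: radlim_unique hl hl'.
Qed.

End TestFunctions.

Section Necessity.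
Variables (R : realType) (mu : {finite_measure set (R * R)%type -> \bar R}) (Psi1 Psi2 : R -> R).
Hypotheses (o1 : orlicz Psi1) (o2 : orlicz Psi2).

(** The factor 2 makes the inequality strict: a norm at most [e] gives an admissible constant below
    2 e, though perhaps not [e] itself. *)
Lemma LPnorm_chebyshev (F : R * R -> R[i]) (B : set (R * R)) (e c : R) :
  0 < e -> 0 <= c -> (LPnorm Psi2 mu F <= e%:E)%E -> measurable B -> B `<=` @cdisc R ->
  (forall q, B q -> 2 * e * c <= cabs (F q)) -> ((Psi2 c)%:E * mu B <= 1)%E.
Proof.
move=> e0 c0 Fe mB BD hB.
have : (LPnorm Psi2 mu F < (2 * e)%:E)%E by apply: le_lt_trans Fe _; rewrite lte_fin; lra.
move=> /ereal_inf_lt [_ /= [C [C0 hC] <-]]; rewrite lte_fin => Ce.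
apply: le_trans hC; apply: markov_nomeas => //.
- exact: measurable_cdisc.
- exact: orlicz_ge0.
- by move=> q _; rewrite lee_fin (orlicz_ge0 o2) // divr_ge0 ?cabs_ge0 // ltW.
move=> q Bq; rewrite lee_fin; apply: orlicz_mono => //; rewrite ler_pdivlMr //.
by apply: le_trans (hB q Bq); rewrite mulrC ler_wpM2r // ltW.
Qed.

Lemma necessity : compact_embedding Psi1 Psi2 mu -> rho_cond Psi1 Psi2 mu.
Proof.
move=> [_ cpt] A A0 eps eps0; apply: contrapT => N.
have ex n : exists ht : R * R, [/\ 0 < ht.1 < 1, ht.1 < n.+1%:R^-1 &
    ((eps * (1 / Psi2 (A * orlicz_inv Psi1 ht.1^-1)))%:E < mu (window ht.2 ht.1))%E].
  apply: contrapT => H; apply: N; exists n.+1%:R^-1; split; first by rewrite invr_gt0.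
  move=> h /andP[h0 h1]; apply: ge_ereal_sup => _ [th _ <-]; rewrite leNgt; apply/negP => lt.
  apply: H; exists (h, th); split=> //=; rewrite h0 (lt_le_trans h1) //.
  by rewrite invf_le1 ?ltr0n // ler1n.
have [ht hht] := choice ex; pose h n := (ht n).1; pose a n := orlicz_inv Psi1 (h n)^-1.
have h01 n : 0 < h n < 1 by have [] := hht n.
have h0 n : 0 < h n by case/andP: (h01 n).
have a0 n : 0 < a n by apply: orlicz_inv_gt0 => //; rewrite invr_gt0.
pose u n := test_fun (a n) (h n) (ht n).2.
have hu n : (hnorm Psi1 (u n) <= 1%:E)%E by exact: test_hnorm.
have uH n : in_H Psi1 (u n).
  by split; [exact: test_analytic (ltW (a0 n))|exact: le_lt_trans (hu n) (ltry _)].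
have [phi [g [phi_mono mR mI _ cv]]] := cpt u uH (ex_intro _ 1 hu).
have phi_ge n : (n <= phi n)%N.
  by elim: n => // n IH; apply: leq_ltn_trans IH (phi_mono _ _ (ltnSn n)).
(* Makes K eps > 2. The two halves of the window have total mass at most 2 / Psi2 (K A b), hence at
   most 2 / (K Psi2 (A b)), against the lower bound eps / Psi2 (A b). *)
pose K := 2 / eps + 1.
have K1 : 1 <= K by rewrite lerDr divr_ge0 // ltW.
have Keps : K * eps = 2 + eps by rewrite mulrDl divfK ?lt0r_neq0 // mul1r.
pose e := (48 * (K * A))^-1.
have KA0 : 0 < K * A by rewrite mulr_gt0 // (lt_le_trans ltr01).
have e0 : 0 < e by rewrite invr_gt0 mulr_gt0.
have eE b : 2 * e * (K * (A * b)) = b / 24.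
  by rewrite /e; field; rewrite !lt0r_neq0 // (lt_le_trans ltr01).
have [n0 hn0] := cv e e0; pose M0 := a (phi n0).
(* The earlier peak has fixed height [M0], while h n < 1 / (n + 1) forces the heights [a n] to
   infinity. *)
have [m n0m am] : exists2 m, (n0 <= m)%N & 24 * M0 <= a (phi m).
  pose Y := Psi1 (24 * M0); have M00 : 0 <= 24 * M0 by apply: mulr_ge0 => //; exact: ltW (a0 _).
  have := Num.Theory.truncnS_gt Y; set n1 := Num.truncn Y => Yn1.
  exists (maxn n0 n1); first exact: leq_maxl.
  apply: orlicz_inv_ge => //; have [_ hm _] := hht (phi (maxn n0 n1)).
  have hm' : (phi (maxn n0 n1)).+1%:R < (h (phi (maxn n0 n1)))^-1.
    by rewrite -[ltLHS]invrK ltf_pV2 ?posrE ?invr_gt0.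
  apply: le_trans (ltW Yn1) (le_trans _ (ltW hm')).
  by rewrite ler_nat ltnS (leq_trans (leq_maxr n0 n1)).
pose b := a (phi m); rewrite -/b in am; have b0 : 0 < b by exact: a0.
pose W := window (ht (phi m)).2 (h (phi m)).
have mW : measurable W by exact: measurable_window.
have WD : W `<=` @cdisc R by move=> q [/andP[_ ?] _].
have mg := measurable_cabs mR mI.
(* Split at |g| = b / 12. Below it, the late peak, at least b / 6 on the window, is far from [g];
   above it, the early peak, at most b / 24, is. *)
have mB1 := mg (@measurable_cdisc R) _ (measurable_itv `]-oo, (b / 12)]).
have mB2 := mg (@measurable_cdisc R) _ (measurable_itv `](b / 12), +oo[).
set G1 := (X in measurable X) in mB1; set G2 := (X in measurable X) in mB2.
have WE : W = (W `&` G1) `|` (W `&` G2).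
  apply/seteqP; split=> q /=; last by case=> -[].
  move=> Wq; have Dq := WD q Wq; have [g1|g1] := lerP (cabs (g q)) (b / 12).
    by left; split=> //; split=> //=; rewrite in_itv.
  by right; split=> //; split=> //=; rewrite in_itv /= andbT.
have bound B n : (n0 <= n)%N -> measurable B -> B `<=` @cdisc R ->
    (forall q, B q -> b / 24 <= cabs (fext (u (phi n)) q - g q)) ->
    ((Psi2 (K * (A * b)))%:E * mu B <= 1)%E.
  move=> n0n mB BD hB; apply: (LPnorm_chebyshev e0 _ (hn0 n n0n) mB BD).
    by rewrite mulrA ltW // mulr_gt0.
  by move=> q Bq; rewrite eE; exact: hB.
have B1 : ((Psi2 (K * (A * b)))%:E * mu (W `&` G1) <= 1)%E.
  apply: (bound _ m) => //; first exact: measurableI.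
    by move=> q [/WD].
  move=> q [Wq [Dq]]; rewrite /= in_itv /= => gq.
  have fE : fext (u (phi m)) q = u (phi m) (toC q) by exact: fext_test (h01 _) (ltW (a0 _)) Dq.
  have fq : b / 6 <= cabs (u (phi m) (toC q)) by exact: test_ge (h01 _) (ltW (a0 _)) Wq.
  rewrite fE; have := cabsB_ge (u (phi m) (toC q)) (g q); lra.
have B2 : ((Psi2 (K * (A * b)))%:E * mu (W `&` G2) <= 1)%E.
  apply: (bound _ n0) => //; first exact: measurableI.
    by move=> q [/WD].
  move=> q [Wq [Dq]]; rewrite /= in_itv /= andbT => gq.
  have fE : fext (u (phi n0)) q = u (phi n0) (toC q) by exact: fext_test (h01 _) (ltW (a0 _)) Dq.
  have fq : cabs (u (phi n0) (toC q)) <= M0 by exact: test_le (h01 _) (ltW (a0 _)) Dq.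
  rewrite fE cabsC; have := cabsB_ge (g q) (u (phi n0) (toC q)); lra.
have [w _ wE] := finite_measure_value mu mW.
have [w1 _ w1E] := finite_measure_value mu (measurableI _ _ mW mB1).
have [w2 _ w2E] := finite_measure_value mu (measurableI _ _ mW mB2).
have ww : w <= w1 + w2.
  rewrite -lee_fin EFinD -wE -w1E -w2E [X in (mu X <= _)%E]WE.
  by apply: measureU2; exact: measurableI.
have [_ _] := hht (phi m); rewrite -/W -/(h _) -/b [X in (_ < X)%E]wE lte_fin.
rewrite w1E lee_fin in B1; rewrite w2E lee_fin in B2.
set p := Psi2 (A * b); set P := Psi2 _ in B1 B2.
have p0 : 0 < p by apply: orlicz_gt0 => //; exact: mulr_gt0.
have Pp : K * p <= P by apply: orlicz_scale_ge => //; rewrite ltW // mulr_gt0.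
rewrite mul1r ltr_pdivrMr // => epw.
have w0 : 0 < w by rewrite -(pmulr_lgt0 w p0) // (lt_trans eps0).
have K0 : 0 < K by exact: lt_le_trans K1.
have s1 : K * eps < K * (w * p) by rewrite ltr_pM2l.
have s2 : w * (K * p) <= w * P by rewrite ler_wpM2l // ltW.
have s3 : P * w <= P * (w1 + w2) by rewrite ler_wpM2l // (le_trans _ Pp) // mulr_ge0 // ltW.
rewrite mulrDr in s3; clear -Keps s1 s2 s3 B1 B2 eps0; lra.
Qed.

End Necessity.

(** * The condition nabla0 *)

Section CarlesonFunctions.
Variables (R : realType) (mu : {finite_measure set (R * R)%type -> \bar R}) (Psi : R -> R).
Hypothesis oP : orlicz Psi.

Lemma K_cond_rho (Psi1 Psi2 : R -> R) : K_cond Psi1 Psi2 mu -> rho_cond Psi1 Psi2 mu.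
Proof.
move=> KC A A0 eps eps0; have [d [d0 hd]] := KC A A0 eps eps0.
exists d; split=> // h hh; have /andP[h0 _] := hh.
have : (rho mu h * (h^-1)%:E <= Kmu mu h)%E.
  by apply: ereal_sup_ubound; exists h => //=; rewrite h0 lexx.
move=> /le_trans/(_ (hd h hh)); rewrite lee_pdivrMr //.
have E P : eps * (h^-1 / P) * h = eps * (1 / P).
  by rewrite -mulrA mulrAC mulVf ?lt0r_neq0.
by rewrite -EFinM E.
Qed.

(** The ratios telescope. The n-th step applies the condition at 2^n x and (2 C)^n y, whose order
    persists because 2 <= 2 C. *)
Lemma nabla0_iter (x0 C : R) : 0 < x0 -> 1 <= C ->
  (forall x y : R, x0 <= x -> x <= y -> Psi (2 * x) / Psi x <= Psi (2 * C * y) / Psi y) ->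
  forall (n : nat) (x y : R), x0 <= x -> x <= y ->
    Psi (2 ^+ n * x) / Psi x <= Psi ((2 * C) ^+ n * y) / Psi y.
Proof.
move=> x00 C1 H n x y x0x xy; have x_gt0 : 0 < x by lra.
have y_gt0 : 0 < y by lra.
have Px := orlicz_gt0 oP x_gt0; have Py := orlicz_gt0 oP y_gt0.
elim: n => [|n IH]; first by rewrite !expr0 !mul1r !divff ?lt0r_neq0.
have C2 : 2 <= 2 * C by lra.
have u1 : 0 < 2 ^+ n * x by rewrite mulr_gt0 ?exprn_gt0.
have v1 : 0 < (2 * C) ^+ n * y by rewrite mulr_gt0 ?exprn_gt0 //; lra.
have uv : 2 ^+ n * x <= (2 * C) ^+ n * y.
  apply: ler_pM; rewrite ?exprn_ge0 ?(ltW x_gt0) //.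
  by rewrite lerXn2r ?nnegrE //; lra.
have xu : x0 <= 2 ^+ n * x.
  by apply: le_trans x0x _; rewrite ler_peMl ?(ltW x_gt0) // exprn_ege1 //; lra.
have Pu := orlicz_gt0 oP u1; have Pv := orlicz_gt0 oP v1.
have := H _ _ xu uv; rewrite !mulrA -!exprS => H1.
have -> : Psi (2 ^+ n.+1 * x) / Psi x =
  (Psi (2 ^+ n.+1 * x) / Psi (2 ^+ n * x)) * (Psi (2 ^+ n * x) / Psi x).
  by rewrite mulrA divfK // lt0r_neq0.
have -> : Psi ((2 * C) ^+ n.+1 * y) / Psi y =
  (Psi ((2 * C) ^+ n.+1 * y) / Psi ((2 * C) ^+ n * y)) * (Psi ((2 * C) ^+ n * y) / Psi y).
  by rewrite mulrA divfK // lt0r_neq0.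
have g0 z w : 0 <= z -> 0 <= w -> 0 <= Psi z / Psi w.
  by move=> z0 w0; rewrite divr_ge0 ?(orlicz_ge0 oP).
by apply: ler_pM => //; apply: g0; rewrite ?mulr_ge0 ?exprn_ge0 ?(ltW x_gt0) ?(ltW u1).
Qed.

(** For t <= h let x <= y be the inverses at 1 / h and 1 / t. As Psi x = 1 / h and Psi y = 1 / t,
    the iterated ratio inequality reads Psi (A x) h <= Psi (A' y) t. *)
Lemma nabla0_rho_cond_K : nabla0 Psi -> rho_cond Psi Psi mu -> K_cond Psi Psi mu.
Proof.
move=> [x0 [C [x00 C1 H]]] RC A A0 eps eps0.
have [n An] : exists n : nat, A <= 2 ^+ n.
  exists (Num.truncn A).+1; apply: le_trans (ltW (Num.Theory.truncnS_gt A)) _.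
  by rewrite -natrX ler_nat ltnW // ltn_expl.
pose A' : R := (2 * C) ^+ n.
have A'0 : 0 < A' by rewrite exprn_gt0 //; lra.
have [d [d0 hd]] := RC A' A'0 eps eps0.
have P0 := orlicz_gt0 oP x00.
(* The second entry ensures x0 <= x, the range where [nabla0] holds. *)
exists (Num.min d (Psi x0)^-1); split; first by rewrite lt_min d0 invr_gt0.
move=> h /andP[h0]; rewrite lt_min => /andP[hd' hx0].
apply: ge_ereal_sup => _ [t /andP[t0 th] <-].
have hV : 0 <= h^-1 by rewrite invr_ge0 ltW.
have tV : 0 <= t^-1 by rewrite invr_ge0 ltW.
have ht : h^-1 <= t^-1 by rewrite lef_pV2 ?posrE.
have [_ xE] := orlicz_invP oP hV; have [_ yE] := orlicz_invP oP tV.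
have x_gt0 := orlicz_inv_gt0 oP (ltac:(by rewrite invr_gt0) : 0 < h^-1).
set x := orlicz_inv Psi h^-1 in xE x_gt0 *; set y := orlicz_inv Psi t^-1 in yE.
have xy : x <= y by apply: (orlicz_inv_ge oP) => //; [exact: ltW|rewrite xE].
have x0x : x0 <= x.
  apply: (orlicz_inv_ge oP); first exact: ltW.
  by rewrite -[leLHS]invrK lef_pV2 ?posrE ?invr_gt0 // ltW.
rewrite lee_pdivrMr //; apply: le_trans (hd t _) _; first by rewrite t0 (le_lt_trans th).
rewrite -/y -EFinM lee_fin -mulrA ler_wpM2l ?(ltW eps0) //.
have y_gt0 : 0 < y by lra.
have := nabla0_iter x00 C1 H n x0x xy; rewrite -/A' xE yE => it.
have PA : 0 < Psi (A * x) by apply: (orlicz_gt0 oP); exact: mulr_gt0.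
have PA' : 0 < Psi (A' * y) by apply: (orlicz_gt0 oP); exact: mulr_gt0.
have PAn : Psi (A * x) <= Psi (2 ^+ n * x).
  by apply: (orlicz_mono oP); rewrite ?mulr_ge0 ?(ltW A0) ?(ltW x_gt0) // ler_wpM2r // ltW.
rewrite !invrK in it.
rewrite ler_pdivrMr // [leRHS]mulrAC -mulrA mulrAC ler_pdivlMr // mul1r.
have le1 : Psi (A * x) * h <= Psi (A' * y) * t.
  by apply: le_trans it; rewrite ler_wpM2r // ltW.
by rewrite [leRHS]mulrC ler_pdivlMr.
Qed.

(** Centres spaced by [h] up to 8 >= 2 pi; an angle g lies within [h] of the multiple of h given by
    the integer part of g / h. *)
Lemma circle_window_cover (h : R) : 0 < h < 1 ->
  @ucircle R `<=` \big[setU/set0]_(k < (Num.truncn (8 / h)).+1) window (k%:R * h) h.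
Proof.
move=> /andP[h0 h1] q q1; rewrite -(bigcup_mkord _ (fun k => window (k%:R * h) h)).
have [g /andP[g0 g2] qE] := polar_2pi (toC q).
have p4 := pihalf_02 R; have g8 : g <= 8 by lra.
have gh : 0 <= g / h by rewrite divr_ge0 // ltW.
have /andP[k1 k2] := Num.Theory.truncn_itv gh.
exists (Num.truncn (g / h)).
  by rewrite /= ltnS; apply: le_truncn; rewrite ler_pM2r ?invr_gt0.
split; first by rewrite q1 lexx andbT; lra.
exists g; split=> //.
rewrite ler_pdivlMr // in k1; rewrite ltr_pdivrMr // -natr1 mulrDl mul1r in k2.
by rewrite ger0_norm; lra.
Qed.

Lemma rho_cond_circle_null : rho_cond Psi Psi mu -> mu (@ucircle R) = 0%E.
Proof.
move=> RC; apply/eqP; rewrite eq_le measure_ge0 andbT; apply/lee_addgt0Pr => /= e e0.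
(* At A = 1 the function and its inverse cancel, so each window has mass at most (e / 9) h. The N +
   1 windows satisfy N h <= 8 and h <= 1, hence the 9. *)
rewrite add0e; have [d [d0 hd]] := RC 1 ltr01 (e / 9) ltac:(lra).
pose h := Num.min d 1 / 2; have m0 : 0 < Num.min d 1 by rewrite lt_min d0 ltr01.
have md : Num.min d 1 <= d by rewrite ge_min lexx.
have m1 : Num.min d 1 <= 1 by rewrite ge_min lexx orbT.
have h01 : 0 < h < 1 by rewrite /h; lra.
have hdd : 0 < h < d by rewrite /h; lra.
have := hd h hdd; have /andP[h0 h1] := h01.
have hV : 0 <= h^-1 by rewrite invr_ge0 ltW.
have [_ iE] := orlicz_invP oP hV; rewrite !mul1r iE invrK => rh.
apply: le_trans (@content_subadditive _ _ _ mu _ (fun k => window (k%:R * h) h) _ _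
  (@measurable_ucircle R) (circle_window_cover h01)) _.
  by move=> k _; exact: measurable_window.
apply: (@le_trans _ _ (\sum_(k < (Num.truncn (8 / h)).+1) (e / 9 * h)%:E)%E).
  apply: lee_sum => k _; apply: le_trans rh; apply: ereal_sup_ubound; by exists (k%:R * h).
rewrite sumEFin lee_fin sumr_const card_ord -[X in X <= _]mulr_natr.
have h8 : 0 <= 8 / h by rewrite divr_ge0 // ltW.
have /andP[k1 _] := Num.Theory.truncn_itv h8; set N := Num.truncn _ in k1 *.
rewrite ler_pdivlMr // in k1; rewrite -[N.+1%:R]natr1.
have e9 : 0 <= e / 9 by lra.
have : e / 9 * (N%:R * h + h) <= e / 9 * 9 by rewrite ler_wpM2l //; lra.
have -> : e / 9 * h * (N%:R + 1) = e / 9 * (N%:R * h + h) by ring.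
by rewrite divfK.
Qed.

End CarlesonFunctions.

Theorem mainTheorem11 (R : realType)
  (mu : {finite_measure set (R * R)%type -> \bar R})
  (Psi1 Psi2 : R -> R) :
  mu (~` @cdisc R) = 0%E ->
  orlicz Psi1 -> orlicz Psi2 ->
  [/\ (compact_embedding Psi1 Psi2 mu -> rho_cond Psi1 Psi2 mu),
      (mu (@ucircle R) = 0%E -> K_cond Psi1 Psi2 mu ->
         compact_embedding Psi1 Psi2 mu) &
      (Psi1 = Psi2 -> nabla0 Psi1 ->
         (compact_embedding Psi1 Psi1 mu <-> rho_cond Psi1 Psi1 mu) /\
         (rho_cond Psi1 Psi1 mu <-> K_cond Psi1 Psi1 mu))].
Proof.
move=> _ o1 o2; split; first exact: necessity.
  by move=> c0 KC; exact: sufficiency.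
move=> _ n1; have rK := nabla0_rho_cond_K o1 n1.
split; last by split; [exact: rK|exact: K_cond_rho].
split=> [|RC]; first exact: necessity.
(* The condition on [rho] provides both inputs of the sufficiency argument: [K_cond] through
   [nabla0], and the null circle. *)
exact: (sufficiency o1 o1 (rK mu RC) (rho_cond_circle_null o1 RC)).
Qed.
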